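(* Let $q$ be any prime power. Then for every integer $n \geq 0$ the following four numbers are equal: (1) the number of real conjugacy classes of $\mathrm{PGL}(n,\mathbb{F}_q)$; (2) the number of real conjugacy classes of $\mathrm{GL}(n,\mathbb{F}_q)$ which are contained in $\mathrm{SL}(n,\mathbb{F}_q)$; (3) the number of real conjugacy classes of $\mathrm{PGU}(n,\mathbb{F}_q)$; (4) the number of real conjugacy classes of $\mathrm{U}(n,\mathbb{F}_q)$ which are contained in $\mathrm{SU}(n,\mathbb{F}_q)$. Moreover, letting $e = \gcd(q-1,2)$ and letting $c_n$ denote this common number, the generating function $\sum_{n\ge 0} c_n u^n$ is $$\frac{1}{2}\left(\prod_{i=1}^{\infty}\frac{(1+u^i)^e}{1-qu^{2i}} + \prod_{i=1}^{\infty}\frac{1+u^{ei}}{1-qu^{2i}}\right).$$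
   Context: An element $g$ of a group $G$ is real if $g$ is conjugate to $g^{-1}$ in $G$; a conjugacy class of $G$ is real if its elements are real. (In (2) and (4), realness is in $\mathrm{GL}(n,\mathbb{F}_q)$, respectively $\mathrm{U}(n,\mathbb{F}_q)$, and one counts $\mathrm{GL}(n,\mathbb{F}_q)$-classes, respectively $\mathrm{U}(n,\mathbb{F}_q)$-classes.) $\mathrm{U}(n,\mathbb{F}_q)$ is the group of $g=(a_{ij})\in\mathrm{GL}(n,\mathbb{F}_{q^2})$ with $g = {}^{\top}(a_{ij}^q)^{-1}$ (so its elements have entries in $\mathbb{F}_{q^2}$). $\mathrm{SU}(n,\mathbb{F}_q)$ is its subgroup of determinant $1$ elements. Its center is the group of scalar matrices with scalar in $C_{q+1}$, the subgroup of order $q+1$ of $\mathbb{F}_{q^2}^{\times}$, and $\mathrm{PGU}(n,\mathbb{F}_q)=\mathrm{U}(n,\mathbb{F}_q)/C_{q+1}$. Likewise $\mathrm{PGL}(n,\mathbb{F}_q)=\mathrm{GL}(n,\mathbb{F}_q)/\mathbb{F}_q^{\times}$. When $n=0$ all of these groups are taken to be the group with one element. *)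

(* Defs.v *)
From mathcomp Require Import all_boot all_order all_algebra all_fingroup all_solvable all_field.

Set Implicit Arguments.
Unset Strict Implicit.
Unset Printing Implicit Defensive.

Import GRing.Theory.
Local Open Scope ring_scope.

Section Real.
Variable gT : finGroupType.
Implicit Types G C : {set gT}.

Definition real_elt G (g : gT) : bool := (g^-1 \in g ^: G)%g.
Definition real_class G C : bool := [forall g in C, real_elt G g].
Definition real_classes G : {set {set gT}} :=
  [set C in classes G | real_class G C].
Definition real_classes_in G (S : {set gT}) : {set {set gT}} :=
  [set C in real_classes G | C \subset S].

End Real.

Section Linear.
Variables (n : nat) (F : finFieldType).

(* {'GL_0[F]} is by construction {'GL_1[F]}, hence the case distinction: all
   the groups below live inside GLn and so are trivial when n = 0. *)
Definition GLn : {group {'GL_n[F]}} := if n == 0%N then 1%G else 'GL_n[F]%G.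

Definition SLn : {set {'GL_n[F]}} := [set g in GLn | \det (GLval g) == 1].

Definition scalarGL : {set {'GL_n[F]}} :=
  [set g in GLn | [exists a : F, (a != 0) && (GLval g == a%:M)]].

Lemma scalarGL_group_set : group_set scalarGL.
Proof.
apply/group_setP; split=> [|g h].
  rewrite inE group1; apply/existsP; exists 1.
  by rewrite oner_eq0 GL_1E /= eqxx.
rewrite !inE => /andP[Gg /existsP[a /andP[a0 /eqP ga]]].
move=> /andP[Gh /existsP[b /andP[b0 /eqP hb]]]; rewrite groupM //.
apply/existsP; exists (a * b).
by rewrite mulf_neq0 // GL_MxE ga hb -scalar_mxM eqxx.
Qed.
Canonical scalarGL_group := Group scalarGL_group_set.

Definition PGLn := (GLn / scalarGL)%g.

End Linear.

Section Unitary.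
(* Meant for #|K| = q ^ 2, so that x |-> x ^+ q is the involution of K. *)
Variables (q n : nat) (K : finFieldType).

Definition Un : {set {'GL_n[K]}} :=
  [set g in GLn n K | GLval g == invmx (map_mx (fun x => x ^+ q) (GLval g))^T].

Definition SUn : {set {'GL_n[K]}} := [set g in Un | \det (GLval g) == 1].

Definition scalarU : {set {'GL_n[K]}} :=
  [set g in GLn n K |
    [exists a : K, (a ^+ q.+1 == 1) && (GLval g == a%:M)]].

Lemma scalarU_group_set : group_set scalarU.
Proof.
apply/group_setP; split=> [|g h].
  rewrite inE group1; apply/existsP; exists 1.
  by rewrite expr1n GL_1E /= !eqxx.
rewrite !inE => /andP[Gg /existsP[a /andP[/eqP a1 /eqP ga]]].
move=> /andP[Gh /existsP[b /andP[/eqP b1 /eqP hb]]]; rewrite groupM //.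
apply/existsP; exists (a * b).
by rewrite exprMn a1 b1 mulr1 GL_MxE ga hb -scalar_mxM !eqxx.
Qed.
Canonical scalarU_group := Group scalarU_group_set.

Definition PGUn := (Un / scalarU)%g.

Lemma Un_group_set : #|K| = (q ^ 2)%N -> group_set Un.
Proof.
move=> cardK; have [p p_pr pK] := finPcharP K.
have q_nat : [pchar K].-nat q.
  rewrite (eq_pnat _ (pcharf_eq pK)).
  have /abelem_pgroup : (p.-abelem [set: K])%g by apply: fin_ring_pchar_abelem.
  by rewrite /pgroup cardsT cardK pnatX orbF.
have q_gt0 : (0 < q)%N by case/andP: q_nat.
pose phi (A : 'M[K]_n.-1.+1) := map_mx (fun x => x ^+ q) A.
have phiM A B : phi (A *m B) = phi A *m phi B.
  apply/matrixP=> i j; rewrite !mxE.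
  rewrite (big_morph _ (fun x y => exprDn_pchar x y q_nat) (_ : 0 ^+ q = 0)).
    by apply: eq_bigr => k _; rewrite !mxE exprMn.
  by rewrite expr0n eqn0Ngt q_gt0.
have phi1 : phi 1%:M = 1%:M.
  apply/matrixP=> i j; rewrite !mxE; case: (i == j); first exact: expr1n.
  by rewrite expr0n eqn0Ngt q_gt0.
apply/group_setP; split=> [|g h].
  by rewrite inE group1 /= -[map_mx _ _]/(phi 1%:M) phi1 trmx1 invmx1.
rewrite !inE => /andP[Gg /eqP gE] /andP[Gh /eqP hE]; rewrite groupM //.
have phi_unit (x : {'GL_n[K]}) : (phi (GLval x))^T \in unitmx.
  have /mulmx1_unit[] : phi (GLval x) *m phi (GLval x^-1%g) = 1%:M.
    by rewrite -phiM -GL_MxE mulgV GL_1E phi1.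
  by rewrite unitmx_tr.
rewrite (GL_MxE g h) -[map_mx _ _]/(phi _) phiM trmx_mul.
rewrite andTb [invmx _](invrM (phi_unit h) (phi_unit g)).
by apply/eqP; congr (_ *m _).
Qed.

End Unitary.

Section PowerSeries.

(* f represents \sum_n (f n) u^n. *)
Definition fps := nat -> rat.
Implicit Types f g : fps.

Definition fps_poly (p : {poly rat}) : fps := fun n => p`_n.

Definition fps_mul f g : fps := fun n => \sum_(i < n.+1) f i * g (n - i)%N.

(* The first n coefficients of 1 / f, obtained by solving f * h = 1. *)
Fixpoint fps_inv_seq f (n : nat) : seq rat :=
  if n is m.+1 then
    let s := fps_inv_seq f m in
    rcons s (((m == 0%N)%:R - \sum_(j < m) f (m - j)%N * s`_j) / f 0%N)
  else [::].

Definition fps_inv f : fps := fun n => (fps_inv_seq f n.+1)`_n.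

Lemma fps_mulV f : f 0%N != 0 -> fps_mul f (fps_inv f) =1 fps_poly 1.
Proof.
move=> f0 n.
have sz m : size (fps_inv_seq f m) = m by elim: m => //= m IH; rewrite size_rcons IH.
have nthS m j : (j < m)%N -> (fps_inv_seq f m)`_j = fps_inv f j.
  elim: m => // m IH; rewrite ltnS leq_eqVlt => /predU1P[-> //|lt_jm].
  by rewrite /= nth_rcons sz lt_jm IH.
have invE : fps_inv f n = ((n == 0%N)%:R - \sum_(j < n) f (n - j)%N * fps_inv f j) / f 0%N.
  rewrite {1}/fps_inv /= nth_rcons sz ltnn eqxx; congr ((_ - _) / _).
  by apply: eq_bigr => j _; rewrite nthS.
rewrite /fps_mul (reindex_inj rev_ord_inj) /= big_ord_recr /=.
rewrite subSS subnn subn0 invE mulrC divfK // addrC.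
under eq_bigr => j _.
  rewrite subSS subKn; last exact: ltnW.
  over.
by rewrite subrK /fps_poly coef1.
Qed.

(* \prod_(i >= 1) f i = g, for coefficientwise convergence: each coefficient of
   the partial products is eventually constant. *)
Definition fps_infprod (f : nat -> fps) g : Prop :=
  forall k, exists N, forall m, (N <= m)%N ->
    (\big[fps_mul/fps_poly 1]_(1 <= i < m.+1) f i) k = g k.

(* p / r as a power series; meaningful when r`_0 != 0. *)
Definition fps_frac (p r : {poly rat}) : fps :=
  fps_mul (fps_poly p) (fps_inv (fps_poly r)).

End PowerSeries.

(* Main.v *)
(* Over a finite field, a conjugacy class of GL_n is recorded by the quotients
   y_0, y_1, ... of its successive invariant factors: monic polynomials with
   nonzero constant terms and \sum_i (n - i) deg y_i = n.  The class of mu g^-1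
   is recorded by the mu-reciprocals of the y_i, so classes fixed by
   g |-> mu g^-1 are counted by \prod_i L(X^i), where L counts the
   mu-reciprocal monic polynomials by degree.  By Hilbert 90 and a norm argument
   in centralizers, the classes of U_n are the classes of GL_n over the quadratic
   extension fixed by conjugate transpose inverse.

   Counting pairs (g, h) with g^h g in a central subgroup Z shows that the number
   of real classes of G / Z is the average over z in Z of the number of classes
   of G fixed by g |-> z g^-1.  In odd characteristic half of the scalars are
   squares, for which L(t) = (1 + t)^2 / (1 - q t^2), and half are not, for which
   L(t) = (1 + t^2) / (1 - q t^2); this gives the two products.  Real classes of
   determinant 1 are counted by averaging 1 and the determinant, and the
   resulting signed product equals the second one by Euler's identity. *)
Require Import Defs.
From mathcomp Require Import all_boot all_order all_algebra all_fingroup all_solvable all_field.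
From mathcomp Require Import zify ring.
From Stdlib Require Import Classical_Prop.

Set Implicit Arguments.
Unset Strict Implicit.
Unset Printing Implicit Defensive.

Import GRing.Theory.
Local Open Scope ring_scope.

(** * Invariant factors *)

(** U_n runs parallel to GL_n because the same numbers of polynomials occur. A quotient y_i of a
    unitary class fixed by g -> mu g^-1 obeys two symmetries, mu-reciprocality and self-adjointness;
    together they confine each coefficient to a line over F_q inside F_{q^2}, so half of the
    coefficients again range over sets of size q. The constant term lies in a group H, the units of
    F_q or the elements of norm 1, and L depends on mu only through the number of square roots of mu
    in H. That number is 1 on average over H, which is what weights the two products by 1/2. In
    characteristic 2 squaring is bijective on H, every mu gives L(t) = (1 + t) / (1 - q t^2), and
    real classes automatically have determinant 1. The sign of the determinant sees y_i only when
    its multiplicity n - i is odd. There the odd degrees cancel, leaving (1 - t^2) / (1 - q t^2),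
    while even multiplicities keep (1 + t)^2 / (1 - q t^2); this mixture is the signed product.
    Uniqueness of types is drawn from the ranks of p(A) rather than from similarity, so that a
    matrix and its transpose visibly share their type. *)

Lemma ex_min_nat (P : nat -> Prop) :
  (exists n, P n) -> exists2 n, P n & forall m, (m < n)%N -> ~ P m.
Proof.
case=> n; elim/ltn_ind: n => n IH Pn.
case: (classic (exists2 m, (m < n)%N & P m)) => [[m /IH]|noP]; first by apply.
by exists n => // m lt_mn Pm; apply: noP; exists m.
Qed.

Section HornerMatrix.
Variable F : fieldType.

(* [horner_mx] needs a positive size; the empty matrices arise here as empty
   companion blocks. *)
Definition hmx n : 'M[F]_n -> {poly F} -> 'M[F]_n :=
  if n is n'.+1 then fun A p => horner_mx A p else fun _ _ => 0.

Variable n : nat.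
Implicit Types (A B : 'M[F]_n) (p q : {poly F}).

Lemma hmxD A p q : hmx A (p + q) = hmx A p + hmx A q.
Proof. by case: n A => [|m] A; rewrite /= ?addr0 ?rmorphD. Qed.

Lemma hmxM A p q : hmx A (p * q) = hmx A p *m hmx A q.
Proof. by case: n A => [|m] A; rewrite /= ?mulmx0 ?rmorphM. Qed.

Lemma hmxC A c : hmx A c%:P = c%:M.
Proof. by case: n A => [|m] A; rewrite ?[c%:M]flatmx0 //; apply: horner_mx_C. Qed.

Lemma hmxX A : hmx A 'X = A.
Proof. by case: n A => [|m] A; rewrite ?[A in RHS]flatmx0 //; apply: horner_mx_X. Qed.

Lemma hmx0 A : hmx A 0 = 0.
Proof. by rewrite -[0]/(0%:P) hmxC raddf0. Qed.

Lemma hmx1 A : hmx A 1 = 1%:M.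
Proof. exact: hmxC. Qed.

Lemma hmxZ A c p : hmx A (c *: p) = c *: hmx A p.
Proof. by rewrite -mul_polyC hmxM hmxC mul_scalar_mx. Qed.

Lemma hmx_sum A (I : Type) (r : seq I) (P : pred I) (f : I -> {poly F}) :
  hmx A (\sum_(i <- r | P i) f i) = \sum_(i <- r | P i) hmx A (f i).
Proof. exact: (big_morph (hmx A) (hmxD A) (hmx0 A)). Qed.

Lemma hmx_comm A p q : hmx A p *m hmx A q = hmx A q *m hmx A p.
Proof. by rewrite -!hmxM mulrC. Qed.

Lemma hmx_char_poly A : hmx A (char_poly A) = 0.
Proof.
by case: n A => [|m] A //; apply: Cayley_Hamilton.
Qed.

End HornerMatrix.

Lemma hmx_block (F : fieldType) m n (A : 'M[F]_m) (B : 'M[F]_n) p :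
  hmx (block_mx A 0 0 B) p = block_mx (hmx A p) 0 0 (hmx B p).
Proof.
elim/poly_ind: p => [|p c IH]; first by rewrite !hmx0 block_mx0.
rewrite !hmxD !hmxM !hmxC !hmxX IH mulmx_block !mulmx0 !mul0mx !addr0 add0r.
by rewrite scalar_mx_block add_block_mx !addr0.
Qed.

(** * F^n as an F[X]-module: generators, relations and the invariant factor decomposition *)

Section Presentation.
Variables (F : fieldType) (n : nat) (A : 'M[F]_n).

(** The F[X]-linear combination of the [v j] with coefficients [p j], where X acts on row vectors as
    [A]. *)
Definition lc k (v : 'I_k -> 'rV[F]_n) (p : 'I_k -> {poly F}) : 'rV[F]_n :=
  \sum_j v j *m hmx A (p j).

Definition spanned k (v : 'I_k -> 'rV[F]_n) (w : 'rV[F]_n) :=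
  exists p, w = lc v p.

(* [p |-> lc v p] induces an isomorphism from the direct sum of the
   F[X]/(D j) onto F^n, X acting on the latter as A *)
Definition presents k (v : 'I_k -> 'rV[F]_n) (D : 'I_k -> {poly F}) :=
  (forall w, spanned v w) /\
  (forall p, lc v p = 0 <-> forall j, D j %| p j).

Definition presented k (D : 'I_k -> {poly F}) := exists v, presents v D.

Definition dvd_chain k (D : 'I_k -> {poly F}) :=
  forall i j : 'I_k, (i <= j)%N -> D i %| D j.

Section Lc.
Variables (k : nat) (v : 'I_k -> 'rV[F]_n).
Implicit Types p q : 'I_k -> {poly F}.

Lemma eq_lc p q : p =1 q -> lc v p = lc v q.
Proof. by move=> pq; apply: eq_bigr => j _; rewrite pq. Qed.

Lemma lcD p q : lc v (fun j => p j + q j) = lc v p + lc v q.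
Proof. by rewrite -big_split; apply: eq_bigr => j _; rewrite hmxD mulmxDr. Qed.

Lemma lcM p r : lc v (fun j => p j * r) = lc v p *m hmx A r.
Proof. by rewrite /lc mulmx_suml; apply: eq_bigr => j _; rewrite hmxM mulmxA. Qed.

Lemma lcZ c p : lc v (fun j => c *: p j) = c *: lc v p.
Proof. by rewrite /lc scaler_sumr; apply: eq_bigr => j _; rewrite hmxZ scalemxAr. Qed.

Lemma lcB p q : lc v (fun j => p j - q j) = lc v p - lc v q.
Proof.
rewrite (lcD p (fun j => - q j)) -scaleN1r -lcZ.
by congr (_ + _); apply: eq_lc => j; rewrite scaleN1r.
Qed.

Lemma lc_sum (I : finType) (f : I -> 'I_k -> {poly F}) :
  lc v (fun j => \sum_i f i j) = \sum_i lc v (f i).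
Proof.
rewrite /lc exchange_big; apply: eq_bigr => j _.
by rewrite hmx_sum mulmx_sumr.
Qed.

Lemma lc0 : lc v (fun=> 0) = 0.
Proof. by rewrite /lc big1 // => j _; rewrite hmx0 mulmx0. Qed.

Lemma lc_delta j r : lc v (fun i => if i == j then r else 0) = v j *m hmx A r.
Proof.
rewrite /lc (bigD1 j) //= eqxx big1 ?addr0 // => i /negPf->.
by rewrite hmx0 mulmx0.
Qed.

Lemma spannedD w w' : spanned v w -> spanned v w' -> spanned v (w + w').
Proof. by case=> p -> [q ->]; rewrite -lcD; exists (fun j => p j + q j). Qed.

Lemma spanned0 : spanned v 0.
Proof. by exists (fun=> 0); rewrite lc0. Qed.

Lemma spannedM w r : spanned v w -> spanned v (w *m hmx A r).
Proof. by case=> p ->; rewrite -lcM; exists (fun j => p j * r). Qed.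

Lemma spanned_sum (I : finType) (w : I -> 'rV[F]_n) :
  (forall i, spanned v (w i)) -> spanned v (\sum_i w i).
Proof. by move=> vw; apply: (big_ind _ spanned0 spannedD). Qed.

Lemma spanned_gen j : spanned v (v j).
Proof.
by exists (fun i => if i == j then 1 else 0); rewrite lc_delta hmx1 mulmx1.
Qed.

End Lc.

Definition subspan k m (v : 'I_k -> 'rV[F]_n) (v' : 'I_m -> 'rV[F]_n) :=
  forall j, spanned v' (v j).

Lemma subspanP k m (v : 'I_k -> 'rV[F]_n) (v' : 'I_m -> 'rV[F]_n) w :
  subspan v v' -> spanned v w -> spanned v' w.
Proof. by move=> vv' [p ->]; apply: spanned_sum => j; apply: spannedM. Qed.

Definition eqspan k (v v' : 'I_k -> 'rV[F]_n) := subspan v v' /\ subspan v' v.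

Lemma eqspan_refl k (v : 'I_k -> 'rV[F]_n) : eqspan v v.
Proof. by split=> j; apply: spanned_gen. Qed.

Lemma eqspan_trans k (v v' v'' : 'I_k -> 'rV[F]_n) :
  eqspan v v' -> eqspan v' v'' -> eqspan v v''.
Proof. by case=> a b [c d]; split=> j; [apply: subspanP (a j) | apply: subspanP (d j)]. Qed.

Definition cons_fun T k (x : T) (f : 'I_k -> T) (i : 'I_k.+1) : T :=
  if unlift ord0 i is Some j then f j else x.

Lemma cons_fun0 T k (x : T) (f : 'I_k -> T) : cons_fun x f ord0 = x.
Proof. by rewrite /cons_fun unlift_none. Qed.

Lemma cons_funS T k (x : T) (f : 'I_k -> T) j : cons_fun x f (lift ord0 j) = f j.
Proof. by rewrite /cons_fun liftK. Qed.

Lemma subspan_cons k x (u : 'I_k -> 'rV[F]_n) : subspan u (cons_fun x u).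
Proof. by move=> j; rewrite -(cons_funS x u j); apply: spanned_gen. Qed.

Lemma lc_cons k (v : 'I_k.+1 -> 'rV[F]_n) p :
  lc v p = v ord0 *m hmx A (p ord0)
           + lc (fun j => v (lift ord0 j)) (fun j => p (lift ord0 j)).
Proof. by rewrite /lc big_ord_recl. Qed.

Lemma ord_caseP k (P : 'I_k.+1 -> Prop) :
  P ord0 -> (forall j, P (lift ord0 j)) -> forall i, P i.
Proof. by move=> P0 PS i; case: (unliftP ord0 i) => [j|] ->. Qed.

(** An elementary change of generators. Relations transform the opposite way: by [lc_shear], (d, r)
    is a relation of the new family when (d, q d + r) is one of the old, so a shear performs
    division by d. *)
Definition shear k (v : 'I_k.+1 -> 'rV[F]_n) (q : 'I_k -> {poly F}) :=
  cons_fun (v ord0 + lc (fun j => v (lift ord0 j)) q) (fun j => v (lift ord0 j)).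

Lemma eqspan_shear k (v : 'I_k.+1 -> 'rV[F]_n) q : eqspan v (shear v q).
Proof.
have tail w : spanned (fun j => v (lift ord0 j)) w -> spanned (shear v q) w.
  by apply: subspanP; apply: subspan_cons.
have tail' : spanned v (lc (fun j => v (lift ord0 j)) q).
  apply: (@subspanP _ _ (fun j => v (lift ord0 j))); last by exists q.
  by move=> j; apply: spanned_gen.
split; apply: ord_caseP => [|j].
- have -> : v ord0 = shear v q ord0 + lc (fun j => v (lift ord0 j)) (fun j => q j * (-1)%:P).
    by rewrite lcM hmxC mul_mx_scalar scaleN1r /shear cons_fun0 addrK.
  by apply: spannedD; [apply: spanned_gen | apply: tail; eexists].
- by apply: tail; apply: (spanned_gen (fun j => v (lift ord0 j))).
- by rewrite /shear cons_fun0; apply: spannedD => //; apply: spanned_gen.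
- by rewrite /shear cons_funS; apply: spanned_gen.
Qed.

Lemma lc_shear k (v : 'I_k.+1 -> 'rV[F]_n) q d r :
  lc (shear v q) (cons_fun d r) = lc v (cons_fun d (fun j => q j * d + r j)).
Proof.
rewrite !lc_cons /shear !cons_fun0 mulmxDl -lcM -addrA; congr (_ + _).
rewrite -[in RHS](@eq_lc _ _ (fun j => q j * d + r j)) => [|j]; last by rewrite cons_funS.
rewrite lcD; congr (_ + _).
by apply: eq_bigr => j _; rewrite !cons_funS.
Qed.

(* Among all relations between generating families of the given submodule,
   take one with a nonzero coefficient d of least degree: division by d, realized
   by shears, splits off a cyclic summand F[X]/(d), and d divides all the rest. *)
Lemma invariant_factors k (v : 'I_k -> 'rV[F]_n) :
  exists v' D, [/\ eqspan v v', dvd_chain D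
    & forall p, lc v' p = 0 <-> forall j, D j %| p j].
Proof.
elim: k v => [|k IH] v.
  exists v, (fun=> 0); split; [exact: eqspan_refl | by case | move=> p].
  by split=> [_ []//|_]; rewrite /lc big_ord0.
(* Not a decidable predicate, hence the classical minimum. Cayley-Hamilton shows that it is
   inhabited. *)
pose Rel m := exists v' p j, [/\ eqspan v v', lc v' p = 0, p j != 0 & size (p j) = m].
have [|m [v1 [p1 [j1 [vv1 p1v1 nz_p1 sz_p1]]]] minm] := @ex_min_nat Rel.
  exists (size (char_poly A)), v, (fun=> char_poly A), ord0; split=> //.
  - exact: eqspan_refl.
  - by rewrite /lc big1 // => j _; rewrite hmx_char_poly mulmx0.
  - exact: monic_neq0 (char_poly_monic _).
have min_rel v' p j : eqspan v v' -> lc v' p = 0 -> (size (p j) < m)%N -> p j = 0.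
  move=> vv' pv' ltm; have [//|nzp] := eqVneq (p j) 0.
  by case: (minm _ ltm); exists v', p, j.
(* A shear by the quotients replaces each other coefficient by its remainder modulo d, which
   minimality forces to be 0. *)
have dvd_rel v' d p : eqspan v v' -> lc v' (cons_fun d p) = 0 -> d != 0 -> size d = m ->
    forall j, d %| p j.
  move=> vv' pv' nzd szd j; rewrite /dvdp; apply/eqP.
  have := min_rel (shear v' (fun j => p j %/ d)) (cons_fun d (fun j => p j %% d)) (lift ord0 j).
  rewrite cons_funS; apply.
  - by apply: eqspan_trans vv' _; apply: eqspan_shear.
  - rewrite lc_shear -[RHS]pv'; apply: eq_lc; apply: ord_caseP => [|i].
      by rewrite !cons_fun0.
    by rewrite !cons_funS -divp_eq.
  - by rewrite -szd ltn_modp.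
pose t : {perm 'I_k.+1} := tperm ord0 j1.
pose d := p1 j1.
pose v2 i := v1 (t i); pose p2 i := p1 (t (lift ord0 i)).
have v1v2 : eqspan v v2.
  apply: eqspan_trans vv1 _; split=> j; last exact: spanned_gen.
  by have := spanned_gen v2 (t j); rewrite /v2 tpermK.
have d_rel : lc v2 (cons_fun d p2) = 0.
  rewrite -[RHS]p1v1 [RHS](reindex_inj (@perm_inj _ t)) /=.
  apply: eq_bigr => j _; congr (_ *m hmx A _); move: j.
  by apply: ord_caseP => [|j]; rewrite ?cons_fun0 ?cons_funS // tpermL.
have d_p2 := dvd_rel _ _ _ v1v2 d_rel nz_p1 sz_p1.
(* All remainders being 0, the sheared relation reads d v_0 = 0. *)
pose v3 := shear v2 (fun j => p2 j %/ d).
have vv3 : eqspan v v3 by apply: eqspan_trans v1v2 (eqspan_shear _ _).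
have v3d : v3 ord0 *m hmx A d = 0.
  have : lc v3 (cons_fun d (fun=> 0)) = 0.
    rewrite lc_shear -[RHS]d_rel; apply: eq_lc; apply: ord_caseP => [|j].
      by rewrite !cons_fun0.
    by rewrite !cons_funS addr0 divpK.
  rewrite lc_cons cons_fun0 -[X in _ + X](@eq_lc _ _ (fun=> 0)) ?lc0 ?addr0 // => j.
  by rewrite cons_funS.
have [u [D [uu chD kerD]]] := IH (fun j => v3 (lift ord0 j)).
pose v4 := cons_fun (v3 ord0) u.
have vv4 : eqspan v v4.
  apply: eqspan_trans vv3 _; case: uu => uu1 uu2.
  have tailE w : spanned u w -> spanned v4 w.
    by apply: subspanP; apply: subspan_cons.
  split; apply: ord_caseP => [|j].
  - by rewrite -[v3 ord0](cons_fun0 _ u); apply: spanned_gen.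
  - exact: tailE.
  - by rewrite /v4 cons_fun0; apply: spanned_gen.
  - rewrite /v4 cons_funS; apply: subspanP (uu2 j) => i; exact: spanned_gen.
have lc4 p : lc v4 p = v3 ord0 *m hmx A (p ord0) + lc u (fun j => p (lift ord0 j)).
  rewrite lc_cons /v4 cons_fun0; congr (_ + _); apply: eq_bigr => j _.
  by rewrite cons_funS.
(* The relations d v_0 = 0 and D_j u_j = 0 add up to one that contains d, to which [dvd_rel]
   applies. *)
have d_D j : d %| D j.
  have kD : lc v4 (cons_fun d (fun i => if i == j then D j else 0)) = 0.
    rewrite lc4 cons_fun0 v3d add0r.
    by apply/kerD => i; rewrite cons_funS; case: eqP => [->|].
  by have := dvd_rel _ _ _ vv4 kD nz_p1 sz_p1 j; rewrite eqxx.
exists v4, (cons_fun d D); split=> // [|p].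
  apply: ord_caseP => [|i]; apply: ord_caseP => [|j]; rewrite ?cons_fun0 ?cons_funS //.
  exact: chD.
split=> [pv4|].
  have := pv4; rewrite lc4 {1}(divp_eq (p ord0) d) hmxD hmxM hmx_comm mulmxDr mulmxA v3d.
  rewrite mul0mx add0r => pv4'.
  (* Since d kills v_0, the first coefficient matters only modulo d; the remainder is too small to
     occur in a relation unless it is 0. *)
  have r0 : p ord0 %% d = 0.
    have := min_rel v4 (cons_fun (p ord0 %% d) (fun j => p (lift ord0 j))) ord0 vv4.
    rewrite lc4 cons_fun0 -sz_p1 ltn_modp; apply => //.
    by rewrite -[RHS]pv4'; congr (_ + _); apply: eq_lc => j; rewrite cons_funS.
  move: pv4'; rewrite r0 hmx0 mulmx0 add0r => /kerD pD.
  by apply: ord_caseP => [|j]; rewrite ?cons_fun0 ?cons_funS // /dvdp r0.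
move=> Dp; rewrite lc4.
have := Dp ord0; rewrite cons_fun0 => /divpK <-.
rewrite hmxM hmx_comm mulmxA v3d mul0mx add0r; apply/kerD => j.
by have := Dp (lift ord0 j); rewrite cons_funS.
Qed.

(** A zero [D j] would be a free summand, which [char_poly A] could not annihilate. *)
Lemma presented_neq0 k (D : 'I_k -> {poly F}) j : presented D -> D j != 0.
Proof.
case=> v [_ kerD]; apply: contraTneq (monic_neq0 (char_poly_monic A)) => D0.
have /kerD/(_ j) : lc v (fun=> char_poly A) = 0.
  by rewrite /lc big1 // => i _; rewrite hmx_char_poly mulmx0.
by rewrite D0 dvd0p => ->.
Qed.

(** The standard basis generates, so n invariant factors suffice; any number of them may be 1. *)
Lemma presented_exists :
  exists D : 'I_n -> {poly F}, [/\ forall j, D j \is monic, dvd_chain D & presented D].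
Proof.
have [v [D [[e_v v_e] chD kerD]]] := invariant_factors (fun j : 'I_n => delta_mx 0 j).
have prD : presented D.
  exists v; split=> // w; apply: (subspanP e_v).
  exists (fun j => (w 0 j)%:P); rewrite [LHS]row_sum_delta.
  by apply: eq_bigr => j _; rewrite hmxC mul_mx_scalar.
have nzD j := presented_neq0 j prD.
have nzl j : (lead_coef (D j))^-1 != 0 by rewrite invr_eq0 lead_coef_eq0.
exists (fun j => (lead_coef (D j))^-1 *: D j); split.
- by move=> j; rewrite monicE lead_coefZ mulVf // lead_coef_eq0.
- by move=> i j le_ij; rewrite dvdpZl // dvdpZr // chD.
- case: prD => v' [spv kerv]; exists v'; split=> // p.
  by split=> [/kerv Dp|Dp] //; [|apply/kerv] => j; have := Dp j; rewrite dvdpZl.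
Qed.

End Presentation.

Lemma row_inj_unitmx (F : fieldType) n (P : 'M[F]_n) :
  (forall w : 'rV_n, w *m P = 0 -> w = 0) -> P \in unitmx.
Proof.
move=> injP; rewrite -row_free_unit -kermx_eq0; apply/eqP/row_matrixP => i.
by rewrite row0; apply: injP; rewrite -row_mul mulmx_ker row0.
Qed.

(** Sending generators to generators is well defined and injective because both relation modules are
    cut out by the same [D]; preimages of the basis vectors turn this isomorphism into a matrix. *)
Lemma presented_similar (F : fieldType) n (A B : 'M[F]_n) k (D : 'I_k -> {poly F}) :
  presented A D -> presented B D -> exists2 P, P \in unitmx & A *m P = P *m B.
Proof.
case=> v [spv kerv] [w [spw kerw]].
have [p pE] := fin_all_exists (fun i : 'I_n => spv (delta_mx 0 i)).
pose P := \matrix_i lc B w (p i).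
have PE x r : x = lc A v r -> x *m P = lc B w r.
  move=> xE; have -> : x *m P = lc B w (fun j => \sum_i x 0 i *: p i j).
    rewrite lc_sum mulmx_sum_row; apply: eq_bigr => i _.
    by rewrite rowK lcZ.
  apply/eqP; rewrite -subr_eq0 -lcB; apply/eqP/kerw/kerv.
  rewrite lcB -xE lc_sum [in X in _ - X](row_sum_delta x).
  apply/eqP; rewrite subr_eq0; apply/eqP/eq_bigr => i _.
  by rewrite lcZ -pE.
exists P; last first.
  apply/row_matrixP => i; rewrite !row_mul rowE.
  rewrite (PE _ (fun j => p i j * 'X)) ?rowK -?hmxX ?lcM // ?hmxX //.
  by rewrite -pE.
apply: row_inj_unitmx => x; have [r xE] := spv x.
by rewrite (PE _ _ xE) => /kerw/kerv; rewrite -xE.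
Qed.

(** * Sizes of the images of p(A), and uniqueness of the invariant factors *)

Section Count.
Variable F : finFieldType.

Lemma card_npoly_le N d : (d <= N)%N ->
  #|[set r : {poly_N F} | (size r <= d)%N]| = (#|F| ^ d)%N.
Proof.
move=> le_dN; rewrite -card_npoly.
have K (r : {poly_d F}) : npolyp N r = r :> {poly F}.
  by apply: npolypK; apply: leq_trans (size_npoly r) le_dN.
rewrite -(card_imset (f := fun r : {poly_d F} => npolyp N r)); last first.
  by move=> r s /(congr1 val); rewrite /= !K => /val_inj.
apply: eq_card => r; rewrite inE; apply/idP/imsetP => [le_r|[s _ ->]].
  exists (npolyp d r) => //; apply: val_inj; rewrite /= K.
  by rewrite npolypK.
by rewrite /= K size_npoly.
Qed.

(** On F[X]/(D), multiplication by p has image isomorphic to F[X]/(D / gcd(D, p)). *)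
Lemma card_hmx n (A : 'M[F]_n) k (D : 'I_k -> {poly F}) p : presented A D ->
  #|[set w *m hmx A p | w : 'rV[F]_n]|
  = (#|F| ^ \sum_j (size (D j %/ gcdp (D j) p)%R).-1)%N.
Proof.
move=> prD; have nzD j := presented_neq0 j prD; case: prD => v [spv kerv].
pose g j := gcdp (D j) p; pose E j := D j %/ g j.
have nzg j : g j != 0 by rewrite gcdp_eq0 negb_and nzD.
have nzE j : E j != 0 by rewrite dvdp_div_eq0 ?dvdp_gcdl.
have kerE r : lc A v (fun j => r j * p) = 0 <-> forall j, E j %| r j.
  have eqE j : (D j %| r j * p) = (E j %| r j).
    have copE : coprimep (E j) (p %/ g j).
      by apply: coprimep_div_gcd; rewrite nzD.
    rewrite -[X in X %| _](divpK (dvdp_gcdl (D j) p)) -[X in _ %| _ * X](divpK (dvdp_gcdr (D j) p)).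
    by rewrite mulrA dvdp_mul2r ?nzg // Gauss_dvdpl.
  by rewrite kerv; split=> H j; have := H j; rewrite eqE.
pose N := \max_j size (D j).
have le_EN j : (size (E j) <= N)%N.
  apply: leq_trans (leq_bigmax j); apply: dvdp_leq => //.
  by rewrite -[X in _ %| X](divpK (dvdp_gcdl (D j) p)) dvdp_mulr.
(* The remainders modulo [E j] represent the image without repetition. *)
pose S j := [set r : {poly_N F} | (size r <= (size (E j)).-1)%N].
pose phi (r : {ffun 'I_k -> {poly_N F}}) := lc A v (fun j => (r j : {poly F}) * p).
have <- : #|family S| = (#|F| ^ \sum_j (size (E j)).-1)%N.
  rewrite card_family foldrE big_map big_enum expn_sum; apply: eq_bigr => j _.
  by rewrite card_npoly_le // (leq_trans (leq_pred _)).
rewrite -(card_in_imset (f := phi)); last first.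
  move=> r s /familyP rS /familyP sS eq_rs; apply/ffunP => j; apply: val_inj => /=.
  have /kerE/(_ j) : lc A v (fun j => ((r j : {poly F}) - s j) * p) = 0.
    rewrite (@eq_lc _ _ _ _ _ _ (fun j => (r j : {poly F}) * p - (s j : {poly F}) * p)).
      by rewrite lcB; apply/eqP; rewrite subr_eq0; apply/eqP.
    by move=> i; rewrite mulrBl.
  move=> dvdE; apply/eqP; rewrite -subr_eq0; apply: contraLR dvdE => nz.
  apply/negP => /(dvdp_leq nz); rewrite leqNgt => /negP[].
  rewrite [ltnRHS]polySpred // ltnS (leq_trans (size_polyD _ _)) // size_polyN geq_max.
  by have := rS j; have := sS j; rewrite !inE => -> ->.
apply: eq_card => w; apply/imsetP/imsetP => [[x _ ->]|[r _ ->]].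
  have [r ->] := spv x; rewrite -lcM.
  have szr j : (size (r j %% E j)%R <= (size (E j)).-1)%N.
    by rewrite -ltnS -polySpred // ltn_modp.
  have rK j : npolyp N (r j %% E j) = r j %% E j :> {poly F}.
    by apply: npolypK; apply: leq_trans (szr j) (leq_trans (leq_pred _) (le_EN j)).
  exists [ffun j => npolyp N (r j %% E j)].
    by apply/familyP => j; rewrite ffunE inE /= rK.
  apply/eqP; rewrite -subr_eq0 -lcB; apply/eqP.
  rewrite (@eq_lc _ _ _ _ _ _ (fun j => (r j - r j %% E j) * p)).
    apply/kerE => j; rewrite {1}(divp_eq (r j) (E j)) addrK.
    exact: dvdp_mull.
  by move=> j; rewrite ffunE rK mulrBl.
exists (lc A v (fun j => r j : {poly F})) => //.
by rewrite -lcM.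
Qed.

Lemma presented_dim n (A : 'M[F]_n) k (D : 'I_k -> {poly F}) : presented A D ->
  n = (\sum_j (size (D j)).-1)%N.
Proof.
move=> prD; have := card_hmx 1 prD.
have -> : [set w *m hmx A 1 | w : 'rV[F]_n] = setT.
  by apply/setP => w; rewrite inE; apply/imsetP; exists w; rewrite // hmx1 mulmx1.
rewrite cardsT card_mx mul1n => /eqP.
rewrite eqn_exp2l ?finNzRing_gt1 // => /eqP ->; apply: eq_bigr => j _.
by rewrite (eqp_size (eqp_divr (D j) (gcdp1 (D j)))) divp1.
Qed.

(** Image sizes determine the sum over i of deg(D_i / gcd(D_i, p)) for every p. Take p = D_j: the
    terms i <= j vanish for D by the chain condition, the terms i > j agree by descending induction,
    so they vanish for E as well and E_j divides D_j. The converse is symmetric. *)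
Lemma invariant_factors_uniq n (A B : 'M[F]_n) k (D E : 'I_k -> {poly F}) :
  presented A D -> presented B E -> dvd_chain D -> dvd_chain E ->
  (forall j, D j \is monic) -> (forall j, E j \is monic) ->
  (forall p, #|[set w *m hmx A p | w : 'rV[F]_n]| = #|[set w *m hmx B p | w : 'rV[F]_n]|) ->
  D =1 E.
Proof.
move=> prD prE chD chE mD mE eqAB.
pose e (d p : {poly F}) := (size (d %/ gcdp d p)).-1.
have e0 d p : d \is monic -> (e d p == 0%N) = (d %| p).
  move/monic_neq0 => nzd; have nzg : gcdp d p != 0 by rewrite gcdp_eq0 negb_and nzd.
  have nzq : d %/ gcdp d p != 0 by rewrite dvdp_div_eq0 ?dvdp_gcdl.
  rewrite /e -leqn0 -ltnS -polySpred //; apply/idP/idP => [sz|/dvdp_gcd_idl gdp].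
    have := divpK (dvdp_gcdl d p); rewrite (size1_polyC sz) mul_polyC => dE.
    have c0 : (d %/ gcdp d p)`_0 != 0.
      by apply: contraNneq nzd => c0; rewrite -dE c0 scale0r.
    by rewrite -[X in X %| _]dE dvdpZl // dvdp_gcdr.
  by rewrite (eqp_size (eqp_divr _ gdp)) divpp // size_poly1.
have eqe p : (\sum_j e (D j) p = \sum_j e (E j) p)%N.
  apply/eqP; rewrite -(eqn_exp2l _ _ (finNzRing_gt1 F)).
  by rewrite -(card_hmx p prD) -(card_hmx p prE) eqAB.
have dvd_of (D1 E1 : 'I_k -> {poly F}) (j : 'I_k) : dvd_chain D1 ->
    (forall j, D1 j \is monic) -> (forall j, E1 j \is monic) ->
    (forall p, \sum_j e (D1 j) p = \sum_j e (E1 j) p)%N ->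
    (forall i : 'I_k, (j < i)%N -> D1 i = E1 i) -> E1 j %| D1 j.
  move=> ch1 m1 m2 eq1 eqj; have := eq1 (D1 j).
  rewrite (bigID (fun i : 'I_k => (j < i)%N)) [in RHS](bigID (fun i : 'I_k => (j < i)%N)) /=.
  rewrite [X in (X + _)%N](eq_bigr _ (fun i lti => congr1 (e^~ _) (eqj i lti))).
  move/addnI; rewrite big1 => [/esym/eqP|i]; last first.
    by rewrite -leqNgt => /ch1; rewrite -e0 ?m1 // => /eqP.
  rewrite sum_nat_eq0 => /forallP/(_ j).
  by rewrite ltnn /= e0 ?m2.
have main m : forall j : 'I_k, (k - j <= m)%N -> D j = E j.
  elim: m => [|m IH] j; first by rewrite leqn0 subn_eq0 leqNgt ltn_ord.
  move=> lej; have IHj (i : 'I_k) : (j < i)%N -> D i = E i.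
    move=> ltji; apply: IH; rewrite -ltnS (leq_trans _ lej) //.
    exact: ltn_sub2l (leq_trans ltji (ltnW (ltn_ord i))) ltji.
  apply/eqP; rewrite -eqp_monic ?mD ?mE //; apply/andP; split.
    by apply: dvd_of => // i /IHj.
  exact: dvd_of.
by move=> j; apply: main (leqnn _).
Qed.

Lemma card_mulmx_rank m n (X : 'M[F]_(m, n)) :
  #|[set w *m X | w : 'rV[F]_m]| = (#|F| ^ \rank X)%N.
Proof.
have <- : #|{: 'rV[F]_(\rank X)}| = (#|F| ^ \rank X)%N by rewrite card_mx mul1n.
rewrite -(card_imset _ (row_free_injr (row_base_free X) : injective (mulmxr (row_base X)))).
apply: eq_card => w; apply/imsetP/imsetP => [[x _ ->]|[x _ ->]].
  have /submxP[y ->] : (x *m X <= row_base X)%MS by rewrite eq_row_base submxMl.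
  by exists y.
have /submxP[y ->] : (mulmxr (row_base X) x <= X)%MS.
  by rewrite (submx_trans (submxMl _ _)) ?eq_row_base.
by exists y.
Qed.

End Count.

(** * Companion matrices and reciprocal polynomials *)

Section Realization.
Variable F : fieldType.

(** The first basis vector is cyclic: X^i moves it to the i-th one for i < d, and p kills it. *)
Lemma companion_cyclic (p q : {poly F}) (d := (size p).-1) : p \is monic ->
  (poly_rV 1 : 'rV_d) *m hmx (companionmx p) q = poly_rV (q %% p).
Proof.
move=> mp; set C := companionmx p; set v : 'rV_d := poly_rV 1.
have vX i (lt_id : (i < d)%N) : v *m hmx C 'X^i = delta_mx 0 (Ordinal lt_id).
  elim: i lt_id => [|i IH] lt_id.
    rewrite expr0 hmx1 mulmx1; apply/rowP => j; rewrite !mxE coef1.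
    by rewrite eqxx.
  by rewrite exprSr hmxM mulmxA (IH (ltnW lt_id)) hmxX mulmx_delta_companion.
have vq (r : {poly F}) : (size r <= d)%N -> v *m hmx C r = poly_rV r.
  move=> szr; rewrite -{1}(coefK r) poly_def hmx_sum mulmx_sumr.
  rewrite [RHS]row_sum_delta (big_ord_widen _ (fun i => v *m hmx C (r`_i *: 'X^i)) szr).
  rewrite [LHS]big_mkcond; apply: eq_bigr => i _; rewrite mxE.
  rewrite hmxZ -scalemxAr vX (_ : Ordinal _ = i); last exact: val_inj.
  by case: ltnP => // le_ri; rewrite nth_default ?scale0r.
have Cp0 : hmx C p = 0 by rewrite -[RHS](hmx_char_poly C) /C companionmxK.
rewrite [q in LHS](divp_eq q p) hmxD hmxM Cp0.
rewrite mulmx0 add0r vq // -ltnS -polySpred ?monic_neq0 //.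
by rewrite ltn_modp monic_neq0.
Qed.

Lemma presented_companion (p : {poly F}) : p \is monic ->
  presents (companionmx p) (fun _ : 'I_1 => poly_rV 1) (fun=> p).
Proof.
move=> mp; split=> [w|q].
  exists (fun=> rVpoly w); rewrite /lc big_ord1 companion_cyclic //.
  rewrite modp_small ?rVpolyK //; apply: leq_ltn_trans (size_poly _ _) _.
  by rewrite [ltnRHS]polySpred ?monic_neq0.
rewrite /lc big_ord1 companion_cyclic //.
have sz : (size (q ord0 %% p)%R <= (size p).-1)%N.
  by rewrite -ltnS -polySpred ?monic_neq0 // ltn_modp monic_neq0.
split=> [/(congr1 rVpoly)|/(_ ord0)].
  by rewrite poly_rV_K // linear0 => q0 j; rewrite /dvdp (ord1 j) q0.
by rewrite /dvdp => /eqP->; rewrite linear0.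
Qed.

(** A block diagonal sum of companion matrices. Its characteristic polynomial is recorded because
    determinants are later read off it. *)
Lemma presented_realize k (D : 'I_k -> {poly F}) n :
  (forall j, D j \is monic) -> n = (\sum_j (size (D j)).-1)%N ->
  exists A : 'M[F]_n, presented A D /\ char_poly A = \prod_j D j.
Proof.
elim: k D n => [|k IH] D n mD ->.
  rewrite big_ord0; exists 0; split; last by rewrite big_ord0 /char_poly det_mx00.
  exists (fun=> 0); split=> [w|p]; last by split=> [_ []//|_]; rewrite /lc big_ord0.
  by exists (fun=> 0); rewrite /lc big_ord0 thinmx0.
rewrite !big_ord_recl; set d := (size _).-1; set n' := (\sum_(i < k) _)%N.
have [A' [[v' [spv' kerv']] chA']] := IH (fun j => D (lift ord0 j)) n' (fun=> mD _) erefl.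
have [spC kerC] := presented_companion (mD ord0).
exists (block_mx (companionmx (D ord0)) 0 0 A'); split; last first.
  rewrite /char_poly char_block_diag_mx det_ublock.
  by rewrite [\det _](companionmxK (mD ord0)) [\det _]chA'.
exists (cons_fun (row_mx (poly_rV 1) 0) (fun j => row_mx 0 (v' j))).
have lcE p : lc (block_mx (companionmx (D ord0)) 0 0 A')
    (cons_fun (row_mx (poly_rV 1) 0) (fun j => row_mx 0 (v' j))) p
  = row_mx (poly_rV 1 *m hmx (companionmx (D ord0)) (p ord0))
           (lc A' v' (fun j => p (lift ord0 j))).
  rewrite lc_cons cons_fun0 hmx_block mul_row_block !mul0mx !mulmx0 !addr0.
  have -> : lc (block_mx (companionmx (D ord0)) 0 0 A')
      (fun j => cons_fun (row_mx (poly_rV 1) 0) (fun j => row_mx 0 (v' j)) (lift ord0 j))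
      (fun j => p (lift ord0 j)) = row_mx 0 (lc A' v' (fun j => p (lift ord0 j))).
    rewrite /lc; elim/big_ind2: _ => [|x y z t -> ->|j _].
    - by rewrite row_mx0.
    - by rewrite add_row_mx addr0.
    - by rewrite cons_funS hmx_block mul_row_block !mul0mx !mulmx0 ?addr0 ?add0r.
  by rewrite add_row_mx addr0 add0r.
split=> [w|p].
  rewrite -(hsubmxK w).
  have [q qE] := spC (lsubmx w); have [p pE] := spv' (rsubmx w).
  exists (cons_fun (q ord0) p); rewrite lcE cons_fun0; congr row_mx.
    by rewrite qE /lc big_ord1.
  by rewrite pE; apply: eq_lc => j; rewrite cons_funS.
have kC := kerC (fun=> p ord0); rewrite /lc big_ord1 in kC.
rewrite lcE; split=> [|Dp].
  rewrite -[RHS]row_mx0 => /eq_row_mx[p0 /kerv' Dp].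
  apply: ord_caseP => //.
  by have /kC/(_ ord0) := p0.
rewrite (_ : lc _ _ _ = 0); last by apply/kerv'.
by have /kC -> := fun _ : 'I_1 => Dp ord0; rewrite row_mx0.
Qed.

End Realization.

(** * Reversed polynomials and presentations of mu A^-1 *)

Section Reciprocal.
Variables (F : fieldType) (mu : F).
(* X^N p(mu/X) *)
Definition rev_poly N (p : {poly F}) : {poly F} :=
  \poly_(i < N.+1) (p`_(N - i) * mu ^+ (N - i)).

Implicit Types p q d : {poly F}.

Lemma rev_polyE N p :
  rev_poly N p = \sum_(i < N.+1) (p`_i * mu ^+ i) *: 'X^(N - i).
Proof.
rewrite /rev_poly poly_def (reindex_inj rev_ord_inj) /=.
by apply: eq_bigr => i _; rewrite subSS subKn // -ltnS.
Qed.

Lemma size_rev_poly N p : (size (rev_poly N p) <= N.+1)%N.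
Proof. exact: size_poly. Qed.

Lemma coef_rev_poly N p i : (i <= N)%N ->
  (rev_poly N p)`_i = p`_(N - i) * mu ^+ (N - i).
Proof. by move=> le_iN; rewrite coef_poly ltnS le_iN. Qed.

Lemma rev_polyK N p : (size p <= N.+1)%N -> rev_poly N (rev_poly N p) = mu ^+ N *: p.
Proof.
move=> szp; apply/polyP => i; rewrite coefZ.
have [le_iN|lt_Ni] := leqP i N; last first.
  by rewrite !nth_default ?mulr0 // ?(leq_trans szp) // (leq_trans (size_poly _ _)).
rewrite coef_rev_poly // coef_rev_poly ?leq_subr // subKn //.
by rewrite mulrC mulrCA -exprD subnK // mulrC.
Qed.

Lemma rev_polyD N p q : rev_poly N (p + q) = rev_poly N p + rev_poly N q.
Proof.
by apply/polyP => i; rewrite coefD !coef_poly; case: ifP => _; rewrite ?addr0 // coefD mulrDl.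
Qed.

Lemma rev_polyZ N c p : rev_poly N (c *: p) = c *: rev_poly N p.
Proof.
by apply/polyP => i; rewrite coefZ !coef_poly; case: ifP => _; rewrite ?mulr0 // coefZ mulrA.
Qed.

Lemma rev_poly0 N : rev_poly N 0 = 0.
Proof. by rewrite -[X in rev_poly N X](scale0r (0 : {poly F})) rev_polyZ scale0r. Qed.

Lemma rev_poly_sum N (I : Type) (r : seq I) (P : pred I) f :
  rev_poly N (\sum_(i <- r | P i) f i) = \sum_(i <- r | P i) rev_poly N (f i).
Proof. exact: (big_morph _ (rev_polyD N) (rev_poly0 N)). Qed.

Lemma rev_polyXn N i : (i <= N)%N -> rev_poly N 'X^i = mu ^+ i *: 'X^(N - i).
Proof.
move=> le_iN; apply/polyP => j; rewrite coefZ coef_poly !coefXn ltnS.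
have [le_jN|lt_Nj] := leqP j N; last first.
  by rewrite gtn_eqF ?mulr0 // (leq_ltn_trans (leq_subr _ _)).
have -> : (j == N - i)%N = (N - j == i)%N by apply/eqP/eqP; lia.
by case: eqP => [->|_]; rewrite ?mulr1 ?mul1r ?mul0r ?mulr0.
Qed.

Lemma rev_polyM a b p q : (size p <= a.+1)%N -> (size q <= b.+1)%N ->
  rev_poly (a + b) (p * q) = rev_poly a p * rev_poly b q.
Proof.
move=> szp szq.
have coefE N (r : {poly F}) : (size r <= N.+1)%N -> r = \sum_(i < N.+1) r`_i *: 'X^i.
  by move=> szr; rewrite -poly_def; apply/polyP => i; rewrite coef_poly; case: ltnP => // /(leq_trans szr)/(nth_default _).
rewrite {1}(coefE _ _ szp) {1}(coefE _ _ szq) (rev_polyE a p) (rev_polyE b q) mulr_suml rev_poly_sum mulr_suml.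
apply: eq_bigr => i _; rewrite mulr_sumr rev_poly_sum mulr_sumr.
apply: eq_bigr => j _; rewrite -!scalerAl -!scalerAr -!exprD !rev_polyZ.
have lei := ltn_ord i; have lej := ltn_ord j; rewrite !ltnS in lei lej.
rewrite rev_polyXn ?leq_add // !scalerA.
have -> : (a + b - (i + j) = a - i + (b - j))%N by lia.
by congr (_ *: _); rewrite exprD; ring.
Qed.

Hypothesis nz_mu : mu != 0.

(** Reversal is multiplicative and, up to a power of mu, an involution. A nonzero constant term
    makes the reversal of d keep its degree. *)
Lemma dvd_rev_poly N d p : d`_0 != 0 -> (size p <= N.+1)%N -> (size d <= N.+1)%N ->
  (d %| rev_poly N p) = (rev_poly (size d).-1 d %| p).
Proof.
move=> d0 szp szd; set a := (size d).-1.
have nzd : d != 0 by apply: contraNneq d0 => ->; rewrite coef0.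
have sza : size d = a.+1 by rewrite -polySpred.
have le_aN : (a <= N)%N by rewrite -ltnS -sza.
have split_size (c e : {poly F}) : c != 0 -> e != 0 -> size e = a.+1 -> (size (c * e)%R <= N.+1)%N ->
    (size c <= (N - a).+1)%N.
  move=> nzc nze sze; rewrite size_mul // sze addnS /=.
  by move: (size c) => k; lia.
have NE : N = (N - a + a)%N by lia.
have szra : size (rev_poly a d) = a.+1.
  apply/eqP; rewrite eqn_leq size_rev_poly ltnNge; apply/negP => /leq_sizeP/(_ a (leqnn _)).
  by rewrite coef_rev_poly // subnn expr0 mulr1 => /eqP; apply/negP.
have nzra : rev_poly a d != 0 by rewrite -size_poly_gt0 szra.
have [->|nzp] := eqVneq p 0; first by rewrite rev_poly0 !dvdp0.
have muN m : mu ^+ m != 0 by apply: expf_neq0.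
apply/idP/idP => /dvdpP[r rE].
  have nzr : r != 0.
    apply: contraNneq nzp => r0; have := rev_polyK szp.
    by rewrite rE r0 mul0r rev_poly0 => /esym/eqP; rewrite scaler_eq0 (negPf (muN N)).
  have szr : (size r <= (N - a).+1)%N.
    by apply: (split_size r d) => //; rewrite -rE size_rev_poly.
  rewrite -(dvdpZr _ _ (muN N)) -rev_polyK // rE NE rev_polyM ?sza //.
  exact: dvdp_mull.
have nzr : r != 0 by apply: contraNneq nzp => r0; rewrite rE r0 mul0r.
have szr : (size r <= (N - a).+1)%N by apply: (split_size r _ nzr nzra szra); rewrite -rE.
rewrite rE NE rev_polyM ?szra // rev_polyK ?sza //.
by rewrite dvdp_mull // dvdpZr.
Qed.

Variables (n : nat) (A : 'M[F]_n).
Hypothesis uA : A \in unitmx.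
Let B := mu *: invmx A.

(** Multiplying p(mu A^-1) by A^N clears the inverses and leaves X^N p(mu/X) evaluated at [A]. *)
Lemma hmx_rev_poly N p : (size p <= N.+1)%N ->
  hmx B p *m hmx A 'X^N = hmx A (rev_poly N p).
Proof.
move=> szp; have hX i : (i <= N)%N -> hmx B 'X^i *m hmx A 'X^N = mu ^+ i *: hmx A 'X^(N - i).
  elim: i => [_|i IH lt_iN]; first by rewrite expr0 hmx1 mul1mx scale1r subn0.
  rewrite exprS hmxM -mulmxA IH ?(ltnW lt_iN) // hmxX -(subnSK lt_iN) exprS hmxM hmxX.
  by rewrite -scalemxAr mulmxA -scalemxAl mulVmx // -scalemxAl mul1mx scalerA -exprSr.
have pE : p = \sum_(i < N.+1) p`_i *: 'X^i.
  rewrite -poly_def; apply/polyP => i; rewrite coef_poly; case: ltnP => // le_i.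
  by rewrite nth_default // (leq_trans szp).
rewrite rev_polyE {1}pE !hmx_sum mulmx_suml; apply: eq_bigr => i _.
by rewrite !hmxZ -scalemxAl hX ?scalerA // -ltnS.
Qed.

(** If X divided [D j], invertibility of [A] would let the quotient already annihilate the generator
    [v j]. *)
Lemma presented_coef0 k (D : 'I_k -> {poly F}) j : presented A D -> (D j)`_0 != 0.
Proof.
move=> prD; have nzD := presented_neq0 j prD; case: prD => v [_ kerv].
apply/negP => /eqP D0.
have /dvdpP[q qE] : 'X %| D j by rewrite -['X]subr0 -[0]/(polyC 0) dvdp_XsubCl /root horner_coef0 D0.
have nzq : q != 0 by apply: contraNneq nzD => q0; rewrite qE q0 mul0r.
have : lc A v (fun i => if i == j then q else 0) = 0.
  rewrite lc_delta; apply: (can_inj (mulmxK uA)); rewrite mul0mx -mulmxA -{2}(hmxX A) -hmxM -qE.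
  have /kerv : forall i, D i %| (if i == j then D j else 0) by move=> i; case: eqP => [->|].
  by rewrite lc_delta.
move/kerv/(_ j); rewrite eqxx qE => /(dvdp_leq nzq).
by rewrite size_mulX // ltnn.
Qed.

(** The same generators serve: up to an invertible power of [A], combinations for [B] are
    combinations for [A] with reversed coefficients. *)
Lemma presented_rev_poly k (D : 'I_k -> {poly F}) : presented A D ->
  presented B (fun j => rev_poly (size (D j)).-1 (D j)).
Proof.
move=> prD; have D0 j := presented_coef0 j prD; have nzD j := presented_neq0 j prD.
case: prD => v [spv kerv]; exists v.
have uX N : hmx A 'X^N \in unitmx.
  by elim: N => [|N IH]; rewrite ?expr0 ?hmx1 ?unitmx1 // exprS hmxM unitmx_mul hmxX uA.
have lcE N (p : 'I_k -> {poly F}) : (forall j, (size (p j) <= N.+1)%N) ->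
    lc B v p *m hmx A 'X^N = lc A v (fun j => rev_poly N (p j)).
  move=> szp; rewrite /lc mulmx_suml; apply: eq_bigr => j _.
  by rewrite -mulmxA hmx_rev_poly.
split=> [w|p].
  pose N := \max_j size (D j).
  have [p pE] := spv (w *m hmx A 'X^N).
  have szp j : (size (p j %% D j)%R <= N.+1)%N.
    apply: leq_trans (leqnSn _); apply: leq_trans (leq_bigmax j).
    by apply: ltnW; rewrite ltn_modp.
  (* Reduction modulo [D j] gives all coefficients a common degree bound N, so that reversing twice
     returns them up to the factor mu^N. *)
  exists (fun j => mu ^- N *: rev_poly N (p j %% D j)).
  apply: (can_inj (mulmxK (uX N))); rewrite lcE; last first.
    by move=> j; rewrite (leq_trans (size_scale_leq _ _)) ?size_rev_poly.
  rewrite (@eq_lc _ _ _ _ _ _ (fun j => p j %% D j)).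
    rewrite pE; apply/eqP; rewrite -subr_eq0 -lcB; apply/eqP/kerv => j.
    by rewrite {1}(divp_eq (p j) (D j)) addrK dvdp_mull.
  by move=> j; rewrite rev_polyZ rev_polyK // scalerA mulVf ?scale1r // expf_neq0.
pose N := maxn (\max_j size (D j)) (\max_j size (p j)).
have szp j : (size (p j) <= N.+1)%N.
  by apply: leq_trans (leqnSn _); apply: leq_trans (leq_maxr _ _); apply: leq_bigmax.
have szD j : (size (D j) <= N.+1)%N.
  by apply: leq_trans (leqnSn _); apply: leq_trans (leq_maxl _ _); apply: leq_bigmax.
have -> : lc B v p = 0 <-> lc A v (fun j => rev_poly N (p j)) = 0.
  rewrite -lcE //; split=> [->|]; first by rewrite mul0mx.
  by move=> H; apply: (can_inj (mulmxK (uX N))); rewrite mul0mx.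
by rewrite kerv; split=> H j; have := H j; rewrite dvd_rev_poly.
Qed.

End Reciprocal.

(** * Field involutions and transposition *)

Section MapPresented.
Variables (F : fieldType) (s : {rmorphism F -> F}).
Hypothesis sK : involutive s.

Lemma hmx_map n (A : 'M[F]_n) p : hmx (map_mx s A) (map_poly s p) = map_mx s (hmx A p).
Proof. by case: n A => [|n] A; [rewrite [RHS]flatmx0 | rewrite /= -map_horner_mx]. Qed.

Lemma presented_map n (A : 'M[F]_n) k (D : 'I_k -> {poly F}) : presented A D ->
  presented (map_mx s A) (fun j => map_poly s (D j)).
Proof.
have pK : involutive (map_poly s).
  by move=> p; apply/polyP => i; rewrite !coef_map /= sK.
have mK m (w : 'rV[F]_m) : map_mx s (map_mx s w) = w by apply/rowP => i; rewrite !mxE sK.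
case=> v [spv kerv]; exists (fun j => map_mx s (v j)).
have lcE p : lc (map_mx s A) (fun j => map_mx s (v j)) (fun j => map_poly s (p j))
    = map_mx s (lc A v p).
  by rewrite /lc map_mx_sum; apply: eq_bigr => j _; rewrite hmx_map -map_mxM.
split=> [w|p].
  have [p pE] := spv (map_mx s w); exists (fun j => map_poly s (p j)).
  by rewrite lcE -pE mK.
rewrite (@eq_lc _ _ _ _ _ _ (fun j => map_poly s (map_poly s (p j)))) => [|j]; last by rewrite pK.
rewrite lcE; have -> : map_mx s (lc A v (fun j => map_poly s (p j))) = 0 <->
    lc A v (fun j => map_poly s (p j)) = 0.
  split=> [/(congr1 (map_mx s))|->]; last by rewrite map_mx0.
  by rewrite mK map_mx0.
rewrite kerv; split=> H j; have := H j; rewrite -(dvdp_map s) ?pK //.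
Qed.

End MapPresented.

Lemma hmx_tr (F : fieldType) n (A : 'M[F]_n) p : hmx A^T p = (hmx A p)^T.
Proof.
elim/poly_ind: p => [|p c IH]; first by rewrite !hmx0 trmx0.
by rewrite !hmxD hmxM IH [RHS]linearD /= mulrC hmxM trmx_mul !hmxX !hmxC tr_scalar_mx.
Qed.

(** * Types of conjugacy classes *)

Lemma presented_eqp (F : fieldType) n (A : 'M[F]_n) k (D E : 'I_k -> {poly F}) :
  (forall j, D j %= E j) -> presented A D -> presented A E.
Proof.
move=> DE [v [spv kerv]]; exists v; split=> // p; rewrite kerv.
by split=> H j; have := H j; rewrite (eqp_dvdl _ (DE j)).
Qed.

Lemma card_geq_ord n (i : nat) : #|[pred j : 'I_n | (i <= j)%N]| = (n - i)%N.
Proof.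
rewrite -sum1_card big_mkcond.
elim: n => [|n IH]; first by rewrite big_ord0.
by rewrite big_ord_recr /= IH unfold_in /=; case: leqP => ?; lia.
Qed.

Section Recip.
Variables (F : fieldType) (mu : F).
Implicit Types p q : {poly F}.

Definition deg p := (size p).-1.

Lemma degM p q : p != 0 -> q != 0 -> deg (p * q) = (deg p + deg q)%N.
Proof.
move=> p0 q0; rewrite /deg size_mul //.
by move: p0 q0; rewrite -!size_poly_gt0; case: (size p) => // a; case: (size q) => // b; lia.
Qed.

(* The monic polynomial whose roots are the mu / r, for r a root of p. *)
Definition recip p := (p`_0)^-1 *: rev_poly mu (deg p) p.

Lemma recip1 : recip 1 = 1.
Proof.
rewrite /recip /deg size_poly1 coef1 invr1 scale1r; apply/polyP => i.
by rewrite coef_poly !coef1; case: i => [|i] //=; rewrite expr0 mulr1.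
Qed.

Lemma coef_recip p i : (i <= deg p)%N ->
  (recip p)`_i = (p`_0)^-1 * (p`_(deg p - i) * mu ^+ (deg p - i)).
Proof. by move=> le_i; rewrite coefZ coef_rev_poly. Qed.

Lemma size_recip_le p : p != 0 -> (size (recip p) <= size p)%N.
Proof.
move=> nzp; rewrite (leq_trans (size_scale_leq _ _)) // (leq_trans (size_rev_poly _ _ _)) //.
by rewrite /deg -polySpred.
Qed.

Lemma size_recip p : p`_0 != 0 -> size (recip p) = size p.
Proof.
move=> p0; have nzp : p != 0 by apply: contraNneq p0 => ->; rewrite coef0.
apply/eqP; rewrite eqn_leq size_recip_le // [leqLHS]polySpred // -/(deg p) ltnNge.
apply/negP => /leq_sizeP/(_ _ (leqnn _)); rewrite coef_recip // subnn expr0 mulr1 mulVf //.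
by move/eqP; rewrite oner_eq0.
Qed.

Lemma monic_recip p : p`_0 != 0 -> recip p \is monic.
Proof.
move=> p0; rewrite monicE /lead_coef size_recip // coef_recip // subnn.
by rewrite expr0 mulr1 mulVf.
Qed.

Lemma recipM p q : p`_0 != 0 -> q`_0 != 0 -> recip (p * q) = recip p * recip q.
Proof.
move=> p0 q0.
have nzp : p != 0 by apply: contraNneq p0 => ->; rewrite coef0.
have nzq : q != 0 by apply: contraNneq q0 => ->; rewrite coef0.
rewrite /recip degM // rev_polyM; try exact: leqSpred.
rewrite coef0M invfM.
by rewrite -scalerAl -scalerAr scalerA.
Qed.

Lemma recip_prod (I : finType) (P : pred I) (y : I -> {poly F}) :
  (forall i, (y i)`_0 != 0) ->
  recip (\prod_(i | P i) y i) = \prod_(i | P i) recip (y i).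
Proof.
move=> y0; suff [] : (\prod_(i | P i) y i)`_0 != 0 /\
  recip (\prod_(i | P i) y i) = \prod_(i | P i) recip (y i) by [].
elim/big_ind2: _ => [|p q r s [p0 <-] [r0 <-]|i _].
- by rewrite coef1 oner_eq0 recip1.
- by rewrite coef0M mulf_neq0 // recipM.
- by [].
Qed.

End Recip.

(** * Types: tuples of quotients of successive invariant factors *)

Section Types.
Variables (F : finFieldType) (n : nat).
Implicit Types (A B : 'M[F]_n) (y z : 'I_n -> {poly F}).

(** The j-th invariant factor. Passing to quotients removes the divisibility constraints, so counts
    factor over i; [y i] divides the invariant factors of index j >= i, whence the weights n - i
    below. *)
Definition chain_of y (j : 'I_n) := \prod_(i < n | (i <= j)%N) y i.

Definition has_type A y := (forall i, y i \is monic) /\ presented A (chain_of y).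

Lemma chain_of_chain y : dvd_chain (chain_of y).
Proof.
move=> i j le_ij; rewrite /chain_of [X in _ %| X](bigID (fun l : 'I_n => (l <= i)%N)) /=.
apply: dvdp_mulr; rewrite [X in _ %| X](eq_bigl (fun l : 'I_n => (l <= i)%N)) // => l.
by apply/andP/idP => [[]//|le_li]; rewrite (leq_trans le_li).
Qed.

Lemma chain_of_monic y j : (forall i, y i \is monic) -> chain_of y j \is monic.
Proof. by move=> my; apply: monic_prod. Qed.

Lemma chain_of_inj y z : (forall i, y i \is monic) -> (forall i, z i \is monic) ->
  chain_of y =1 chain_of z -> y =1 z.
Proof.
move=> my mz eq_yz.
suff main m : forall j : 'I_n, (j < m)%N -> y j = z j.
  by move=> j; apply: (main n).
elim: m => // m IH j; rewrite ltnS => le_jm.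
have := eq_yz j; rewrite /chain_of (bigD1 j) // [RHS](bigD1 j) //=.
rewrite (eq_bigr z); last first.
  by move=> i /andP[le_ij ne_ij]; apply: IH; rewrite (leq_trans _ le_jm) // ltn_neqAle ne_ij.
by apply: mulIf; apply: monic_neq0; apply: monic_prod.
Qed.

Lemma has_type_exists A : exists y, has_type A y.
Proof.
have [D [mD chD prD]] := presented_exists A.
(* The invariant factor before the j-th. At j = 0 the index [j.-1] is again 0 and [insub] succeeds,
   so the inner test is what supplies 1. *)
pose prev (j : 'I_n) := if insub j.-1 is Some i then
  if (j : nat) == 0%N then 1 else D i else 1.
have prev_dvd j : prev j %| D j.
  rewrite /prev; case: insubP => [i _ ij|_]; last exact: dvd1p.
  by case: eqP => _; rewrite ?dvd1p // chD // ij leq_pred.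
have mprev j : prev j \is monic.
  by rewrite /prev; case: insub => [i|]; [case: ifP => _|]; rewrite ?monic1.
pose y j := D j %/ prev j.
have yE j : y j * prev j = D j by rewrite divpK.
have my j : y j \is monic by rewrite -(monicMl _ (mprev j)) mulrC yE.
have chE m : forall j : 'I_n, (j <= m)%N -> chain_of y j = D j.
  elim: m => [|m IH] j le_jm; rewrite /chain_of (bigD1 j) //= -[RHS]yE; congr (_ * _).
    rewrite big1 => [|i /andP[le_ij]]; last by rewrite -val_eqE /= => ne_ij; exfalso; lia.
    by rewrite /prev; case: insub => [i|] //; rewrite -leqn0 le_jm.
  have [j0|j_gt0] := posnP (j : nat).
    rewrite big1 => [|i /andP[le_ij]]; last by rewrite -val_eqE /= => ne_ij; exfalso; lia.
    by rewrite /prev; case: insub => [i|] //; rewrite j0.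
  rewrite /prev; case: insubP => [i _ ij|]; last by have := ltn_ord j; lia.
  rewrite gtn_eqF // -IH ?ij; last by lia.
  by rewrite /chain_of; apply: eq_bigl => l; rewrite ij -val_eqE /=; lia.
exists y; split=> //; apply: (presented_eqp _ prD) => j.
by rewrite (chE j) // eqpxx.
Qed.

Lemma has_type_uniq A B y z : has_type A y -> has_type B z ->
  (forall p, #|[set w *m hmx A p | w : 'rV[F]_n]| = #|[set w *m hmx B p | w : 'rV[F]_n]|) ->
  y =1 z.
Proof.
move=> [my prA] [mz prB] eqAB; apply: chain_of_inj => //.
apply: invariant_factors_uniq prA prB _ _ _ _ eqAB; try exact: chain_of_chain.
  by move=> j; apply: chain_of_monic.
by move=> j; apply: chain_of_monic.
Qed.

Lemma similar_type A B P y : P \in unitmx -> A *m P = P *m B -> has_type A y -> has_type B y.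
Proof.
move=> uP AP [my [v [spv kerv]]]; split=> //; exists (fun j => v j *m P).
have hP p : hmx A p *m P = P *m hmx B p.
  elim/poly_ind: p => [|p c IH]; first by rewrite !hmx0 mulmx0 mul0mx.
  rewrite !hmxD !hmxM !hmxC !hmxX mulmxDl mulmxDr mul_scalar_mx mul_mx_scalar.
  by rewrite -mulmxA AP !mulmxA IH.
have lcE p : lc B (fun j => v j *m P) p = lc A v p *m P.
  by rewrite /lc mulmx_suml; apply: eq_bigr => j _; rewrite -!mulmxA hP.
split=> [w|p]; last first.
  rewrite lcE -kerv; split=> [H|->]; last by rewrite mul0mx.
  by rewrite -(mulmxK uP (lc A v p)) H mul0mx.
by have [p pE] := spv (w *m invmx P); exists p; rewrite lcE -pE mulmxKV.
Qed.

Lemma eq_has_type A y z : y =1 z -> has_type A y -> has_type A z.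
Proof.
move=> yz [my prA]; split=> [i|]; first by rewrite -yz.
apply: presented_eqp prA => j; rewrite /chain_of (eq_bigr z) ?eqpxx // => i _.
Qed.

Lemma has_type_inj A y z : has_type A y -> has_type A z -> y =1 z.
Proof. by move=> Ay Az; apply: has_type_uniq Ay Az _. Qed.

Lemma similarP A B y z : has_type A y -> has_type B z ->
  (exists2 P, P \in unitmx & A *m P = P *m B) <-> y =1 z.
Proof.
move=> Ay Bz; split=> [[P uP AP]|yz].
  exact: has_type_inj (similar_type uP AP Ay) Bz.
case: Ay Bz => my prA [mz prB]; apply: presented_similar prA _.
apply: presented_eqp prB => j; rewrite /chain_of (eq_bigr y) ?eqpxx // => i _.
Qed.

Lemma deg_prod_monic (I : finType) (P : pred I) (y : I -> {poly F}) :
  (forall i, y i \is monic) -> deg (\prod_(i | P i) y i) = (\sum_(i | P i) deg (y i))%N.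
Proof.
move=> my; suff [] : \prod_(i | P i) y i \is monic /\
  deg (\prod_(i | P i) y i) = (\sum_(i | P i) deg (y i))%N by [].
elim/big_ind2: _ => [|p a q b [mp <-] [mq <-]|i _]; last by [].
- by rewrite monic1 /deg size_poly1.
- by rewrite monicMl // degM ?monic_neq0.
Qed.

Lemma sum_deg_chain y : (forall i, y i \is monic) ->
  (\sum_j deg (chain_of y j) = \sum_(i < n) (n - i) * deg (y i))%N.
Proof.
move=> my; under eq_bigr => j _ do rewrite deg_prod_monic // big_mkcond.
rewrite exchange_big; apply: eq_bigr => i _ /=.
by rewrite -big_mkcond sum_nat_const card_geq_ord.
Qed.

Lemma has_type_deg A y : has_type A y -> (\sum_(i < n) (n - i) * deg (y i) = n)%N.
Proof. by case=> my prA; rewrite -sum_deg_chain // [RHS](presented_dim prA). Qed.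

Lemma has_type_realize y : (forall i, y i \is monic) ->
  (\sum_(i < n) (n - i) * deg (y i) = n)%N ->
  exists A, has_type A y /\ char_poly A = \prod_i y i ^+ (n - i).
Proof.
move=> my degy.
have [|A [prA chA]] := @presented_realize F n (chain_of y) n (fun j => chain_of_monic j my).
  by rewrite -[LHS]degy -sum_deg_chain.
exists A; split=> //; rewrite chA.
under eq_bigr => j _ do rewrite /chain_of big_mkcond.
rewrite exchange_big; apply: eq_bigr => i _ /=.
by rewrite -big_mkcond prodr_const card_geq_ord.
Qed.

(** [A] is similar to the realization of its type, whose characteristic polynomial is known; the
    determinant is its constant term times (-1)^n. *)
Lemma has_type_det A y : has_type A y ->
  \det A = \prod_i ((-1) ^+ deg (y i) * (y i)`_0) ^+ (n - i).
Proof.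
move=> Ay; have [my _] := Ay.
have [B [By chB]] := has_type_realize my (has_type_deg Ay).
have [P uP AP] : exists2 P, P \in unitmx & A *m P = P *m B by apply/(similarP Ay By).
have -> : \det A = \det B.
  have uP' : \det P \is a GRing.unit by rewrite -unitmxE.
  by have := congr1 determinant AP; rewrite !det_mulmx mulrC => /(mulrI uP').
have -> : \det B = (-1) ^+ n * (char_poly B)`_0.
  by rewrite char_poly_det mulrA -expr2 sqrr_sign mul1r.
rewrite chB -{1}(has_type_deg By).
have -> : (\prod_i y i ^+ (n - i))`_0 = \prod_i (y i)`_0 ^+ (n - i).
  by rewrite -horner_coef0 horner_prod; apply: eq_bigr => i _; rewrite horner_exp horner_coef0.
rewrite expr_sum -big_split; apply: eq_bigr => i _ /=.
by rewrite exprMn -exprM mulnC.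
Qed.

Lemma has_type_unit A y : has_type A y -> (A \in unitmx) = [forall i, (y i)`_0 != 0].
Proof.
move=> Ay; rewrite unitmxE (has_type_det Ay) unitfE prodf_seq_neq0.
apply/allP/forallP => H i; last first.
  by rewrite expf_neq0 // mulf_neq0 // signr_eq0.
have := H i (mem_index_enum i); rewrite expf_eq0 subn_gt0 ltn_ord /=.
by rewrite mulf_eq0 signr_eq0.
Qed.

Lemma has_type_recip A y mu : mu != 0 -> A \in unitmx -> has_type A y ->
  has_type (mu *: invmx A) (fun i => recip mu (y i)).
Proof.
move=> nz_mu uA Ay; have y0 i : (y i)`_0 != 0.
  by move: uA; rewrite (has_type_unit Ay) => /forallP.
case: Ay => my prA; split=> [i|]; first exact: monic_recip.
apply: presented_eqp (presented_rev_poly nz_mu uA prA) => j.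
rewrite /chain_of -recip_prod // /recip eqp_sym eqp_scale // invr_eq0.
exact: presented_coef0 prA.
Qed.

Lemma has_type_map (s : {rmorphism F -> F}) A y : involutive s -> has_type A y ->
  has_type (map_mx s A) (fun i => map_poly s (y i)).
Proof.
move=> sK [my prA]; split=> [i|]; first by rewrite map_monic.
apply: presented_eqp (presented_map sK prA) => j.
by rewrite /chain_of rmorph_prod eqpxx.
Qed.

(** The ranks of the p(A) determine the type, and transposition preserves them. *)
Lemma has_type_tr A y : has_type A y -> has_type A^T y.
Proof.
move=> Ay; have [z Az] := has_type_exists A^T.
suff yz : z =1 y by apply: eq_has_type yz Az.
move=> i; apply/esym; move: i.
apply: has_type_uniq Ay Az _ => p.
by rewrite !card_mulmx_rank hmx_tr mxrank_tr.
Qed.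

End Types.

(** * Unitary groups *)

(** Powers are eventually periodic; an exponent beyond the preperiod that is a multiple of the
    period gives an idempotent. *)
Lemma idempotent_power (R : finNzRingType) (a : R) :
  exists2 N, (0 < N)%N & a ^+ N * a ^+ N = a ^+ N.
Proof.
have /injectivePn[i [j]] : ~~ injectiveb (fun i : 'I_#|R|.+1 => a ^+ i).
  by apply/injectiveP => /leq_card; rewrite card_ord ltnn.
wlog lt_ij : i j / (i < j)%N => [wl ne_ij eq_a|_ eq_a].
  have [lt|lt|/val_inj eq_ij] := ltngtP i j; last by rewrite eq_ij eqxx in ne_ij.
    exact: wl lt ne_ij eq_a.
  by apply: wl lt _ (esym eq_a); rewrite eq_sym.
pose d := (j - i)%N.
have per m t : (i <= m)%N -> a ^+ (m + t * d) = a ^+ m.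
  move=> le_im; elim: t => [|t IH]; first by rewrite addn0.
  rewrite -[RHS]IH mulSn.
  have -> : (m + (d + t * d) = j + (m + t * d - i))%N by rewrite /d; lia.
  by rewrite exprD -eq_a -exprD; congr (_ ^+ _); lia.
(* A multiple of the period d that is at least i; the successor keeps it positive when i = 0. *)
exists (i.+1 * d)%N; first by rewrite muln_gt0 subn_gt0.
by rewrite -exprD per // mulSn; rewrite (leq_trans _ (leq_addl _ _)) // leq_pmulr // subn_gt0.
Qed.

(** * Hilbert 90 for semilinear product-reversing maps of a matrix algebra *)

Section Hilbert90.
Variables (K : finFieldType) (s : {rmorphism K -> K}) (omega : K) (m : nat).
Hypotheses (sK : involutive s) (s_omega : s omega != omega).
Local Notation M := 'M[K]_m.+1.

Variable tau : M -> M.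
Hypotheses (tauD : forall x y, tau (x + y) = tau x + tau y)
  (tauM : forall x y, tau (x * y) = tau y * tau x)
  (tau_scalar : forall a, tau a%:M = (s a)%:M).

(* If e is an idempotent power of 1 + u, then tau e = e and the witness is
   v = c + u tau(c) with c = e + omega (1 - e): the factor 1 + u is invertible
   where e = 1, and where e = 0 it is nilpotent, so that v is
   omega - tau(omega) up to a nilpotent. *)
Lemma hilbert90 (u : M) : u * tau u = 1 ->
  exists v : M, [/\ v \in unitmx, v = u * tau v
    & forall x, GRing.comm x u -> GRing.comm x v].
Proof.
move=> u_tau; set ui := tau u in u_tau.
have ui_u : ui * u = 1 by apply: mulmx1C.
have tau1 : tau 1 = 1 by rewrite -[1 in LHS]/(1%:M : M) tau_scalar rmorph1.
have tauX x k : tau (x ^+ k) = tau x ^+ k.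
  by elim: k => [|k IH]; rewrite ?expr0 // exprSr tauM IH exprS.
have tauZ a x : tau (a *: x) = s a *: tau x.
  by rewrite -mul_scalar_mx tauM tau_scalar [LHS]mul_mx_scalar.
have tauN x : tau (- x) = - tau x.
  by rewrite -scaleN1r tauZ rmorphN1 scaleN1r.
(* [a] already solves v = u tau(v) but need not be invertible; the idempotent below isolates the
   part where it fails. *)
pose a := 1 + u.
have u_ta : u * tau a = a by rewrite /a tauD tau1 -/ui mulrDr mulr1 u_tau; exact: addrC.
have ui_a : ui * a = tau a by rewrite -[in LHS]u_ta mulrA ui_u mul1r.
have comm_uui : GRing.comm u ui by rewrite /GRing.comm u_tau ui_u.
have comm_ua : GRing.comm u a by apply: commrD; [apply: commr1 | apply: commr_refl].
have comm_uia : GRing.comm ui a.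
  by apply: commrD; [apply: commr1 | apply: commr_sym].
have comm_uta : GRing.comm u (tau a) by rewrite -ui_a; apply: commrM.
have comm_ata : GRing.comm a (tau a).
  by rewrite -ui_a; apply: commrM; [apply: commr_sym | apply: commr_refl].
have [N N_gt0 idem] := idempotent_power a.
pose e := a ^+ N; rewrite -/e in idem.
(* [e] and [tau e] are commuting idempotents, each a unit multiple of the other, hence equal. *)
have te : tau e = e.
  have idem' : tau e * tau e = tau e by rewrite -tauM idem.
  have e1 : u ^+ N * tau e = e by rewrite tauX -exprMn_comm // u_ta.
  have e2 : ui ^+ N * e = tau e by rewrite -exprMn_comm // ui_a -tauX.
  have c1 : e * tau e = e by rewrite -{1}e1 -mulrA idem' e1.
  have c2 : tau e * e = tau e by rewrite -{1}e2 -mulrA idem e2.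
  rewrite -c2 -[RHS]c1; apply: commr_sym.
  by rewrite tauX; apply/commrX/commr_sym/commrX/commr_sym.
pose c b : M := e + b *: (1 - e).
have tc b : tau (c b) = c (s b).
  by rewrite /c tauD tauZ tauD tauN tau1 te.
have commE x : GRing.comm x u -> GRing.comm x e.
  by move=> xu; apply/commrX/commrD => //; apply: commr1.
have commC b x : GRing.comm x u -> GRing.comm x (c b).
  move=> xu; apply: commrD; first exact: commE.
  rewrite /GRing.comm -scalerAr -scalerAl; congr (_ *: _).
  by apply: commrB; [apply: commr1 | apply: commE].
pose v := c omega + u * c (s omega).
exists v; split.
- have eN : e * (1 - e) = 0 by rewrite mulrBr mulr1 idem subrr.
  have Ne : (1 - e) * e = 0 by rewrite mulrBl mul1r idem subrr.
  have ve : v * e = e * a.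
    have ce b : c b * e = e by rewrite /c mulrDl -scalerAl Ne scaler0 addr0 idem.
    by rewrite /v mulrDl -mulrA !ce /a mulrDr mulr1 -(commE u) //; apply: commr_refl.
  apply: row_inj_unitmx => w wv0.
  have we0 : w *m e = 0.
    have eE : e = v * e * a ^+ N.-1 by rewrite ve -mulrA -exprS prednK.
    by rewrite eE -[v * e * _]/(v *m e *m _) !mulmxA wv0 !mul0mx.
  have wc b : w *m c b = b *: w.
    by rewrite /c mulmxDr we0 add0r -scalemxAr mulmxBr we0 subr0 mulmx1.
  have wu : w *m (u * c (s omega)) = s omega *: (w *m u).
    rewrite (commC _ u); last exact: commr_refl.
    by rewrite -[c _ * u]/(c _ *m u) mulmxA wc -scalemxAl.
  have nz_so : s omega != 0.
    apply: contraNneq s_omega => so0; rewrite so0 -(inj_eq (inv_inj sK)) so0.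
    by rewrite rmorph0.
  pose kap := (s omega - omega) / s omega.
  have nz_kap : kap != 0 by rewrite mulf_neq0 ?invr_eq0 // subr_eq0.
  (* Once w e = 0, the equation w v = 0 reads omega w + s(omega) w u = 0. So w is an eigenvector of
     [a] with nonzero eigenvalue, while a^N = e kills w; hence w = 0. *)
  have wa : w *m a = kap *: w.
    have := wv0; rewrite /v mulmxDr wc wu => /eqP; rewrite addrC addr_eq0 => /eqP wuE.
    apply: (scalerI nz_so); rewrite /a mulmxDr mulmx1 scalerDr wuE scalerA.
    by rewrite /kap mulrC divfK // scalerBl.
  have waN k : w *m a ^+ k = kap ^+ k *: w.
    elim: k => [|k IH]; first by rewrite !expr0 mulmx1 scale1r.
    rewrite exprSr [a ^+ k * a]/(a ^+ k *m a) mulmxA IH -scalemxAl wa scalerA.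
    by rewrite exprSr.
  apply/eqP; move/eqP: we0; rewrite waN scaler_eq0 expf_eq0 (negPf nz_kap) andbF.
  by [].
- rewrite /v tauD tauM !tc sK -/ui [RHS]mulrDr [LHS]addrC; congr (_ + _).
  by rewrite mulrA (commC _ u) ?u_tau -?mulrA ?u_tau ?mulr1 //; apply: commr_refl.
- move=> x xu; apply: commrD; first exact: commC.
  by apply: commrM => //; apply: commC.
Qed.

End Hilbert90.

(** * Conjugate transpose, hermitian elements and conjugacy in the unitary group *)

Section Star.
Variables (K : finFieldType) (s : {rmorphism K -> K}) (omega : K) (n : nat).
Hypotheses (sK : involutive s) (s_omega : s omega != omega).
Implicit Types (g h x y z : {'GL_n[K]}) (A B : 'M[K]_n.-1.+1).

Definition star A := (map_mx s A)^T.

Lemma starD A B : star (A + B) = star A + star B.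
Proof. by rewrite /star map_mxD linearD. Qed.

Lemma starM A B : star (A * B) = star B * star A.
Proof. by rewrite /star -[A * B]/(A *m B) map_mxM trmx_mul. Qed.

Lemma star_scalar a : star a%:M = (s a)%:M.
Proof. by rewrite /star map_scalar_mx tr_scalar_mx. Qed.

Lemma starK : involutive star.
Proof. by move=> A; apply/matrixP => i j; rewrite !mxE sK. Qed.

Lemma star1 : star 1 = 1.
Proof. by rewrite -[1 in LHS]/(1%:M) star_scalar rmorph1. Qed.

Lemma star_unit g : star (GLval g) \is a GRing.unit.
Proof. by rewrite unitmx_tr map_unitmx GL_unitmx. Qed.

Definition starg g : {'GL_n[K]} := FinRing.Unit (star_unit g).

Lemma stargE g : GLval (starg g) = star (GLval g).
Proof. by []. Qed.

Lemma stargM g h : starg (g * h)%g = (starg h * starg g)%g.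
Proof. by apply: val_inj; rewrite /= starM. Qed.

Lemma stargK : involutive starg.
Proof. by move=> g; apply: val_inj; rewrite /= starK. Qed.

Lemma starg1 : starg 1%g = 1%g.
Proof. by apply: val_inj; rewrite /= star1. Qed.

Lemma stargV g : starg g^-1%g = (starg g)^-1%g.
Proof. by apply: (mulgI (starg g)); rewrite -stargM mulVg mulgV starg1. Qed.

(* Hilbert 90 bounds the kernel of w |-> w w^*, hence its image contains every
   hermitian element. *)
Lemma hermitian_norm z : starg z = z ->
  exists2 w, z = (w * starg w)%g & forall y, commute y z -> commute y w.
Proof.
(* The double centralizer of [z]: abelian, stable under [starg] because [z] is hermitian, and
   commuting with all that commutes with [z]. *)
move=> zH; pose S := 'Z('C[z]%G)%G.
have SP w : reflect (commute w z /\ forall y, commute y z -> commute y w) (w \in S).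
  apply: (iffP setIP) => [[/cent1P wz /centP wC]|[wz wC]]; split=> //.
  - by move=> y yz; apply/commute_sym/wC/cent1P.
  - exact/cent1P.
  - by apply/centP => y /cent1P /wC /commute_sym.
have Sab w w' : w \in S -> w' \in S -> commute w w'.
  by move=> /SP[wz wC] /SP[wz' wC']; apply: wC'.
have star_comm x : commute x z -> commute (starg x) z.
  by move=> /(congr1 starg); rewrite !stargM zH => /esym.
have starS w : w \in S -> starg w \in S.
  move/SP => [wz wC]; apply/SP; split; first exact: star_comm.
  by move=> y /star_comm/wC/(congr1 starg); rewrite !stargM stargK => /esym.
have zS : z \in S by apply/SP; split.
(* Two endomorphisms of the abelian group S. Hilbert 90 puts the kernel of the first inside the
   image of the second; since im [Nm] lies in ker [Dm], comparing orders gives equality there, and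
   ker [Dm] consists of the hermitian elements. *)
pose Nm w := (w * starg w)%g; pose Dm w := (w * (starg w)^-1)%g.
have NmM : {in S &, {morph Nm : x y / (x * y)%g}}.
  move=> x y xS yS; rewrite /Nm stargM -!mulgA; congr (_ * _)%g.
  by rewrite mulgA (Sab (y * starg y)%g) ?groupM ?starS // -mulgA.
have DmM : {in S &, {morph Dm : x y / (x * y)%g}}.
  move=> x y xS yS; rewrite /Dm stargM invMg -!mulgA; congr (_ * _)%g.
  by rewrite !mulgA (Sab y) ?groupV ?starS.
pose N := Morphism NmM; pose D := Morphism DmM.
have cardN : (#|('ker N)%g| * #|(N @* S)%g| = #|S|)%N.
  by rewrite card_morphim setIid Lagrange // subsetIl.
have cardD : (#|('ker D)%g| * #|(D @* S)%g| = #|S|)%N.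
  by rewrite card_morphim setIid Lagrange // subsetIl.
have kerN_sub : ('ker N)%g \subset (D @* S)%g.
  apply/subsetP => u /morphpreP[uS /set1P Nu].
  have [v [vU vE vC]] := hilbert90 sK s_omega starD starM star_scalar
    (etrans (esym (GL_ME u (starg u))) (etrans (congr1 (@GLval n K) Nu) (GL_1E n K))).
  pose vg : {'GL_n[K]} := FinRing.Unit (vU : v \is a GRing.unit).
  have vgE : vg = (u * starg vg)%g by apply: val_inj; rewrite /= -vE.
  have vS : vg \in S.
    have vgC y : commute y u -> commute y vg.
      move=> /(congr1 (@GLval n K)) yu; apply: val_inj; rewrite /=.
      exact: vC.
    move/SP: uS => [uz uC]; apply/SP; split=> [|y /uC]; last exact: vgC.
    by apply/commute_sym/vgC; apply/commute_sym.
  apply/morphimP; exists vg => //.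
  by rewrite /= /Dm {1}vgE mulgK.
have imN_sub : (N @* S)%g \subset ('ker D)%g.
  apply/subsetP => _ /morphimP[w _ wS ->]; apply/morphpreP; split.
    by rewrite groupM ?starS.
  by apply/set1P; rewrite /= /Dm /Nm stargM stargK mulgV.
have imNE : (N @* S)%g = ('ker D)%g.
  apply/eqP; rewrite eqEcard imN_sub -(leq_pmul2l (cardG_gt0 ('ker N)%G)) cardN -cardD.
  by rewrite mulnC leq_mul2l subset_leq_card ?orbT.
have : z \in ('ker D)%g.
  by apply/morphpreP; split=> //; apply/set1P; rewrite /= /Dm zH mulgV.
rewrite -imNE => /morphimP[w _ /SP[_ wC] zE].
by exists w.
Qed.

Definition isU g := (g * starg g == 1)%g.

Lemma isUP g : reflect (starg g = g^-1)%g (isU g).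
Proof.
apply: (iffP eqP) => [gU|->]; last by rewrite mulgV.
by apply: (mulgI g); rewrite gU mulgV.
Qed.

(** Unitarity of [g] and of g^x makes z = x [starg] x commute with [g]. Writing z = w [starg] w with
    w commuting with [g], the element w^-1 x is unitary and conjugates [g] as x does. *)
Lemma unitary_fusion g x : isU g -> isU (g ^ x)%g ->
  exists2 y, isU y & (g ^ x = g ^ y)%g.
Proof.
move=> /isUP gU /isUP hU; pose z := (x * starg x)%g.
have zH : starg z = z by rewrite stargM stargK.
have gz : commute g z.
  rewrite -[g]invgK; apply/commute_sym/commuteV; rewrite /commute.
  move: hU; rewrite !conjgE !(stargM, stargV) gU !invMg -!mulgA => /(congr1 (mulg x)).
  rewrite !mulgA mulgV mul1g => hU.
  by apply: (mulIg (starg x)^-1%g); rewrite /z ?mulgA mulgK hU invgK.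
have [w zE wC] := hermitian_norm zH.
have gw := wC _ gz.
exists (w^-1 * x)%g.
  by rewrite /isU stargM stargV -mulgA (mulgA x) -/z zE -mulgA mulgV mulg1 mulVg.
by rewrite conjgM; congr (_ ^ _)%g; rewrite conjgE invgK mulgA -gw mulgK.
Qed.

(* If B intertwines g and the inverse of g^*, then so does B^*; H90 turns B into a
   hermitian vB. *)
Lemma unitary_representative g b : ((starg g)^-1 = g ^ b)%g -> exists x, isU (g ^ x)%g.
Proof.
(* [u] measures how far [b] is from hermitian: v = u tau(v) says exactly that v b is hermitian. *)
move=> gb; pose u := (starg b * b^-1)%g.
have gbg : (g * b * starg g = b)%g.
  by rewrite -[starg g]invgK gb conjgE !invMg invgK !mulgA mulgK mulgV mul1g.
have gu : commute g u.
  have gbg' : (g * starg b * starg g = starg b)%g.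
    by rewrite -{2}gbg !stargM stargK mulgA.
  have bV : (b^-1 = (starg g)^-1 * b^-1 * g^-1)%g by rewrite -{1}gbg !invMg mulgA.
  rewrite /commute /u; apply/esym.
  transitivity ((g * starg b * starg g) * ((starg g)^-1 * b^-1 * g^-1) * g)%g.
    by rewrite gbg' -bV.
  by rewrite !mulgA mulgK mulgKV.
(* The adjoint with respect to the form [b], in general not an involution; hence the generality of
   [hilbert90]. *)
pose tau (x : 'M[K]_n.-1.+1) := GLval b * star x * GLval b^-1%g.
have bV : GLval b * GLval b^-1%g = 1 by rewrite -GL_ME mulgV GL_1E.
have Vb : GLval b^-1%g * GLval b = 1 by rewrite -GL_ME mulVg GL_1E.
have tauD (x y : 'M[K]_n.-1.+1) : tau (x + y) = tau x + tau y by rewrite /tau starD mulrDr mulrDl.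
have tauM (x y : 'M[K]_n.-1.+1) : tau (x * y) = tau y * tau x.
  by rewrite /tau starM !mulrA -(mulrA _ (GLval b^-1%g)) Vb mulr1.
have tau_scalar a : tau a%:M = (s a)%:M.
  rewrite /tau star_scalar -[_ * _ * _]/(_ *m _ *m _) mul_mx_scalar -scalemxAl.
  by rewrite [_ *m _]bV scalemx1.
have u_tau : GLval u * tau (GLval u) = 1.
  rewrite /tau -stargE -!GL_ME -[RHS](GL_1E n K); congr (GLval _).
  by rewrite /u stargM stargK stargV !mulgA mulgKV mulgK mulgV.
have [v [vU vE vC]] := hilbert90 sK s_omega tauD tauM tau_scalar u_tau.
pose vg : {'GL_n[K]} := FinRing.Unit (vU : v \is a GRing.unit).
have gv : commute g vg.
  apply: val_inj; rewrite /=; apply: vC.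
  by move/(congr1 (@GLval n K)): gu.
pose h := (vg * b)%g.
have hH : starg h = h.
  have vgE : vg = (u * (b * starg vg * b^-1))%g by apply: val_inj; rewrite /= {1}vE.
  by rewrite {2}/h vgE /u /h stargM !mulgA !mulgKV.
have ghg : (g * h * starg g = h)%g.
  by rewrite /h mulgA gv -!mulgA (mulgA g) gbg.
(* [g] preserves the hermitian form h, and h = w [starg] w is a change of basis to the standard
   form. *)
have [w hE wC] := hermitian_norm hH.
exists w; rewrite /isU conjgE !(stargM, stargV) -!mulgA (mulgA w) -hE.
by rewrite (mulgA h) (mulgA g) (mulgA g h) ghg hE !mulgA mulVg mul1g mulgV.
Qed.

End Star.

(** * Counting classes in central quotients *)

Section CentralQuotient.
Local Open Scope group_scope.

Section ClassCounts.
Variables (gT : finGroupType) (G : {group gT}).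

Definition classes_with (P : pred gT) := [set C in classes G | [forall g in C, P g]].

(** [T] is a relation because types are obtained by an existence proof; a choice function turns it
    into a bijection between classes and valid types. *)
Lemma card_classes_type (X : finType) (T : gT -> X -> Prop) (V : {set X})
    (P : pred gT) (Q : pred X) :
  (forall g, g \in G -> exists x, T g x) ->
  (forall g x, g \in G -> T g x -> x \in V) ->
  (forall x, x \in V -> exists2 g, g \in G & T g x) ->
  (forall g h x y, g \in G -> h \in G -> T g x -> T h y -> (x == y) = (h \in g ^: G)) ->
  (forall g x, g \in G -> T g x -> P g = Q x) ->
  #|classes_with P| = #|[set x in V | Q x]|.
Proof.
move=> T_ex T_V T_surj T_inj PQ.
have [x0 _] := T_ex 1 (group1 G).
have /fin_all_exists[f fP] : forall g, exists x, g \in G -> T g x.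
  by move=> g; case: (boolP (g \in G)) => [/T_ex[x]|_]; [exists x | exists x0].
have fE g h : g \in G -> h \in G -> (f g == f h) = (h \in g ^: G).
  by move=> Gg Gh; apply: T_inj => //; apply: fP.
have reprE C : C \in classes G -> repr C \in G /\ C = repr C ^: G by move/repr_classesP.
rewrite -(card_in_imset (f := fun C => f (repr C))).
  apply: eq_card => x; rewrite inE; apply/imsetP/andP.
    case=> C; rewrite inE => /andP[CG /forall_inP CP] ->.
    have [Gr CE] := reprE _ CG; split; first exact: T_V (fP _ Gr).
    by rewrite -(PQ _ _ Gr (fP _ Gr)); apply/CP/(mem_repr_classes CG).
  case=> Vx Qx; have [g Gg Tgx] := T_surj _ Vx.
  have CG : g ^: G \in classes G by apply: mem_classes.
  have [Gr CE] := reprE _ CG.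
  exists (g ^: G).
    rewrite inE CG; apply/forall_inP => h gGh.
    have Gh : h \in G by apply: subsetP gGh; apply: class_subG.
    rewrite (PQ _ _ Gh (fP _ Gh)).
    suff /eqP <- : x == f h by [].
    by rewrite (T_inj g h) //; apply: fP.
  by apply/eqP; rewrite (T_inj g (repr (g ^: G))) ?(mem_repr_classes CG) //; apply: fP.
move=> C D; rewrite !inE => /andP[CG _] /andP[DG _] eq_f.
have [Gr CE] := reprE _ CG; have [Gr' DE] := reprE _ DG.
by rewrite CE DE; apply/class_eqP; rewrite class_sym -fE // eq_f.
Qed.

(** For fixed g, the h with g^h = tau(g) form a coset of the centralizer or the empty set, so each
    class fixed by tau contributes |G| pairs. *)
Lemma card_conj_pairs (tau : gT -> gT) :
  {in G &, forall g h, tau (g ^ h) = tau g ^ h} ->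
  #|[set p : gT * gT | [&& p.1 \in G, p.2 \in G & p.1 ^ p.2 == tau p.1]]|
  = (#|G| * #|classes_with (fun g => tau g \in g ^: G)|)%N.
Proof.
move=> tauJ.
have fibre g : g \in G ->
    #|[set h in G | g ^ h == tau g]| = ((tau g \in g ^: G) * #|'C_G[g]|)%N.
  move=> Gg; case: imsetP => [[k Gk ->]|no_k]; last first.
    rewrite mul0n; apply/eqP; rewrite cards_eq0; apply/eqP/setP => h; rewrite !inE.
    by apply/andP => -[Gh /eqP gh]; case: no_k; exists h.
  rewrite mul1n -(card_rcoset 'C_G[g] k); apply: eq_card => h.
  rewrite in_set mem_rcoset in_setI groupMr ?groupV //; congr (_ && _).
  rewrite -(inj_eq (conjg_inj k^-1)) -!conjgM mulgV conjg1 conjgE -(inj_eq (mulgI (h * k^-1))).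
  rewrite !mulgA mulgV mul1g; apply/eqP/cent1P => c.
    by rewrite /commute mulgA -c.
  by rewrite c mulgA.
rewrite -sum1_card (partition_big (fun p => p.1) (mem G)) /=; last by move=> p; rewrite inE => /andP[].
under eq_bigr => g Gg.
  rewrite (_ : \sum_(_ | _) _ = #|[set h in G | (g ^ h == tau g)%g]|)%N; last first.
    rewrite -sum1_card (reindex_onto (fun h => (g, h)) snd) /=; last first.
      by move=> [a b]; rewrite inE /= => /andP[_ /eqP ->].
    by apply: eq_bigl => h; rewrite !inE /= !eqxx Gg !andbT.
  rewrite fibre //; over.
rewrite (set_partition_big _ (classes_partition G)) /= big_mkcond /=.
rewrite mulnC -sum_nat_const [RHS]big_mkcond; apply: eq_bigr => C _ /=; rewrite inE.
case: imsetP => [[g Gg ->]|] //=.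
have tau_cl h : h \in g ^: G -> (tau h \in h ^: G) = (tau g \in g ^: G).
  case/imsetP => k Gk ->; rewrite tauJ // (class_eqP (memJ_class g Gk)).
  by rewrite !(class_sym _ _ g) (class_eqP (memJ_class (tau g) Gk)).
have cent_cl h : h \in g ^: G -> #|'C_G[h]| = #|'C_G[g]|.
  by case/imsetP => k Gk ->; rewrite cent1J -{1}(conjGid Gk) -conjIg cardJg.
rewrite (eq_bigr (fun=> (tau g \in g ^: G) * #|'C_G[g]|)%N); last first.
  by move=> h gh; rewrite tau_cl // cent_cl.
rewrite sum_nat_const mulnCA -index_cent1 [(_ * #|'C_G[g]|)%N]mulnC Lagrange ?subsetIl //.
have -> : [forall h in g ^: G, tau h \in h ^: G] = (tau g \in g ^: G).
  apply/forall_inP/idP => [|H h gh]; first by apply; apply: class_refl.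
  by rewrite tau_cl.
by case: (_ \in _); rewrite ?mul1n ?mul0n.
Qed.

End ClassCounts.

(** The pairs are sorted by the value of g^h g, and again by their images in G / Z, over which every
    fibre has |Z|^2 elements. *)
Lemma card_real_classes_quotient (gT : finGroupType) (G Z : {group gT}) :
  Z \subset G -> Z \subset 'C(G) ->
  (#|Z| * #|real_classes (G / Z)|
   = \sum_(z in Z) #|classes_with G (fun g => (z * g^-1)%g \in g ^: G)|)%N.
Proof.
move=> sZG cZG.
have nZG : G \subset 'N(Z) by rewrite cents_norm // centsC.
pose E := [set p : gT * gT | [&& p.1 \in G, p.2 \in G & p.1 ^ p.2 * p.1 \in Z]].
pose Eq := [set p : coset_of Z * coset_of Z |
  [&& p.1 \in G / Z, p.2 \in G / Z & p.1 ^ p.2 == (p.1)^-1]].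
have cardEq : #|Eq| = (#|G / Z| * #|real_classes (G / Z)|)%N.
  by rewrite /Eq card_conj_pairs // => g h _ _; rewrite conjVg.
have cardE : #|E| = (\sum_(z in Z) #|G| * #|classes_with G (fun g => (z * g^-1)%g \in g ^: G)|)%N.
  rewrite -sum1_card (partition_big (fun p => p.1 ^ p.2 * p.1) (mem Z)) /=; last first.
    by move=> p; rewrite inE => /and3P[].
  apply: eq_bigr => z Zz; rewrite -card_conj_pairs.
    rewrite -sum1_card; apply: eq_bigl => -[g h]; rewrite !inE /=.
    rewrite -(inj_eq (mulIg g^-1) _ z) mulgK.
    by case: (_ \in G) => //=; case: (_ \in G) => //=; case: eqP => [->|]; rewrite ?andbF // mulgKV Zz.
  move=> g h Gg Gh; rewrite conjMg conjVg; congr (_ * _).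
  by rewrite conjgE (centsP cZG z Zz h Gh) mulKg.
have fibre a : a \in G / Z -> #|[set g in G | coset Z g == a]| = #|Z|.
  case/morphimP => g0 Ng0 Gg0 ->; rewrite -(card_rcoset Z g0); apply: eq_card => g.
  rewrite !inE; apply/andP/idP => [[Gg /eqP eg]|Zg].
    by apply/(rcoset_kercosetP (subsetP nZG _ Gg) Ng0).
  have Gg : g \in G by move: Zg; rewrite mem_rcoset => /(subsetP sZG); rewrite groupMr // groupV.
  by split=> //; apply/eqP/(rcoset_kercosetP (subsetP nZG _ Gg) Ng0).
have cardE' : #|E| = (#|Eq| * (#|Z| * #|Z|))%N.
  rewrite -sum_nat_const -sum1_card.
  rewrite (partition_big (fun p => (coset Z p.1, coset Z p.2)) (mem Eq)) /=; last first.
    move=> [g h]; rewrite !inE /= => /and3P[Gg Gh ghZ].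
    rewrite !mem_quotient //= -morphJ ?(subsetP nZG) // eq_mulgV1 invgK.
    by rewrite -morphM ?groupJ ?(subsetP nZG) //; apply/eqP/coset_id.
  apply: eq_bigr => -[a b]; rewrite inE /= => /and3P[aG bG ab].
  rewrite -{1}(fibre a aG) -(fibre b bG) -cardsX -sum1_card.
  apply: eq_bigl => -[g h]; rewrite !inE /= xpair_eqE.
  case Gg: (g \in G) => //=; case Gh: (h \in G); rewrite ?andbF //=.
  case: eqP => [ga|]; rewrite ?andbF //=; case: eqP => [hb|]; rewrite ?andbF //= andbT.
  move: ab; rewrite -ga -hb -morphJ ?(subsetP nZG) // eq_mulgV1 invgK.
  by rewrite -morphM ?groupJ ?(subsetP nZG) // => /eqP /coset_idr; apply; rewrite groupM ?groupJ ?(subsetP nZG).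
apply/eqP; rewrite -(eqn_pmul2l (cardG_gt0 G)) big_distrr /= -cardE cardE' cardEq.
by rewrite card_quotient // -(Lagrange sZG); apply/eqP; ring.
Qed.

End CentralQuotient.

(** * Classes of the linear and unitary groups *)

Section TypeTuples.
Variables (F : finFieldType) (N : nat).

(** The bound makes this a finite type and loses nothing: weights being at least 1, the degree
    equation forces degrees at most N. *)
Definition type_tuple := {ffun 'I_N -> {poly_N.+1 F}}.
Implicit Types x : type_tuple.

Definition type_fun x (i : 'I_N) : {poly F} := x i.

Definition valid_type x :=
  [forall i, (type_fun x i \is monic) && ((type_fun x i)`_0 != 0)]
  && (\sum_(i < N) (N - i) * deg (type_fun x i) == N)%N.

(** The determinant of any element of type [x]; for real classes it is 1 or -1. *)
Definition type_sign x : F :=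
  \prod_i ((-1) ^+ deg (type_fun x i) * (type_fun x i)`_0) ^+ (N - i).

Definition types_fixed mu (E : pred {poly F}) : {set type_tuple} :=
  [set x | valid_type x &
    [forall i, (recip mu (type_fun x i) == type_fun x i) && E (type_fun x i)]].

Lemma type_fun_inj x y : type_fun x =1 type_fun y -> x = y.
Proof. by move=> xy; apply/ffunP => i; apply: val_inj; apply: xy. Qed.

Lemma type_tuple_of (y : 'I_N -> {poly F}) :
  (forall i, y i \is monic) ->
  (\sum_(i < N) (N - i) * deg (y i) = N)%N -> exists x, type_fun x =1 y.
Proof.
move=> my degy; exists [ffun i => npolyp N.+1 (y i)] => i.
rewrite /type_fun ffunE npolypK // polySpred ?monic_neq0 // ltnS -[leqRHS]degy (bigD1 i) //=.
by rewrite (leq_trans _ (leq_addr _ _)) // leq_pmull // subn_gt0.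
Qed.

End TypeTuples.

(** * Real classes of PGL_n and of GL_n inside SL_n *)

Section GeneralLinear.
Variables (F : finFieldType) (n : nat).
Hypothesis n_gt0 : (0 < n)%N.
Local Notation N := n.-1.+1.
Implicit Types (g h : {'GL_n[F]}) (x : type_tuple F N).

Definition gl_type g x := has_type (GLval g) (type_fun x).

Lemma mem_GLn g : g \in GLn n F.
Proof. by rewrite /GLn gtn_eqF // inE. Qed.

Lemma gl_type_exists g : exists x, gl_type g x.
Proof.
have [y gy] := has_type_exists (GLval g).
have [x xy] := type_tuple_of gy.1 (has_type_deg gy).
by exists x; apply: eq_has_type gy => i; rewrite xy.
Qed.

Lemma gl_type_valid g x : gl_type g x -> valid_type x.
Proof.
move=> gx; apply/andP; split; last by apply/eqP/(has_type_deg gx).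
have /forallP x0 : [forall i, (type_fun x i)`_0 != 0].
  by rewrite -(has_type_unit gx) GL_unitmx.
by apply/forallP => i; rewrite gx.1 x0.
Qed.

Lemma gl_type_surj x : valid_type x -> exists g, gl_type g x.
Proof.
case/andP => /forallP xP /eqP degx.
have [|A [Ax _]] := has_type_realize _ degx; first by move=> i; case/andP: (xP i).
have uA : A \in unitmx.
  by rewrite (has_type_unit Ax); apply/forallP => i; case/andP: (xP i).
by exists (FinRing.Unit (uA : A \is a GRing.unit)).
Qed.

Lemma gl_conjP g h x y : gl_type g x -> gl_type h y ->
  x = y <-> exists k, h = (g ^ k)%g.
Proof.
move=> gx hy; have simP := similarP gx hy; split=> [xy|[k hE]].
  have [|P uP gP] := simP.2; first by move=> i; rewrite xy.
  exists (FinRing.Unit (uP : P \is a GRing.unit)); apply: (mulgI (FinRing.Unit (uP : P \is a GRing.unit))).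
  by rewrite conjgE !mulgA mulgV mul1g; apply: val_inj; rewrite /= -[LHS]gP.
apply: type_fun_inj; apply/simP; exists (GLval k); first exact: GL_unitmx.
by rewrite hE conjgE -!GL_MxE !mulgA mulgV mul1g.
Qed.

Lemma gl_type_conj g k x : gl_type g x -> gl_type (g ^ k)%g x.
Proof.
move=> gx; have [y gy] := gl_type_exists (g ^ k)%g.
by have -> : x = y by apply/(gl_conjP gx gy); exists k.
Qed.

Lemma scalar_unit (a : F) : a != 0 -> (a%:M : 'M[F]_N) \is a GRing.unit.
Proof. by move=> nza; rewrite -[_ \is a _]/(_ \in unitmx) unitmxE det_scalar unitrX // unitfE. Qed.

(** Total thanks to the default value 1, taken at a = 0. *)
Definition scal (a : F) : {'GL_n[F]} := insubd (1%g : {'GL_n[F]}) (a%:M : 'M[F]_N).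

Lemma scalE a : a != 0 -> GLval (scal a) = a%:M.
Proof. by move=> nza; rewrite /scal -[GLval _]/(val _) val_insubd scalar_unit. Qed.

Lemma has_type_scalV g x a : a != 0 -> gl_type g x ->
  has_type (GLval (scal a * g^-1)%g) (fun i => recip a (type_fun x i)).
Proof.
move=> nza gx; rewrite GL_MxE scalE // mul_scalar_mx GL_VxE.
by apply: has_type_recip gx; rewrite ?GL_unitmx.
Qed.

Lemma conj_scalV g x a : a != 0 -> gl_type g x ->
  (exists k, (scal a * g^-1 = g ^ k)%g) <->
  [forall i, recip a (type_fun x i) == type_fun x i].
Proof.
move=> nza gx; have agx := has_type_scalV nza gx.
have [y gy] := gl_type_exists (scal a * g^-1)%g.
rewrite -(gl_conjP gx gy); have yE := has_type_inj gy agx.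
split=> [xy|/forallP xE].
  by apply/forallP => i; rewrite -yE xy.
by apply: type_fun_inj => i; rewrite yE (eqP (xE i)).
Qed.

Lemma card_classes_GLn (P : pred {'GL_n[F]}) (Q : pred (type_tuple F N)) :
  (forall g x, gl_type g x -> P g = Q x) ->
  #|classes_with (GLn n F) P| = #|[set x | valid_type x & Q x]|.
Proof.
move=> PQ; rewrite (@card_classes_type _ _ _ gl_type [set x | valid_type x] P Q).
- by apply: eq_card => x; rewrite !inE.
- by move=> g _; apply: gl_type_exists.
- by move=> g x _ /gl_type_valid; rewrite inE.
- by move=> x; rewrite inE => /gl_type_surj[g gx]; exists g; rewrite ?mem_GLn.
- move=> g h x y _ _ gx hy; apply/eqP/imsetP => [|[k _ hk]].
    by case/(gl_conjP gx hy) => k ->; exists k; rewrite ?mem_GLn.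
  by apply/(gl_conjP gx hy); exists k.
- by move=> g x _; apply: PQ.
Qed.

Lemma conjg_scalV_GLn g x a : a != 0 -> gl_type g x ->
  ((scal a * g^-1)%g \in (g ^: GLn n F)%g) = [forall i, recip a (type_fun x i) == type_fun x i].
Proof.
move=> nza gx; apply/imsetP/idP => [[k _ E]|/(conj_scalV nza gx)[k E]].
  by apply/(conj_scalV nza gx); exists k.
by exists k; rewrite ?mem_GLn.
Qed.

Lemma scal1 : scal 1 = 1%g.
Proof. by apply: val_inj; rewrite /= [LHS]scalE ?oner_eq0. Qed.

Lemma scal_inj : {in [pred a | a != 0] &, injective scal}.
Proof.
move=> a b nza nzb /(congr1 (@GLval n F)); rewrite !scalE // => /matrixP/(_ 0 0).
by rewrite !mxE.
Qed.

Lemma scal_central a (A : {set {'GL_n[F]}}) : a != 0 -> scal a \in ('C(A))%g.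
Proof.
move=> nza; apply/centP => g _; apply: val_inj.
by rewrite -![val _]/(GLval _) !GL_MxE scalE // scalar_mxC.
Qed.

Lemma card_real_PGLn :
  (#|[pred a : F | a != 0%R]| * #|real_classes (PGLn n F)|
   = \sum_(a : F | a != 0%R) #|types_fixed N a predT|)%N.
Proof.
have ZE : scalarGL n F = [set scal a | a in [pred a : F | a != 0]].
  apply/setP => g; rewrite inE mem_GLn /=.
  apply/existsP/imsetP => [[a /andP[nza /eqP ga]]|[a nza ->]].
    by exists a => //; apply: val_inj; rewrite /= ga -[RHS]/(GLval _) scalE.
  by exists a; rewrite inE in nza; rewrite nza scalE ?eqxx.
have sZG : scalarGL n F \subset GLn n F by apply/subsetP => g _; apply: mem_GLn.
have cZG : scalarGL n F \subset ('C(GLn n F))%g.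
  by rewrite ZE; apply/subsetP => _ /imsetP[a nza ->]; apply: scal_central.
have := @card_real_classes_quotient _ (GLn n F) (scalarGL_group n F) sZG cZG.
rewrite /= -/(PGLn n F); set R := #|real_classes (PGLn n F)|.
rewrite ZE card_in_imset; last exact: scal_inj.
rewrite big_imset /=; last exact: scal_inj.
move=> ->; apply: eq_bigr => a nza.
rewrite (@card_classes_GLn _ (fun x => [forall i, recip a (type_fun x i) == type_fun x i])).
  apply: eq_card => x; rewrite !inE; congr (_ && _).
  by apply: eq_forallb => i; rewrite andbT.
by move=> g x; apply: conjg_scalV_GLn.
Qed.

Lemma gl_type_det g x : gl_type g x -> \det (GLval g) = type_sign x.
Proof. exact: has_type_det. Qed.

Lemma sub_class_det (G : {group {'GL_n[F]}}) (S C : {set {'GL_n[F]}}) :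
  S = [set g in G | \det (GLval g) == 1] -> C \in classes G ->
  (C \subset S) = [forall g in C, \det (GLval g) == 1].
Proof.
move=> -> CG; apply/subsetP/forall_inP => CS g Cg; first by have := CS g Cg; rewrite inE => /andP[].
rewrite inE CS // andbT; case/imsetP: CG Cg => h Gh ->.
by apply: subsetP; apply: class_subG.
Qed.

Lemma real_classes_inE (G : {group {'GL_n[F]}}) (S : {set {'GL_n[F]}}) :
  S = [set g in G | \det (GLval g) == 1] ->
  real_classes_in G S
  = classes_with G (fun g => (g^-1 \in g ^: G)%g && (\det (GLval g) == 1)).
Proof.
move=> SE; apply/setP => C; rewrite !inE.
case CG: (C \in classes G) => //=; rewrite (sub_class_det SE CG).
apply/andP/forall_inP => [[/forall_inP C1 /forall_inP C2] g Cg|H].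
  by rewrite C2 // andbT; apply: C1.
by split; apply/forall_inP => g /H /andP[].
Qed.

Lemma card_real_SLn :
  #|real_classes_in (GLn n F) (SLn n F)|
  = #|[set x in types_fixed N (1 : F) predT | type_sign x == 1]|.
Proof.
rewrite real_classes_inE //.
rewrite (@card_classes_GLn _ (fun x : type_tuple F N => [forall i, recip 1 (type_fun x i) == type_fun x i]
  && (type_sign x == 1))).
  apply: eq_card => x; rewrite !inE -!andbA; congr (_ && (_ && _)).
  by congr (_ && _); apply: eq_forallb => i; rewrite andbT.
move=> g x gx; rewrite (gl_type_det gx) -(conjg_scalV_GLn _ gx) ?oner_eq0 //.
by rewrite scal1 mul1g.
Qed.

End GeneralLinear.

(** * Real classes of PGU_n and of U_n inside SU_n *)

Section Unitary.
Variables (q n : nat) (K : finFieldType) (s : {rmorphism K -> K}) (omega : K).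
Hypotheses (n_gt0 : (0 < n)%N) (cardK : #|K| = (q ^ 2)%N).
Hypotheses (sE : forall x, s x = x ^+ q) (sK : involutive s) (s_omega : s omega != omega).
Local Notation N := n.-1.+1.
Implicit Types (g h : {'GL_n[K]}) (x : type_tuple K N).

Let U : {group {'GL_n[K]}} := Group (Un_group_set n cardK).

(** Stability of the roots under r -> 1 / r^q, the effect of the conjugate transpose inverse on
    eigenvalues. *)
Definition selfadj (p : {poly K}) := recip 1 (map_poly s p) == p.

Lemma mem_Un g : (g \in U) = isU s g.
Proof.
rewrite inE mem_GLn //= /isU.
have -> : map_mx (fun a : K => a ^+ q) (GLval g) = map_mx s (GLval g).
  by apply/matrixP => i j; rewrite !mxE sE.
rewrite -[(map_mx s _)^T]/(GLval (starg s g)) -GL_VxE (inj_eq val_inj).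
by rewrite eq_mulgV1 invgK.
Qed.

Lemma gl_type_star g x : gl_type g x ->
  has_type (GLval (starg s g)^-1%g) (fun i => recip 1 (map_poly s (type_fun x i))).
Proof.
move=> gx; rewrite GL_VxE -[invmx _]scale1r.
apply: has_type_recip; rewrite ?oner_eq0 ?GL_unitmx //.
by apply/has_type_tr/has_type_map.
Qed.

Lemma starV_conj g x : gl_type g x ->
  (exists k, (starg s g)^-1 = g ^ k)%g <-> [forall i, selfadj (type_fun x i)].
Proof.
move=> gx; have sgx := gl_type_star gx.
have [y gy] := gl_type_exists (starg s g)^-1%g.
rewrite -(gl_conjP gx gy); have yE := has_type_inj gy sgx.
split=> [xy|/forallP xE].
  by apply/forallP => i; rewrite /selfadj -yE xy.
by apply: type_fun_inj => i; rewrite yE (eqP (xE i)).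
Qed.

(** A class of GL_n meets U_n exactly when its type is self-adjoint, by [unitary_representative],
    and then in a single class of U_n, by [unitary_fusion]. *)
Lemma card_classes_Un (P : pred {'GL_n[K]}) (Q : pred (type_tuple K N)) :
  (forall g x, g \in U -> gl_type g x -> P g = Q x) ->
  #|classes_with U P|
  = #|[set x | valid_type x & [forall i, selfadj (type_fun x i)] && Q x]|.
Proof.
move=> PQ; pose V := [set x : type_tuple K N | valid_type x & [forall i, selfadj (type_fun x i)]].
rewrite (@card_classes_type _ _ _ (@gl_type K n) V P Q) //.
- by apply: eq_card => x; rewrite !inE andbA.
- by move=> g _; apply: gl_type_exists.
- move=> g x; rewrite mem_Un => /isUP gU gx; rewrite inE (gl_type_valid gx) /=.
  by apply/(starV_conj gx); exists 1%g; rewrite gU invgK conjg1.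
- move=> x; rewrite inE => /andP[/gl_type_surj[g gx] /(starV_conj gx)[b gb]].
  have [k kU] := unitary_representative sK s_omega gb.
  by exists (g ^ k)%g; rewrite ?mem_Un //; apply: gl_type_conj.
- move=> g h x y; rewrite !mem_Un => gU hU gx hy; apply/eqP/imsetP => [|[k _ hk]].
    case/(gl_conjP gx hy) => k hk; rewrite hk in hU.
    have [k' k'U kE] := unitary_fusion sK s_omega gU hU.
    by exists k'; rewrite ?mem_Un // hk.
  by apply/(gl_conjP gx hy); exists k.
Qed.

Lemma scal_Un a : a != 0 -> (scal n a \in U) = (a ^+ q.+1 == 1).
Proof.
move=> nza; rewrite mem_Un /isU -(inj_eq val_inj) -![val _]/(GLval _) GL_MxE stargE scalE // GL_1E.
rewrite star_scalar sE -scalar_mxM -exprS.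
apply/eqP/eqP => [/matrixP/(_ 0 0)|->] //; by rewrite !mxE.
Qed.

Lemma conjg_scalV_Un g x a : a != 0 -> a ^+ q.+1 = 1 -> g \in U -> gl_type g x ->
  ((scal n a * g^-1)%g \in (g ^: U)%g) = [forall i, recip a (type_fun x i) == type_fun x i].
Proof.
move=> nza a1 gU gx; have aU : scal n a \in U by rewrite scal_Un // a1.
apply/imsetP/idP => [[k _ E]|/(conj_scalV nza gx)[k E]].
  by apply/(conj_scalV nza gx); exists k.
have : (g ^ k)%g \in U by rewrite -E groupM ?groupV.
rewrite mem_Un => gkU; rewrite mem_Un in gU.
have [k' k'U kE] := unitary_fusion sK s_omega gU gkU.
by exists k'; rewrite ?mem_Un // E.
Qed.

Lemma card_real_PGUn :
  (#|[pred a : K | (a ^+ q.+1 == 1)%R]| * #|real_classes (PGUn q n K)|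
   = \sum_(a : K | (a ^+ q.+1 == 1)%R) #|types_fixed N a selfadj|)%N.
Proof.
have nz (a : K) : a ^+ q.+1 == 1 -> a != 0.
  by apply: contraTneq => ->; rewrite exprS mul0r eq_sym oner_neq0.
have scalI : {in [pred a : K | a ^+ q.+1 == 1] &, injective (scal n)}.
  by move=> a b aH bH; apply: scal_inj => //; apply: nz.
have ZE : scalarU q n K = [set scal n a | a in [pred a : K | a ^+ q.+1 == 1]].
  apply/setP => g; rewrite inE mem_GLn //=.
  apply/existsP/imsetP => [[a /andP[aH /eqP ga]]|[a aH ->]].
    by exists a => //; apply: val_inj; rewrite /= ga -[RHS]/(GLval _) scalE ?nz.
  by exists a; rewrite inE in aH; rewrite aH scalE ?nz ?eqxx.
have sZG : scalarU q n K \subset U.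
  by rewrite ZE; apply/subsetP => _ /imsetP[a aH ->]; rewrite scal_Un ?nz.
have cZG : scalarU q n K \subset ('C(U))%g.
  by rewrite ZE; apply/subsetP => _ /imsetP[a aH ->]; apply/scal_central/nz.
have := @card_real_classes_quotient _ U (scalarU_group q n K) sZG cZG.
rewrite /= -/(PGUn q n K); set R := #|real_classes (PGUn q n K)|.
rewrite ZE card_in_imset // big_imset //= => ->; apply: eq_bigr => a aH.
rewrite (@card_classes_Un _ (fun x => [forall i, recip a (type_fun x i) == type_fun x i])).
  apply: eq_card => x; rewrite !inE; congr (_ && _); apply/andP/forallP.
    by case=> /forallP xs /forallP xr i; rewrite xs xr.
  by move=> xP; split; apply/forallP => i; case/andP: (xP i).
by move=> g x gU; apply: conjg_scalV_Un => //; [apply: nz | apply/eqP].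
Qed.

Lemma card_real_SUn :
  #|real_classes_in (Un q n K) (SUn q n K)|
  = #|[set x in types_fixed N 1 selfadj | type_sign x == 1]|.
Proof.
rewrite (@real_classes_inE _ _ U) //.
rewrite (@card_classes_Un _ (fun x : type_tuple K N => [forall i, recip 1 (type_fun x i) == type_fun x i]
  && (type_sign x == 1))).
  apply: eq_card => x; rewrite !inE -!andbA.
  congr [&& _, _ & _]; rewrite andbA; congr (_ && _); apply/andP/forallP.
    by case=> /forallP xs /forallP xr i; rewrite xs xr.
  by move=> xP; split; apply/forallP => i; case/andP: (xP i).
move=> g x gU gx; rewrite (gl_type_det gx) -(conjg_scalV_Un (oner_neq0 K) (expr1n _ _) gU gx).
by rewrite scal1 mul1g.
Qed.

End Unitary.

(** * Counting reciprocal polynomials *)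

Lemma recip_fixedP (F : fieldType) (mu : F) (p : {poly F}) : p != 0 ->
  reflect (forall i, (i <= deg p)%N -> p`_i = (p`_0)^-1 * (p`_(deg p - i) * mu ^+ (deg p - i)))
          (recip mu p == p).
Proof.
move=> nzp; apply: (iffP eqP) => [rp i le_i|pE].
  by rewrite -{1}rp coef_recip.
apply/polyP => i; have [le_i|lt_i] := leqP i (deg p); first by rewrite coef_recip // -pE.
by rewrite !nth_default // ?(leq_trans (size_recip_le _ _)) // [leqLHS]polySpred.
Qed.

(* For the linear groups T d i is the whole field and H its unit group.  For the
   unitary groups, with [#|K| = q ^ 2], T d i consists of the possible
   coefficients of X^i in a polynomial of degree d satisfying E, and H is the
   group of elements of norm 1. *)
Record recip_conditions (K : finFieldType) (mu : K) (E : pred {poly K}) (q : nat)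
    (T : nat -> nat -> {set K}) (H : {set K}) : Prop := RecipConditions {
  rc_neq0 : mu != 0;
  rc_zero : forall d i, 0 \in T d i;
  rc_one : forall d, 1 \in T d d;
  rc_card : forall d i, #|T d i| = q;
  rc_sym : forall d i a c, (i <= d)%N -> c \in T d 0%N -> c ^+ 2 = mu ^+ d ->
    a \in T d i -> c^-1 * (a * mu ^+ i) \in T d (d - i)%N;
  rc_coef : forall p : {poly K}, p \is monic -> p`_0 != 0 -> recip mu p == p ->
    E p = [forall i : 'I_(deg p).+1, p`_i \in T (deg p) i];
  rc_group : forall d c, c ^+ 2 = mu ^+ d -> (c \in T d 0%N) = (c \in H);
  rc_group_mul : forall c k, (c * mu ^+ k \in H) = (c \in H);
  rc_group1 : 1 \in H;
  rc_groupN : forall c, c \in H -> - c \in H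
}.

Section LocalCount.
Variables (K : finFieldType) (mu : K) (E : pred {poly K}) (q : nat)
  (T : nat -> nat -> {set K}) (H : {set K}).
Hypothesis cond : recip_conditions mu E q T H.

Let nz_mu := rc_neq0 cond.
Let T0 := rc_zero cond.
Let T1 := rc_one cond.
Let card_T := rc_card cond.
Let T_sym := rc_sym cond.
Let E_T := rc_coef cond.

Variable N : nat.

Definition good (p : {poly K}) :=
  [&& p \is monic, p`_0 != 0, recip mu p == p & E p].

Definition goods d : {set {poly_N.+1 K}} := [set p : {poly_N.+1 K} | good p & deg p == d].

Lemma good_coef0 p : good p -> p`_0 ^+ 2 = mu ^+ deg p /\ p`_0 \in T (deg p) 0%N.
Proof.
case/and4P => mp p0 rp; rewrite (E_T mp p0 rp) => /forallP Tp; split; last exact: (Tp ord0).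
have := elimT (recip_fixedP mu (monic_neq0 mp)) rp 0%N isT.
rewrite subn0 (_ : p`_(deg p) = 1) ?mul1r; last exact/eqP.
by move/(congr1 ( *%R p`_0)); rewrite mulrA divff // mul1r -expr2.
Qed.

Lemma good1 : good 1.
Proof.
rewrite /good monic1 coef1 oner_eq0 recip1 eqxx /=.
rewrite E_T ?monic1 ?coef1 ?oner_eq0 ?recip1 // /deg size_poly1.
by apply/forallP => i; rewrite (ord1 i) coef1.
Qed.

Lemma card_goods0 : goods 0 = [set npolyp N.+1 1].
Proof.
have oneE : npolyp N.+1 1 = 1 :> {poly K} by apply: npolypK; rewrite size_poly1.
apply/setP => p; rewrite !inE; apply/andP/eqP => [[/and4P[mp _ _ _] /eqP dp]|->].
  have szp : (size p <= 1)%N by rewrite [leqLHS]polySpred ?monic_neq0 // -/(deg p) dp.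
  apply: val_inj; rewrite /= oneE (size1_polyC szp).
  by move: mp; rewrite monicE /lead_coef -/(deg p) dp => /eqP->.
by rewrite oneE good1 /deg size_poly1.
Qed.

Section Fixed.
Variables (d : nat) (c : K).
Hypotheses (d_gt0 : (0 < d)%N) (le_dN : (d <= N)%N).
Hypotheses (cT : c \in T d 0%N) (c2 : c ^+ 2 = mu ^+ d).

Let m := d./2.

(** The values allowed for the lower coefficients, which determine the others by symmetry. In even
    degree the middle coefficient is its own mirror image: it must vanish unless c = mu^(d/2). *)
Let half (i : 'I_m.+1) : {set K} :=
  if (i : nat) == 0%N then [set c]
  else if (d == i.*2)%N && (c != mu ^+ i) then [set 0] else T d i.

Let nz_c : c != 0.
Proof. by rewrite -sqrf_eq0 c2 expf_neq0. Qed.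

Lemma card_goods_half : #|[set p in goods d | (p : {poly K})`_0 == c]| = #|family half|.
Proof.
have mE := odd_double_half d; rewrite -/m in mE.
have lt_md : (m < d)%N by rewrite -mE; case: (odd d) mE => /=; lia.
pose phi (p : {poly_N.+1 K}) := [ffun i : 'I_m.+1 => (p : {poly K})`_i].
rewrite -(card_in_imset (f := phi)); last first.
  move=> p p'; rewrite !inE => /andP[/andP[/and4P[mp _ /(recip_fixedP _ (monic_neq0 mp)) rp _] /eqP dp] /eqP pc].
  move=> /andP[/andP[/and4P[mp' _ /(recip_fixedP _ (monic_neq0 mp')) rp' _] /eqP dp'] /eqP pc'] /ffunP eq_pp'.
  have lo i : (i <= m)%N -> (p : {poly K})`_i = (p' : {poly K})`_i.
    by move=> le_im; have := eq_pp' (Ordinal (le_im : (i < m.+1)%N)); rewrite !ffunE.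
  apply: val_inj; apply/polyP => i /=; have [/lo//|lt_mi] := leqP i m.
  have [le_id|lt_di] := leqP i d; last first.
    have szE (r : {poly K}) : r \is monic -> deg r = d -> (size r <= i)%N.
      by move=> mr dr; rewrite polySpred ?monic_neq0 // -/(deg r) dr.
    by rewrite [LHS]nth_default ?[RHS]nth_default //; apply: szE.
  rewrite rp ?dp // rp' ?dp' // pc pc' lo //; lia.
apply: eq_card => h; apply/imsetP/familyP => [[p]|hF].
  rewrite !inE => /andP[/andP[gp /eqP dp] /eqP pc] -> i; rewrite ffunE /half.
  case/and4P: gp => mp p0 rp; rewrite (E_T mp p0 rp) dp => /forallP pT.
  move/(recip_fixedP _ (monic_neq0 mp)): rp => rp.
  have le_id : (i <= d)%N by have := ltn_ord i; lia.
  case: eqP => [->|_]; first by rewrite inE pc.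
  case: andP => [[/eqP d2i cmu]|_]; last exact: (pT (Ordinal (le_id : (i < d.+1)%N))).
  have := rp i; rewrite dp => /(_ le_id); rewrite pc.
  have -> : (d - i = i)%N by lia.
  move/(congr1 ( *%R c)); rewrite mulrA divff // mul1r mulrC => /eqP.
  rewrite -subr_eq0 -mulrBr mulf_eq0 => /orP[/eqP->|]; first by rewrite inE.
  by rewrite subr_eq0 (negPf cmu).
(* Extension of the lower half by the reciprocal symmetry. *)
pose a i := if (i <= m)%N then h (inord i) else c^-1 * (h (inord (d - i)) * mu ^+ (d - i)).
have hT (i : 'I_m.+1) : h i \in T d i.
  have := hF i; rewrite /half; case: eqP => [->|_]; first by rewrite inE => /eqP->.
  by case: ifP => // _; rewrite inE => /eqP->.
have h0 : h ord0 = c by have := hF ord0; rewrite /half /= inE => /eqP.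
have a_lo (i : 'I_m.+1) : a i = h i by rewrite /a -ltnS ltn_ord inord_val.
have aT i : (i <= d)%N -> a i \in T d i.
  move=> le_id; rewrite /a; case: leqP => [le_im|lt_mi].
    by have := hT (inord i); rewrite inordK.
  have lt_dim : (d - i < m.+1)%N by lia.
  have hTi := hT (inord (d - i)); rewrite inordK // in hTi.
  by have := T_sym (leq_subr i d) cT c2 hTi; rewrite subKn.
have a0 : a 0%N = c by rewrite -h0 -(a_lo ord0).
have ad : a d = 1.
  rewrite /a leqNgt lt_md /= subnn expr0 mulr1 (_ : inord 0 = ord0) ?h0 ?mulVf //.
  by apply: val_inj; rewrite /= inordK.
have a_le i : (i <= m)%N -> a i = h (inord i) by rewrite /a => ->.
have a_gt i : (m < i)%N -> a i = c^-1 * (h (inord (d - i)) * mu ^+ (d - i)).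
  by move=> lt_mi; rewrite /a leqNgt lt_mi.
have a_sym i : (i <= d)%N -> a i = c^-1 * (a (d - i)%N * mu ^+ (d - i)).
  move=> le_id; have [le_im|lt_mi] := leqP i m; last first.
    by rewrite a_gt // a_le //; lia.
  have [le_dim|lt_mdi] := leqP (d - i) m; last first.
    rewrite a_le // a_gt // subKn //.
    rewrite (_ : c^-1 * _ = h (inord i) * (mu ^+ i * mu ^+ (d - i)) / c ^+ 2).
      by rewrite -exprD subnKC // c2 mulfK // expf_neq0.
    by field.
  (* The middle coefficient, where the case distinction in [half] is needed. *)
  have d2i : (d - i = i)%N by lia.
  rewrite d2i a_le //; have := hF (inord i); rewrite /half inordK //.
  rewrite (_ : (i == 0%N) = false); last by apply/eqP; lia.
  rewrite (_ : (d == i.*2)%N = true) /=; last by apply/eqP; lia.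
  case: eqP => [->|_]; last by rewrite inE => /eqP->; rewrite mul0r mulr0.
  by move=> _; rewrite mulrC mulfK // expf_neq0.
pose p := npolyp N.+1 (\poly_(i < d.+1) a i).
have pE : p = \poly_(i < d.+1) a i :> {poly K}.
  by apply: npolypK; rewrite (leq_trans (size_poly _ _)).
have szp : size p = d.+1 by rewrite pE size_poly_eq // ad oner_eq0.
have dp : deg p = d by rewrite /deg szp.
have pa i : (i <= d)%N -> (p : {poly K})`_i = a i by move=> le_id; rewrite pE coef_poly ltnS le_id.
have mp : (p : {poly K}) \is monic by rewrite monicE /lead_coef -/(deg _) dp pa // ad.
have p0 : (p : {poly K})`_0 = c by rewrite pa.
have rp : recip mu p == p.
  apply/(recip_fixedP _ (monic_neq0 mp)) => i; rewrite dp p0 => le_id.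
  by rewrite !pa ?leq_subr // a_sym.
exists p; last by apply/ffunP => i; rewrite ffunE pa ?a_lo //; have := ltn_ord i; lia.
rewrite !inE p0 eqxx dp eqxx !andbT /good mp p0 nz_c rp /= (E_T mp) ?p0 // dp.
by apply/forallP => i; rewrite pa ?aT // -ltnS.
Qed.

Lemma card_goods_coef0 : #|[set p in goods d | (p : {poly K})`_0 == c]| =
  (q ^ (m - (~~ odd d && (c != mu ^+ m))))%N.
Proof.
rewrite card_goods_half card_family foldrE big_map big_enum /=.
rewrite big_ord_recl /half /= cards1 mul1n.
have := odd_double_half d; rewrite -/m; case: (m) => [|m']; first by rewrite big_ord0; case: (_ && _).
rewrite big_ord_recr /= => mE.
have -> : (d == m'.+1.*2)%N = ~~ odd d.
  by move: mE; case: (odd d) => /= <-; rewrite ?add0n ?add1n ?eqxx ?gtn_eqF.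
rewrite (eq_bigr (fun=> q)) => [|i _]; last first.
  rewrite (_ : (d == _)%N = false) /= ?card_T //.
  by apply/eqP; move: mE (ltn_ord i); rewrite /bump /=; case: (odd d) => /= ? ? ?; lia.
rewrite prod_nat_const card_ord /bump /=; case: ifP => _.
  by rewrite cards1 muln1 subn1.
by rewrite card_T subn0 expnSr.
Qed.

End Fixed.
End LocalCount.

(* Coefficient of t^d in (1 + sigma t + tau t^2) / (1 - q t^2). *)
Definition ell (q : nat) (sigma tau : rat) (d : nat) : rat :=
  if odd d then sigma * q%:R ^+ d./2
  else if d == 0%N then 1 else q%:R ^+ d./2 + tau * q%:R ^+ d./2.-1.

(** * Counts and signed counts of reciprocal polynomials by degree *)

Section LocalSums.
Variables (K : finFieldType) (mu : K) (E : pred {poly K}) (q : nat)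
  (T : nat -> nat -> {set K}) (H : {set K}).
Hypothesis cond : recip_conditions mu E q T H.

Let nz_mu := rc_neq0 cond.
Let T_H := rc_group cond.
Let H_mu := rc_group_mul cond.
Let H1 := rc_group1 cond.
Let HN := rc_groupN cond.

Variable N : nat.
Local Notation goods := (goods mu E N).

Let Hmu k : mu ^+ k \in H. Proof. by rewrite -[_ ^+ _]mul1r H_mu. Qed.

(** The coefficient of t in the numerator of L: in odd degree 2k + 1 the possible constant terms are
    the b mu^k with b^2 = mu. *)
Definition sqrt_count : nat := #|[set c in H | c ^+ 2 == mu]|.

Lemma sum_goods d (w : K -> rat) : (0 < d)%N -> (d <= N)%N ->
  \sum_(p in goods d) w (p : {poly K})`_0
  = \sum_(c in H | c ^+ 2 == mu ^+ d) w c * q%:R ^+ (d./2 - (~~ odd d && (c != mu ^+ d./2))).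
Proof.
move=> d_gt0 le_dN.
rewrite (partition_big (fun p : {poly_N.+1 K} => (p : {poly K})`_0)
  (fun c => (c \in H) && (c ^+ 2 == mu ^+ d))) /=; last first.
  move=> p; rewrite inE => /andP[gp /eqP dp].
  have [c2 cT] := good_coef0 cond gp; rewrite dp in c2 cT.
  by rewrite -(T_H c2) cT c2 eqxx.
apply: eq_bigr => c /andP[cH /eqP c2].
rewrite (eq_bigr (fun=> w c)) => [|p /andP[_ /eqP->]] //.
have cT : c \in T d 0%N by rewrite T_H.
have := card_goods_coef0 cond d_gt0 le_dN cT c2.
rewrite -natrX => <-; rewrite -sum1_card natr_sum mulr_sumr; apply: eq_big => p.
  by rewrite inE.
by rewrite mulr1.
Qed.

Lemma card_sqrt_odd d : odd d -> #|[set c in H | c ^+ 2 == mu ^+ d]| = sqrt_count.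
Proof.
move=> od; have dE := odd_double_half d; rewrite od in dE.
have nzm : mu ^+ d./2 != 0 by rewrite expf_neq0.
rewrite /sqrt_count -[RHS](card_imset (f := fun c => c * mu ^+ d./2)); last exact: mulIf.
apply: eq_card => c; rewrite !inE; apply/andP/imsetP => [[cH /eqP c2]|[b]].
  exists (c / mu ^+ d./2); last by rewrite divfK.
  rewrite inE -(H_mu _ d./2) divfK // cH expr_div_n c2 -exprM muln2 -{1}dE exprD expr1 /=.
  by rewrite mulfK // expf_neq0.
rewrite inE => /andP[bH /eqP b2] ->.
by rewrite H_mu bH exprMn b2 -exprM muln2 -[X in _ == _ ^+ X]dE exprD expr1.
Qed.

Let sqrt_even m c : (c ^+ 2 == mu ^+ m.*2) = (c == mu ^+ m) || (c == - mu ^+ m).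
Proof. by rewrite -muln2 exprM eqf_sqr. Qed.

Let goods0 (w : K -> rat) : \sum_(p in goods 0) w (p : {poly K})`_0 = w 1.
Proof. by rewrite (card_goods0 cond) big_set1 npolypK ?size_poly1 // coef1. Qed.

(** The constant term is mu^(d/2), with a free middle coefficient, or its opposite, where the middle
    coefficient is 0; hence the two exponents. *)
Lemma sum_goods_even d (w : K -> rat) : 2%:R != 0 :> K -> ~~ odd d -> (0 < d)%N -> (d <= N)%N ->
  \sum_(p in goods d) w (p : {poly K})`_0
  = w (mu ^+ d./2) * q%:R ^+ d./2 + w (- mu ^+ d./2) * q%:R ^+ d./2.-1.
Proof.
move=> nz2 evd d_gt0 le_dN; rewrite sum_goods // evd.
have dE := odd_double_half d; rewrite (negPf evd) add0n in dE.
have ne_m : mu ^+ d./2 != - mu ^+ d./2.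
  by rewrite -subr_eq0 opprK -mulr2n -mulr_natl mulf_neq0 // expf_neq0.
have sqE c : (c ^+ 2 == mu ^+ d) = (c == mu ^+ d./2) || (c == - mu ^+ d./2).
  by rewrite -{1}dE sqrt_even.
rewrite (bigD1 (mu ^+ d./2)) /=; last by rewrite Hmu sqE eqxx.
rewrite eqxx subn0; congr (_ + _).
rewrite (bigD1 (- mu ^+ d./2)) /=; last by rewrite HN ?Hmu //= sqE eqxx orbT eq_sym.
rewrite [- _ == _]eq_sym ne_m subn1 big1 ?addr0 // => c /andP[/andP[/andP[_]]].
by rewrite sqE => /orP[] /eqP->; rewrite eqxx.
Qed.

Lemma card_goods_odd_char d : 2%:R != 0 :> K -> (d <= N)%N ->
  #|goods d|%:R = ell q sqrt_count%:R 1 d.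
Proof.
move=> nz2 le_dN; rewrite -sum1_card natr_sum /ell.
have [->|d_gt0] := posnP d; first by rewrite (goods0 (fun=> 1)).
case: ifP => od.
  rewrite (sum_goods (fun=> 1)) // od /= -(card_sqrt_odd od) -sum1_card natr_sum mulr_suml.
  by apply: eq_big => c; rewrite ?inE // subn0.
by rewrite (sum_goods_even (fun=> 1)) // ?od // !mul1r.
Qed.

Lemma card_goods_char2 d : 2%:R = 0 :> K -> (d <= N)%N ->
  #|goods d|%:R = ell q sqrt_count%:R 0 d.
Proof.
move=> c2 le_dN; rewrite -sum1_card natr_sum /ell.
have [->|d_gt0] := posnP d; first by rewrite (goods0 (fun=> 1)).
case: ifP => od.
  rewrite (sum_goods (fun=> 1)) // od /= -(card_sqrt_odd od) -sum1_card natr_sum mulr_suml.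
  by apply: eq_big => c; rewrite ?inE // subn0.
rewrite mul0r addr0 (sum_goods (fun=> 1)) // od.
have dE := odd_double_half d; rewrite od add0n in dE.
have oppE (c : K) : - c = c.
  by apply/eqP; rewrite -subr_eq0 -opprD -mulr2n -mulr_natl c2 mul0r oppr0.
rewrite (big_pred1 (mu ^+ d./2)) => [|c]; first by rewrite eqxx subn0 mul1r.
rewrite /= -{1}dE sqrt_even oppE orbb.
by case: eqP => [->|]; rewrite ?andbF ?Hmu.
Qed.

(** The sign of a square root of 1 in K, as a rational number. *)
Definition eta (c : K) : rat := if c == 1 then 1 else -1.

(** In odd degree the constant terms 1 and -1 are equally frequent and cancel; in even degree the
    second one changes sign, which turns tau = 1 into tau = -1. *)
Lemma sum_goods_sign d : mu = 1 -> 2%:R != 0 :> K -> (d <= N)%N ->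
  \sum_(p in goods d) eta ((-1) ^+ d * (p : {poly K})`_0) = ell q 0 (-1) d.
Proof.
move=> mu1 nz2 le_dN; rewrite /ell.
have ne1 : (-1 == 1 :> K) = false.
  by rewrite eq_sym -subr_eq0 opprK; apply/negbTE.
have [->|d_gt0] := posnP d.
  by rewrite (goods0 (fun c => eta ((-1) ^+ 0 * c))) mulr1 /eta eqxx.
rewrite -signr_odd; case: ifP => od.
  rewrite (sum_goods (fun c => eta ((-1) ^+ 1 * c))) // od mul0r.
  have dE := odd_double_half d; rewrite od in dE.
  have c1 (c : K) : (c ^+ 2 == mu ^+ d) = (c == 1) || (c == -1).
    by rewrite mu1 expr1n sqrf_eq1.
  rewrite (bigD1 1) /=; last by rewrite H1 c1 eqxx.
  rewrite (bigD1 (-1)) /=; last by rewrite HN // c1 eqxx orbT ne1.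
  rewrite expr1 mulr1 mulrNN mulr1 /eta eqxx ne1 big1 ?addr0 => [|c].
    by rewrite mulN1r mul1r addNr.
  by rewrite c1 => /andP[/andP[/andP[_ /orP[]]]] /eqP-> ; rewrite eqxx.
rewrite expr0 (eq_bigr (fun p : {poly_N.+1 K} => eta (p : {poly K})`_0)).
  by rewrite sum_goods_even ?od // mu1 expr1n /eta eqxx ne1 mul1r.
by move=> p _; rewrite mul1r.
Qed.

End LocalSums.

(** * From tuples of polynomials to products of series *)

Section GeneratingFunction.
Variables (K : finFieldType) (mu : K) (E : pred {poly K}) (N : nat).
Implicit Types x : type_tuple K N.

Lemma types_fixedE x : (x \in types_fixed N mu E) =
  [forall i, good mu E (type_fun x i)]
  && (\sum_(i < N) (N - i) * deg (type_fun x i) == N)%N.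
Proof.
rewrite inE /valid_type -andbA [X in _ && X]andbC andbA; congr (_ && _).
apply/andP/forallP => [[/forallP xv /forallP xf] i|xg].
  by have := xv i; have := xf i; rewrite /good => /andP[-> ->] /andP[-> ->].
by split; apply/forallP => i; case/and4P: (xg i) => [mp p0 rp Ep]; rewrite ?mp ?p0 ?rp ?Ep.
Qed.

(** Expanding the product over all tuples, the exponent of X is the weighted sum of the degrees, so
    coefficient N picks out the degree equation. *)
Lemma sum_types_fixed (w : 'I_N -> {poly K} -> rat) :
  \sum_(x in types_fixed N mu E) \prod_i w i (type_fun x i)
  = (\prod_(i < N) ((\poly_(d < N.+1) \sum_(p in goods mu E N d) w i p) \Po 'X^(N - i)))`_N.
Proof.
transitivity (\prod_(i < N) \sum_(p : {poly_N.+1 K})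
    (if good mu E p then w i p *: 'X^((N - i) * deg p) else 0))`_N; last first.
  congr (polyseq _)`_N; apply: eq_bigr => i _.
  rewrite poly_def raddf_sum /= -big_mkcond /=.
  rewrite (partition_big (fun p : {poly_N.+1 K} => (inord (deg p) : 'I_N.+1)) predT) //=.
  apply: eq_bigr => d _; rewrite linearZ /= comp_Xn_poly -exprM scaler_suml.
  have degE (p : {poly_N.+1 K}) : (inord (deg p) == d) = (deg p == d).
    by rewrite -val_eqE /= inordK // ltnS /deg -subn1 leq_subLR add1n size_npoly.
  apply: eq_big => [p|p /andP[_]]; first by rewrite inE degE.
  by rewrite degE => /eqP->.
rewrite bigA_distr_bigA /= coef_sum [LHS]big_mkcond; apply: eq_bigr => x _ /=.
rewrite types_fixedE.
have [/forallP gx|/forallPn[i ngx]] := boolP [forall i, good mu E (type_fun x i)]; last first.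
  by rewrite /= (bigD1 i) //= ifN ?mul0r ?coef0.
rewrite (eq_bigr (fun i => w i (type_fun x i) *: 'X^((N - i) * deg (type_fun x i)))).
  rewrite scaler_prod -expr_sum coefZ coefXn eq_sym.
  by case: eqP => _; rewrite ?mulr1 ?mulr0.
by move=> i _; rewrite ifT ?gx.
Qed.

End GeneratingFunction.

(** * Power series *)

(** Congruence modulo X^N, which lets polynomials stand for power series. *)
Definition eqX (R : nzRingType) N (a b : {poly R}) := forall k, (k < N)%N -> a`_k = b`_k.

Section EqX.
Variables (R : idomainType) (N : nat).
Implicit Types a b c d : {poly R}.

Lemma eqX_trans a b c : eqX N a b -> eqX N b c -> eqX N a c.
Proof. by move=> ab bc k lt_k; rewrite ab ?bc. Qed.

Lemma eqX_sym a b : eqX N a b -> eqX N b a.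
Proof. by move=> ab k lt_k; rewrite ab. Qed.

Lemma eqXM a b c d : eqX N a b -> eqX N c d -> eqX N (a * c) (b * d).
Proof.
move=> ab cd k lt_k; rewrite !coefM; apply: eq_bigr => j _.
by rewrite ab ?cd // (leq_ltn_trans _ lt_k) ?leq_subr // -ltnS.
Qed.

Lemma eqX_prod (I : Type) (r : seq I) (P : pred I) (f g : I -> {poly R}) :
  (forall i, P i -> eqX N (f i) (g i)) ->
  eqX N (\prod_(i <- r | P i) f i) (\prod_(i <- r | P i) g i).
Proof. by move=> fg; apply: (big_ind2 (eqX N)) => // *; apply: eqXM. Qed.

Lemma eqX_cancel c a b : c`_0 != 0 -> eqX N (c * a) (c * b) -> eqX N a b.
Proof.
move=> c0 cab; elim/ltn_ind => k IH lt_k.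
have := cab k lt_k; rewrite !coefM !big_ord_recl /= subn0.
rewrite [X in _ + X = _](eq_bigr (fun i : 'I_k => c`_(lift ord0 i) * b`_(k - lift ord0 i))).
  by move/addIr/(mulfI c0).
move=> i _; rewrite IH // /bump /=; have := ltn_ord i; first by lia.
by move=> _; rewrite (leq_ltn_trans (leq_subr _ _)).
Qed.

Lemma eqX_comp_Xn a b i : (0 < i)%N -> eqX N a b -> eqX N (a \Po 'X^i) (b \Po 'X^i).
Proof.
move=> i_gt0 ab k lt_k; rewrite !coef_comp_poly_Xn //; case: ifP => // _.
by apply: ab; apply: leq_ltn_trans (leq_div _ _) lt_k.
Qed.

Lemma eqX_prod_widen (f : nat -> {poly R}) k m : (k <= m)%N ->
  (forall i, (k <= i)%N -> eqX N (f i) 1) ->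
  eqX N (\prod_(i < m) f i) (\prod_(i < k) f i).
Proof.
move=> le_km f1; rewrite -!(big_mkord xpredT) (big_cat_nat (leq0n k) le_km) //=.
rewrite -[X in eqX _ _ X]mulr1; apply: eqXM => //.
rewrite -[X in eqX _ _ X](big1_eq (R := {poly R}) (op := *%R) (index_iota k m) xpredT).
rewrite big_nat_cond [X in eqX _ _ X]big_nat_cond.
by apply: eqX_prod => i /andP[/andP[le_ki _] _]; apply: f1.
Qed.

End EqX.

Lemma prod_coef0 (R : idomainType) (I : finType) (f : I -> {poly R}) :
  (forall i, (f i)`_0 = 1) -> (\prod_i f i)`_0 != 0.
Proof.
move=> f1; suff -> : (\prod_i f i)`_0 = 1 by rewrite oner_eq0.
by apply: (big_ind (fun p : {poly R} => p`_0 = 1)) => [|p r p1 r1|//]; rewrite ?coef1 // coef0M p1 r1 mulr1.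
Qed.

Lemma prod_pairs (R : comNzRingType) (f : nat -> R) h :
  \prod_(j < h) (f j.*2 * f j.*2.+1) = \prod_(i < h.*2) f i.
Proof.
elim: h => [|h IH]; first by rewrite !big_ord0.
by rewrite doubleS !big_ord_recr /= IH mulrA.
Qed.

(* Euler's identity (1 + v)(1 + v^2)(1 + v^3)... (1 - v)(1 - v^3)(1 - v^5)... = 1
   at v = X^2. *)
Lemma euler_eqX n :
  eqX n.+1 (\prod_(j < n) (if odd j.+1 then 1 - 'X^(2 * j.+1) else (1 + 'X^(j.+1)) ^+ 2))
    (\prod_(j < n) (1 + 'X^(2 * j.+1)) : {poly rat}).
Proof.
pose f j : {poly rat} := if odd j.+1 then 1 - 'X^(2 * j.+1) else (1 + 'X^(j.+1)) ^+ 2.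
pose g j : {poly rat} := 1 - 'X^(2 * j.+1).
have Xk0 k i : (k < i)%N -> ('X^i : {poly rat})`_k = 0.
  by move=> lt_ki; rewrite coefXn ltn_eqF.
have f1 j : (n <= j)%N -> eqX n.+1 (f j) 1.
  move=> le_nj; have XN i : (n < i)%N -> eqX n.+1 (1 + 'X^i : {poly rat}) 1.
    by move=> lt_ni k lt_k; rewrite coefD Xk0 ?addr0 //; apply: leq_trans lt_ni.
  rewrite /f; case: ifP => _ k lt_k.
    by rewrite coefB Xk0 ?subr0 //; lia.
  by have := eqXM (XN j.+1 le_nj) (XN j.+1 le_nj); rewrite mulr1; apply.
have g1 j : (n <= j)%N -> eqX n.+1 (g j) 1.
  by move=> le_nj k lt_k; rewrite coefB Xk0 ?subr0 //; lia.
have le_n2 : (n <= n.*2)%N by rewrite -addnn leq_addr.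
(* Multiplying by the product of the 1 - v^j and doubling the number of factors [f] makes the
   congruence an exact identity, true for each pair of consecutive factors. *)
apply: (@eqX_cancel _ _ (\prod_(j < n) g j)).
  by apply: prod_coef0 => j; rewrite coefB coef1 coefXn subr0.
apply: (@eqX_trans _ _ _ (\prod_(j < n) g j * \prod_(j < n.*2) f j)).
  by apply: eqXM => //; apply/eqX_sym/eqX_prod_widen.
have -> : \prod_(j < n) g j * \prod_(j < n.*2) f j
    = \prod_(j < n.*2) g j * \prod_(j < n) (1 + 'X^(2 * j.+1)).
  rewrite -!prod_pairs -!big_split; apply: eq_bigr => j _ /=.
  rewrite /f /g /= odd_double /=.
  rewrite (_ : (2 * j.*2.+2)%N = (j.*2.+2 + j.*2.+2)%N) ?exprD; last by lia.
  rewrite (_ : (2 * j.+1)%N = j.*2.+2); last by lia.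
  by ring.
by apply: eqXM => //; apply: eqX_prod_widen.
Qed.

Section EllSeries.
Variables (q : nat) (sigma tau : rat).

Definition ell_poly N : {poly rat} := \poly_(d < N.+1) ell q sigma tau d.

Definition ell_num : {poly rat} := 1 + sigma *: 'X + tau *: 'X^2.

Lemma ell_polyE N : eqX N.+1 ((1 - q%:R *: 'X^2) * ell_poly N) ell_num.
Proof.
move=> k lt_k; rewrite mulrBl mul1r -scalerAl coefB coefZ coefXnM coef_poly lt_k.
rewrite /ell_num !coefD coef1 !coefZ coefX coefXn coef_poly.
have ltk2 : (k - 2 < N.+1)%N by rewrite (leq_ltn_trans (leq_subr _ _)).
rewrite ltk2; case: k {lt_k ltk2} => [|[|[|[|k]]]] //=; rewrite /ell /=.
- by ring.
- by ring.
- by ring.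
- by ring.
- by rewrite !negbK; case: ifP => _; rewrite ?exprS; ring.
Qed.

Lemma ell_poly_comp N i : (0 < i)%N ->
  eqX N.+1 ((1 - q%:R *: 'X^(2 * i)) * (ell_poly N \Po 'X^i)) (ell_num \Po 'X^i).
Proof.
move=> i_gt0; have := eqX_comp_Xn i_gt0 (@ell_polyE N).
rewrite comp_polyM comp_polyB comp_polyC linearZ /= comp_Xn_poly -exprM.
by rewrite mulnC.
Qed.

Lemma ell_poly_comp1 N i : (N < i)%N -> eqX N.+1 (ell_poly N \Po 'X^i) 1.
Proof.
move=> lt_Ni k lt_k; rewrite coef_comp_poly_Xn ?(leq_ltn_trans (leq0n N)) // coef1.
case: k lt_k => [|k] lt_k; first by rewrite dvdn0 div0n coef_poly.
by rewrite gtnNdvd //; apply: leq_trans lt_Ni.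
Qed.

Lemma ell_num_comp i : ell_num \Po 'X^i = 1 + sigma *: 'X^i + tau *: 'X^(2 * i).
Proof.
rewrite /ell_num !comp_polyD !comp_polyZ comp_polyX comp_Xn_poly -exprM mulnC.
by rewrite -[X in X \Po _]/(1%:P) comp_polyC.
Qed.

(** Coefficient n of the infinite product of the L(u^j), since the factors with j > n are 1 modulo
    u^(n+1). *)
Definition ell_coef n : rat := (\prod_(j < n) (ell_poly n \Po 'X^(j.+1)))`_n.

End EllSeries.

(** The left side is the signed count: a quotient of multiplicity j enters the determinant to the
    power j, so its sign survives for odd j only. After clearing denominators this is
    [euler_eqX]. *)
Lemma sign_ell_coef q n :
  (\prod_(j < n) ((if odd j.+1 then ell_poly q 0 (-1) n else ell_poly q 2%:R 1 n) \Po 'X^(j.+1)))`_n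
  = ell_coef q 0 1 n.
Proof.
pose c := \prod_(j < n) (1 - q%:R *: 'X^(2 * j.+1)) : {poly rat}.
apply: (@eqX_cancel _ n.+1 c) (ltnSn n).
  by apply: prod_coef0 => j; rewrite coefB coef1 coefZ coefXn mulr0 subr0.
rewrite /c -!big_split /=; apply: (@eqX_trans _ _ _ (\prod_(j < n) (1 + 'X^(2 * j.+1)))).
  apply: eqX_trans _ (@euler_eqX n); apply: eqX_prod => j _.
  rewrite [odd j.+1]/=; case: (odd j) => /=; apply: eqX_trans (@ell_poly_comp _ _ _ _ _ (ltn0Sn j)) _ => // k _;
    rewrite ell_num_comp; last by rewrite scale0r addr0 scaleN1r.
  by congr (polyseq _)`__; rewrite scale1r scaler_nat mul2n -addnn exprD; ring.
apply/eqX_sym/eqX_prod => j _; apply: eqX_trans (@ell_poly_comp _ _ _ _ _ (ltn0Sn j)) _ => // k _.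
by rewrite ell_num_comp scale0r addr0 scale1r.
Qed.

Section PowerSeries.
Implicit Types (f g : fps) (p r t : {poly rat}).

Definition approx N f p := forall k, (k < N)%N -> f k = p`_k.

Lemma approx_mul N f g p r : approx N f p -> approx N g r -> approx N (fps_mul f g) (p * r).
Proof.
move=> fp gr k lt_k; rewrite coefM; apply: eq_bigr => j _.
by rewrite fp ?gr // (leq_ltn_trans _ lt_k) ?leq_subr // -ltnS.
Qed.

Lemma approx_poly N p : approx N (fps_poly p) p. Proof. by []. Qed.

Lemma approx_frac N p r t : r`_0 != 0 -> eqX N (r * t) p -> approx N (fps_frac p r) t.
Proof.
move=> r0 rt; pose h := \poly_(i < N) fps_inv (fps_poly r) i : {poly rat}.
have hE : approx N (fps_inv (fps_poly r)) h by move=> k lt_k; rewrite coef_poly lt_k.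
have rh : eqX N (r * h) 1.
  move=> k lt_k; rewrite -(approx_mul (@approx_poly N r) hE lt_k).
  exact: fps_mulV.
move=> k lt_k; transitivity (p * h)`_k; first exact: (approx_mul (@approx_poly N p) hE lt_k).
apply: eqX_trans (_ : eqX N (r * t * h) _) _ lt_k.
  by apply: eqXM => //; apply: eqX_sym.
rewrite mulrAC -[X in eqX _ _ X]mul1r.
exact: eqXM.
Qed.

Lemma infprod_ell q sigma tau (P : nat -> {poly rat}) :
  (forall i, (0 < i)%N -> P i = ell_num sigma tau \Po 'X^i) ->
  fps_infprod (fun i => fps_frac (P i) (1 - q%:R *: 'X^(2 * i))) (ell_coef q sigma tau).
Proof.
move=> PE k; exists k => m le_km.
have -> : (\big[fps_mul/fps_poly 1]_(1 <= i < m.+1) fps_frac (P i) (1 - q%:R *: 'X^(2 * i))) k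
    = (\prod_(1 <= i < m.+1) (ell_poly q sigma tau k \Po 'X^i))`_k.
  rewrite big_nat_cond [in RHS]big_nat_cond.
  apply: (big_ind2 (approx k.+1)) (ltnSn k) => // [f p g r|i /andP[/andP[i_gt0 _] _]].
    exact: approx_mul.
  apply: approx_frac; last by rewrite PE //; apply: ell_poly_comp.
  by rewrite coefB coef1 coefZ coefXn (@ltn_eqF 0 (2 * i)) ?muln_gt0 // mulr0 subr0 oner_eq0.
rewrite big_add1 big_mkord.
apply: (@eqX_prod_widen _ k.+1 (fun j => ell_poly q sigma tau k \Po 'X^(j.+1))) (ltnSn k) => // i le_ki.
exact: ell_poly_comp1.
Qed.

End PowerSeries.

(** * The four counts *)

Lemma natr2_eq0 (K : finFieldType) : (2%:R == 0 :> K) = ~~ odd #|K|.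
Proof.
have [p p_pr pK] := finPcharP K.
have pnat : p.-nat #|K|.
  by have /abelem_pgroup := fin_ring_pchar_abelem pK; rewrite /pgroup cardsT.
rewrite -(dvdn_pcharf pK) dvdn_prime2 //; apply/eqP/idP => [p2|ev].
  have := finNzRing_gt1 K; rewrite p2 in pnat; have [k ->] := p_natP pnat.
  by case: k => // k _; rewrite oddX.
move/(pnatP _ (ltnW (finNzRing_gt1 K)))/(_ 2 isT): pnat.
by rewrite dvdn2 ev => /(_ isT); rewrite inE => /eqP.
Qed.

(** * The involution x -> x^q and its elements of norm 1 *)

Section Frobenius.
Variables (q : nat) (K : finFieldType).
Hypothesis cardK : #|K| = (q ^ 2)%N.

(** An iterate of the Frobenius map. It moves some element because X^q - X has at most q roots,
    fewer than q^2. *)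
Lemma frobenius_involution : exists s : {rmorphism K -> K},
  [/\ forall x, s x = x ^+ q, involutive s & exists omega, s omega != omega].
Proof.
have [p p_pr pK] := finPcharP K.
have pnat : p.-nat q.
  have /abelem_pgroup := fin_ring_pchar_abelem pK.
  by rewrite /pgroup cardsT cardK pnatX orbF.
have [k qE] := p_natP pnat.
have [s sE] : exists s : {rmorphism K -> K}, forall x, s x = x ^+ (p ^ k).
  elim: k {qE} => [|k [s sE]]; first by exists idfun => x; rewrite expr1.
  exists [the {rmorphism K -> K} of pFrobenius_aut pK \o s] => x.
  by rewrite /= pFrobenius_autE sE -exprM expnSr.
rewrite -qE in sE; exists s; split=> //.
  by move=> x; rewrite !sE -exprM -[X in _ ^+ X]cardK expf_card.
have q_gt1 : (1 < q)%N.
  by have := finNzRing_gt1 K; rewrite cardK -{1}(exp1n 2) ltn_exp2r.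
case: (pickP (fun x => s x != x)) => [w|all_fix]; first by exists w.
have szP : size ('X^q - 'X : {poly K}) = q.+1.
  by rewrite size_polyDl size_polyXn // size_polyN size_polyX ltnS.
have := @max_poly_roots _ ('X^q - 'X) (enum K).
rewrite -size_poly_eq0 szP => /(_ isT).
have -> : all (root ('X^q - 'X)) (enum K).
  apply/allP => x _; rewrite rootE !hornerE ?hornerXn -sE.
  by rewrite subr_eq0; have /negbFE := all_fix x.
rewrite enum_uniq -cardE cardK => /(_ isT isT).
by rewrite ltnS leqNgt -{1}(expn1 q) ltn_exp2l.
Qed.

Variables (s : {rmorphism K -> K}) (omega : K).
Hypotheses (sE : forall x, s x = x ^+ q) (sK : involutive s) (s_omega : s omega != omega).

Let q_gt1 : (1 < q)%N.
Proof. by have := finNzRing_gt1 K; rewrite cardK -{1}(exp1n 2) ltn_exp2r. Qed.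

Lemma card_fixed_field : #|[set b | s b == b]| = q.
Proof.
set K0 := [set b | _]; apply/eqP; rewrite eqn_leq; apply/andP; split.
  have szP : size ('X^q - 'X : {poly K}) = q.+1.
    by rewrite size_polyDl size_polyXn // size_polyN size_polyX ltnS.
  have := @max_poly_roots _ ('X^q - 'X) (enum K0).
  rewrite -size_poly_eq0 szP => /(_ isT); rewrite enum_uniq -cardE ltnS; apply=> //.
  apply/allP => x; rewrite mem_enum inE sE rootE !hornerE ?hornerXn => /eqP->.
  by rewrite subrr.
rewrite -(leq_exp2r _ _ (isT : (0 < 2)%N)) -cardK -cardsT.
(* The traces of b and of omega b lie in the fixed field and determine b, so the fixed field has at
   least q elements. *)
pose f b := (b + s b, omega * b + s (omega * b)).
have fI : injective f.
  move=> a b [e1 e2]; apply/eqP; rewrite -subr_eq0.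
  have sab : s (a - b) = - (a - b).
    rewrite rmorphB; apply/eqP; rewrite -addr_eq0; apply/eqP.
    by rewrite addrACA -opprD [s a + a]addrC [s b + b]addrC e1 subrr.
  have : (omega - s omega) * (a - b) = 0.
    rewrite mulrBl -[s omega * _]opprK -mulrN -sab -rmorphM opprK mulrBr rmorphB.
    by rewrite addrACA -opprD e2 subrr.
  by move/eqP; rewrite mulf_eq0 [omega - _ == _]subr_eq0 [omega == _]eq_sym (negPf s_omega).
rewrite -(card_imset _ fI) expnS expn1 -cardsX subset_leq_card //.
by apply/subsetP => _ /imsetP[b _ ->]; rewrite !inE /= !rmorphD !sK ![s _ + _]addrC !eqxx.
Qed.

(** Every c + a s(c) is a solution; c = 1 gives a nonzero one unless a = -1, and then c = omega
    does. *)
Lemma norm1_quotient a : a ^+ q.+1 = 1 -> exists2 y, y != 0 & y = a * s y.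
Proof.
move=> a1; have asa : a * s a = 1 by rewrite sE -exprS.
have yP c : c + a * s c = a * s (c + a * s c).
  by rewrite rmorphD rmorphM sK mulrDr mulrA asa mul1r addrC.
have [y1|y1] := eqVneq (1 + a * s 1) 0; last by exists (1 + a * s 1).
exists (omega + a * s omega) => //.
have aE : a = -1 by move: y1; rewrite rmorph1 mulr1 => /eqP; rewrite addrC addr_eq0 => /eqP.
by rewrite aE mulN1r subr_eq0 eq_sym.
Qed.

(** Eliminating the mirror coefficient from the two symmetries leaves s(a) mu^(d-i) = a for the
    coefficient a of X^i. For the constant term c, where c^2 = mu^d, this says that c has norm 1. *)
Lemma recip_conditions_U mu : mu ^+ q.+1 = 1 ->
  recip_conditions mu (selfadj s) q (fun d i => [set a | s a * mu ^+ (d - i) == a])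
    [set a | a ^+ q.+1 == 1].
Proof.
move=> mu1; have nz_mu : mu != 0.
  by apply: contra_eq_neq mu1 => ->; rewrite exprS mul0r eq_sym oner_neq0.
have smu : s mu = mu^-1 by apply: (mulfI nz_mu); rewrite sE -exprS mu1 divff.
have s_sq d c : c ^+ 2 = mu ^+ d -> s c * mu ^+ d = c -> c != 0 -> s c = c^-1.
  by move=> <- scE c0; apply: (mulIf (expf_neq0 2 c0)); rewrite scE expr2 mulrA mulVf ?mul1r.
split=> //.
- by move=> d i; rewrite inE rmorph0 mul0r.
- by move=> d; rewrite inE subnn rmorph1 mulr1.
(* With y = mu s(y), the solutions form the line y^(d-i) times the fixed field, which has q
   elements. *)
- move=> d i; have [y nzy yE] := norm1_quotient mu1.
  have nzyk : y ^+ (d - i) != 0 by rewrite expf_neq0.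
  rewrite -[RHS]card_fixed_field -[RHS](card_imset _ (mulfI nzyk)); apply: eq_card => a.
  have ykE : s (y ^+ (d - i)) * mu ^+ (d - i) = y ^+ (d - i).
    by rewrite rmorphXn -exprMn mulrC -yE.
  rewrite inE; apply/eqP/imsetP => [aT|[b]]; last first.
    by rewrite inE => /eqP sb ->; rewrite rmorphM sb mulrAC ykE.
  exists (a / y ^+ (d - i)); last by rewrite mulrC divfK.
  rewrite inE -(inj_eq (mulIf nzyk)) divfK // -{2}ykE fmorph_div mulrA divfK ?aT //.
  by rewrite fmorph_eq0.
- move=> d i a c le_id; rewrite !inE subn0 => /eqP cT c2 /eqP aT.
  have nzc : c != 0 by rewrite -sqrf_eq0 c2 expf_neq0.
  have sc := s_sq _ _ c2 cT nzc.
  have saE : s a = a / mu ^+ (d - i) by rewrite -[in RHS]aT mulfK // expf_neq0.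
  have cV : c^-1 = c / (mu ^+ (d - i) * mu ^+ i).
    by rewrite -exprD subnK // -c2 expr2 invfM mulrA divff // mul1r.
  rewrite subKn // !rmorphM rmorphXn fmorphV sc smu invrK saE cV exprVn; apply/eqP.
  have := expf_neq0 (d - i) nz_mu; have := expf_neq0 i nz_mu.
  by move: (mu ^+ (d - i)) (mu ^+ i) => x y y0 x0; field; rewrite x0 y0.
- move=> p mp p0 /(recip_fixedP _ (monic_neq0 mp)); set d := deg p; set c := p`_0 => rp.
  have pd : p`_d = 1 by apply/eqP.
  have c2 : c ^+ 2 = mu ^+ d.
    have := rp 0%N isT; rewrite subn0 pd mul1r -/c => /(congr1 ( *%R c)).
    by rewrite mulrA divff // mul1r -expr2.
  have dE : deg (map_poly s p) = d by rewrite /deg size_map_poly.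
  have mapE : selfadj s p <-> forall i, (i <= d)%N -> p`_i = (s c)^-1 * s p`_(d - i).
    rewrite /selfadj; split=> [/eqP sp i le_id|sp].
      by rewrite -[in LHS]sp coef_recip dE // !coef_map expr1n mulr1.
    apply/eqP/polyP => i; have [le_id|lt_di] := leqP i d.
      by rewrite coef_recip dE // !coef_map expr1n mulr1 -sp.
    have nzs : map_poly s p != 0 by rewrite map_poly_eq0 monic_neq0.
    rewrite !nth_default // ?(leq_trans (size_recip_le _ nzs)) ?size_map_poly //;
      by rewrite polySpred ?monic_neq0.
  apply/idP/forallP => [/mapE sp i|pT]; last first.
    apply/mapE => i le_id.
    have := pT ord0; rewrite inE subn0 => /eqP cT.
    rewrite (s_sq d) // invrK.
    have lt_di : (d - i < d.+1)%N by rewrite ltnS leq_subr.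
    have := pT (Ordinal lt_di); rewrite inE /= subKn // => /eqP eT.
    rewrite [LHS]rp // -/d -[in LHS]eT -mulrA -exprD subnKC // -c2 -/c; field.
    exact: p0.
  have le_id : (i <= d)%N by rewrite -ltnS.
  rewrite inE; have csc : s c = c^-1.
    have := sp 0%N isT; rewrite subn0 pd rmorph1 mulr1 -/c => cE.
    by rewrite [in RHS]cE invrK.
  have := sp (d - i)%N (leq_subr _ _); rewrite subKn // csc invrK => pE.
  apply/eqP; rewrite [RHS]rp // -/d pE -/c; field.
  exact: p0.
- move=> d c c2; rewrite !inE subn0 sE -c2.
  have nzc : c != 0 by rewrite -sqrf_eq0 c2 expf_neq0.
  by rewrite expr2 mulrA -exprSr -[X in _ * c == X]mul1r (inj_eq (mulIf nzc)).
- by move=> c k; rewrite !inE exprMn -exprM mulnC exprM mu1 expr1n mulr1.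
- by rewrite inE expr1n.
- move=> c; rewrite !inE => /eqP c1.
  by rewrite exprNn c1 mulr1 exprS -sE rmorphN1 mulrNN mulr1.
Qed.

End Frobenius.

Lemma recip_conditions_GL (F : finFieldType) (mu : F) : mu != 0 ->
  recip_conditions mu predT #|F| (fun _ _ => setT) [set a | a != 0].
Proof.
move=> nz_mu; split=> //; try by move=> *; rewrite inE.
- by move=> d i; exact: cardsT.
- by move=> p _ _ _; apply/esym/forallP => i; rewrite inE.
- move=> d c c2; rewrite !inE; apply/esym; by rewrite -sqrf_eq0 c2 expf_neq0.
- by move=> c k; rewrite !inE mulf_eq0 expf_eq0 (negPf nz_mu) andbF orbF.
- by rewrite inE oner_neq0.
- by move=> c; rewrite !inE oppr_eq0.
Qed.

(** * Averages over central scalars, and determinant signs *)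

Section Assembly.
Variables (K : finFieldType) (q N : nat) (E : pred {poly K}) (H : {set K}).

Definition char_odd := 2%:R != 0 :> K.

Lemma prod_ord_rev (R : comNzRingType) (f : nat -> R) :
  \prod_(i < N) f (N - i)%N = \prod_(j < N) f j.+1.
Proof.
rewrite [RHS](reindex_inj rev_ord_inj); apply: eq_bigr => i _ /=.
by rewrite subnSK.
Qed.

Lemma card_types_fixed mu T tau : recip_conditions mu E q T H ->
  (forall d, (d <= N)%N -> #|goods mu E N d|%:R = ell q (sqrt_count mu H)%:R tau d) ->
  #|types_fixed N mu E|%:R = ell_coef q (sqrt_count mu H)%:R tau N.
Proof.
move=> cond goodsE; rewrite -sum1_card natr_sum.
transitivity (\sum_(x in types_fixed N mu E) \prod_(i < N) (1 : rat)).
  by apply: eq_bigr => x _; rewrite big1.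
rewrite (sum_types_fixed mu E (fun _ _ => 1)) /ell_coef.
rewrite -(prod_ord_rev (fun j => ell_poly q (sqrt_count mu H)%:R tau N \Po 'X^j)).
congr (polyseq _)`_N; apply: eq_bigr => i _; congr (_ \Po _).
apply/polyP => d; rewrite !coef_poly ltnS; case: ifP => // le_dN.
by rewrite -goodsE // -sum1_card natr_sum.
Qed.

Lemma card_types_fixed_odd mu T : char_odd -> recip_conditions mu E q T H ->
  #|types_fixed N mu E|%:R = ell_coef q (sqrt_count mu H)%:R 1 N.
Proof. by move=> odd_K cond; apply: (card_types_fixed cond) => d; apply: (card_goods_odd_char cond). Qed.

Lemma card_types_fixed_char2 mu T : 2%:R = 0 :> K -> recip_conditions mu E q T H ->
  #|types_fixed N mu E|%:R = ell_coef q (sqrt_count mu H)%:R 0 N.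
Proof. by move=> K2 cond; apply: (card_types_fixed cond) => d; apply: (card_goods_char2 cond). Qed.

Hypothesis H1 : 1 \in H.
Hypothesis cond : forall mu, mu \in H -> exists T, recip_conditions mu E q T H.

Lemma group_sqr c : c \in H -> c ^+ 2 \in H.
Proof. by move=> cH; have [T cT] := cond cH; rewrite expr2 -{2}[c]expr1 (rc_group_mul cT). Qed.

(** Each element of [H] is a square root of exactly one element of [H]. *)
Lemma sum_sqrt_count : (\sum_(mu in H) sqrt_count mu H = #|H|)%N.
Proof.
rewrite -[RHS]sum1_card [RHS](partition_big (fun c => c ^+ 2) (mem H)) /=; last exact: group_sqr.
apply: eq_bigr => mu _; rewrite /sqrt_count -sum1_card; apply: eq_bigl => c.
by rewrite inE.
Qed.

Lemma sqrt_count_odd mu : char_odd -> mu \in H -> (sqrt_count mu H == 0%N) || (sqrt_count mu H == 2%N).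
Proof.
move=> odd_K muH; have [T cT] := cond muH; rewrite /sqrt_count.
have [->|[c]] := set_0Vmem [set c in H | c ^+ 2 == mu]; first by rewrite cards0.
rewrite inE => /andP[cH /eqP c2].
have nzc : c != 0 by rewrite -sqrf_eq0 c2 (rc_neq0 cT).
have -> : [set c in H | c ^+ 2 == mu] = [set c; - c].
  apply/setP => b; rewrite !inE -c2 eqf_sqr.
  by apply/andP/orP => [[_ /orP]//|[]/eqP->]; rewrite ?eqxx ?orbT ?(rc_groupN cT).
rewrite cards2 (_ : c != - c) //.
by rewrite -subr_eq0 opprK -mulr2n -mulr_natl mulf_neq0.
Qed.

(** In characteristic 2 there is at most one square root, and the average is 1. *)
Lemma sqrt_count_char2 mu : 2%:R = 0 :> K -> mu \in H -> sqrt_count mu H = 1%N.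
Proof.
move=> K2 muH; have le1 nu : (sqrt_count nu H <= 1)%N.
  apply/card_le1_eqP => a b; rewrite !inE => /andP[_ /eqP a2] /andP[_ /eqP b2].
  have bN : - b = b by apply/eqP; rewrite -subr_eq0 -opprD -mulr2n -mulr_natl K2 mul0r oppr0.
  have := eqf_sqr a b; rewrite a2 b2 eqxx bN orbb => /esym/eqP ->.
  by [].
apply/eqP; rewrite eqn_leq le1 /= leqNgt ltnS leqn0; apply/negP => /eqP s0.
have := sum_sqrt_count; rewrite (bigD1 mu) //= s0 add0n => sH.
have : (#|H| <= #|H :\ mu|)%N.
  rewrite -{1}sH -sum1_card [leqRHS](eq_bigl (fun nu => (nu \in H) && (nu != mu))).
    by apply: leq_sum => nu _; apply: le1.
  by move=> nu; rewrite !inE andbC.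
by rewrite (cardsD1 mu H) muH ltnn.
Qed.

(** The count is A or B according as mu has 2 or 0 square roots, hence affine in that number; its
    average 1 yields the midpoint. *)
Lemma average_odd R : char_odd -> (#|H| * R = \sum_(mu in H) #|types_fixed N mu E|)%N ->
  R%:R = 2%:R^-1 * (ell_coef q 2%:R 1 N + ell_coef q 0 1 N).
Proof.
move=> odd_K HR; set A := ell_coef _ _ _ _; set B := ell_coef _ _ _ _.
have XE mu : mu \in H ->
    #|types_fixed N mu E|%:R = (sqrt_count mu H)%:R * (2%:R^-1 * (A - B)) + B.
  move=> muH; have [T cT] := cond muH; rewrite (card_types_fixed_odd odd_K cT).
  by have := sqrt_count_odd odd_K muH => /orP[] /eqP->; rewrite -/A -/B; field.
have nzH : #|H|%:R != 0 :> rat.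
  by rewrite Num.Theory.pnatr_eq0 (cardsD1 1 H) H1.
apply: (mulfI nzH); rewrite -natrM HR natr_sum (eq_bigr _ XE) big_split /= -mulr_suml.
by rewrite -natr_sum sum_sqrt_count sumr_const -mulr_natl; field.
Qed.

Lemma average_char2 R : 2%:R = 0 :> K -> (#|H| * R = \sum_(mu in H) #|types_fixed N mu E|)%N ->
  R%:R = ell_coef q 1 0 N.
Proof.
move=> K2 HR; have XE mu : mu \in H -> #|types_fixed N mu E|%:R = ell_coef q 1 0 N.
  by move=> muH; have [T cT] := cond muH; rewrite (card_types_fixed_char2 K2 cT) sqrt_count_char2.
have nzH : #|H|%:R != 0 :> rat by rewrite Num.Theory.pnatr_eq0 (cardsD1 1 H) H1.
apply: (mulfI nzH); rewrite -natrM HR natr_sum (eq_bigr _ XE) sumr_const.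
by rewrite mulr_natl.
Qed.

Lemma fixed_coef0 x i : x \in types_fixed N 1 E -> ((type_fun x i)`_0) ^+ 2 = 1.
Proof.
have [T cT] := cond H1; rewrite types_fixedE => /andP[/forallP/(_ i) gx _].
by have [-> _] := good_coef0 cT gx; rewrite expr1n.
Qed.

(** The constant terms square to 1, and 1 is its own opposite. *)
Lemma sign_char2 x : 2%:R = 0 :> K -> x \in types_fixed N 1 E -> type_sign x = 1.
Proof.
move=> K2 Ex; rewrite /type_sign big1 // => i _.
have oppE (c : K) : - c = c by apply/eqP; rewrite -subr_eq0 -opprD -mulr2n -mulr_natl K2 mul0r oppr0.
have /eqP := fixed_coef0 i Ex; rewrite sqrf_eq1 !oppE orbb => /eqP->.
by rewrite !expr1n mulr1 expr1n.
Qed.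

Lemma card_sign_char2 : 2%:R = 0 :> K ->
  #|[set x in types_fixed N 1 E | type_sign x == 1]|%:R = ell_coef q 1 0 N.
Proof.
move=> K2; have [T cT] := cond H1.
have := card_types_fixed_char2 K2 cT; rewrite sqrt_count_char2 // => <-.
congr _%:R; apply: eq_card => x; rewrite inE; case Ex: (x \in _) => //=.
by rewrite (sign_char2 K2 Ex) eqxx.
Qed.

Lemma eta_prod (I : finType) (f : I -> K) : char_odd -> (forall i, f i ^+ 2 = 1) ->
  eta (\prod_i f i) = \prod_i eta (f i).
Proof.
move=> odd_K f2; have ne1 : (-1 == 1 :> K) = false.
  by rewrite eq_sym -subr_eq0 opprK; apply/negbTE.
suff [] : (\prod_i f i) ^+ 2 = 1 /\ eta (\prod_i f i) = \prod_i eta (f i) by [].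
apply: (big_ind2 (fun a b => a ^+ 2 = 1 /\ eta a = b)) => //.
  by rewrite expr1n /eta eqxx.
move=> a _ b _ [a2 <-] [b2 <-]; rewrite exprMn a2 b2 mulr1; split=> //.
move/eqP: a2; move/eqP: b2; rewrite !sqrf_eq1 /eta.
by case/orP=> /eqP->; case/orP=> /eqP->; rewrite ?mulrNN ?mulr1 ?mul1r ?eqxx ?ne1 ?mulrNN ?mulr1 ?mul1r.
Qed.

Lemma eta_exp (a : K) k : char_odd -> a ^+ 2 = 1 -> eta (a ^+ k) = if odd k then eta a else 1.
Proof.
move=> odd_K a2; rewrite -{1}(odd_double_half k) exprD -muln2 mulnC exprM a2 expr1n mulr1.
by case: (odd k); rewrite ?expr1 // expr0 /eta eqxx.
Qed.

(** The indicator of determinant 1 is (1 + eps) / 2. The term 1 gives the count at mu = 1, which has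
    the two square roots 1 and -1; the term eps gives the signed product. *)
Lemma card_sign_odd : char_odd ->
  #|[set x in types_fixed N 1 E | type_sign x == 1]|%:R
  = 2%:R^-1 * (ell_coef q 2%:R 1 N + ell_coef q 0 1 N).
Proof.
move=> odd_K; have [T cT] := cond H1.
have s2 : sqrt_count 1 H = 2%N.
  have := sqrt_count_odd odd_K H1; rewrite orbC => /orP[/eqP//|].
  rewrite cards_eq0 => /eqP/setP/(_ 1).
  by rewrite !inE H1 expr1n eqxx.
pose eps (x : type_tuple K N) := eta (type_sign x).
have sum_eps : \sum_(x in types_fixed N 1 E) eps x = ell_coef q 0 1 N.
  pose w (i : 'I_N) (p : {poly K}) :=
    if odd (N - i) then eta ((-1) ^+ deg p * p`_0) else 1.
  transitivity (\sum_(x in types_fixed N 1 E) \prod_(i < N) w i (type_fun x i)).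
    apply: eq_bigr => x Ex.
    have x2 i : ((-1) ^+ deg (type_fun x i) * (type_fun x i)`_0) ^+ 2 = 1.
      by rewrite exprMn (fixed_coef0 _ Ex) mulr1 sqrr_sign.
    rewrite /eps /type_sign eta_prod // => [|i]; last by rewrite -exprM mulnC exprM x2 expr1n.
    by apply: eq_bigr => i _; rewrite eta_exp.
  rewrite sum_types_fixed -sign_ell_coef.
  rewrite -(prod_ord_rev (fun j => (if odd j then ell_poly q 0 (-1) N else ell_poly q 2%:R 1 N) \Po 'X^j)).
  congr (polyseq _)`_N; apply: eq_bigr => i _; congr (_ \Po _).
  rewrite /w; case: ifP => _; apply/polyP => d; rewrite !coef_poly ltnS; case: ifP => // le_dN.
    rewrite -(@sum_goods_sign _ _ _ _ _ _ cT N d) //; apply: eq_bigr => p; rewrite inE => /andP[_ /eqP->].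
    by [].
  by rewrite -s2 -(card_goods_odd_char cT odd_K le_dN) -sum1_card natr_sum.
rewrite -s2 -(card_types_fixed_odd odd_K cT) -sum_eps -!sum1_card !natr_sum -big_split mulr_sumr.
rewrite (eq_bigl (fun x => (x \in types_fixed N 1 E) && (type_sign x == 1))); last by move=> x; rewrite inE.
rewrite big_mkcondr; apply: eq_bigr => x Ex /=; rewrite /eps /eta.
by rewrite s2; case: (_ == 1) => /=; field.
Qed.

End Assembly.

(** * The trivial groups at n = 0 *)

Section Trivial.
Variables (gT : finGroupType).

Lemma classes_trivial : classes (1%g : {set gT}) = [set 1%g].
Proof. by rewrite /classes imset_set1 class1G. Qed.

Lemma card_real_classes1 (G : {set gT}) : G = 1%g -> #|real_classes G| = 1%N.
Proof.
move=> ->; rewrite (_ : real_classes _ = [set 1%g]) ?cards1 //; apply/setP => C.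
rewrite inE classes_trivial inE; case: eqP => //= ->.
by apply/forall_inP => g /set1P->; rewrite /real_elt invg1 class_refl.
Qed.

Lemma card_real_classes_in1 (G S : {set gT}) :
  G = 1%g -> 1%g \in S -> #|real_classes_in G S| = 1%N.
Proof.
move=> G1 S1; rewrite -(card_real_classes1 G1); apply: eq_card => C; rewrite !inE.
by rewrite G1 classes_trivial inE; case: eqP => //= ->; rewrite sub1set S1 andbT.
Qed.

End Trivial.

Lemma ell_coef0 q sigma tau : ell_coef q sigma tau 0 = 1.
Proof. by rewrite /ell_coef big_ord0 coef1. Qed.

(** For even q the two products coincide; the repeated summand keeps the half-sum shape of the
    generating function. *)
Lemma common_count (q : nat) (F K : finFieldType) (hF : #|F| = q) (hK : #|K| = (q ^ 2)%N) n
    (e := gcdn (q - 1) 2) :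
  let v := 2%:R^-1 * (if e == 2%N then ell_coef q 2%:R 1 n + ell_coef q 0 1 n
                      else ell_coef q 1 0 n + ell_coef q 1 0 n) in
  [/\ #|real_classes (PGLn n F)|%:R = v, #|real_classes_in (GLn n F) (SLn n F)|%:R = v,
      #|real_classes (PGUn q n K)|%:R = v & #|real_classes_in (Un q n K) (SUn q n K)|%:R = v].
Proof.
have q_gt1 : (1 < q)%N by rewrite -hF finNzRing_gt1.
have eE : e = if odd q then 2%N else 1%N.
  rewrite /e gcdnC; case: ifP => oq.
    by apply/gcdn_idPl; rewrite dvdn2 oddB ?(ltnW q_gt1) // oq.
  by apply/eqP; rewrite -/(coprime 2 _) prime_coprime // dvdn2 oddB ?(ltnW q_gt1) // oq.
have [->|n_gt0] := posnP n.
  rewrite !ell_coef0 if_same /=.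
  have GF1 : GLn 0 F = 1%g :> {set _} by [].
  have UK1 : Un q 0 K = 1%g :> {set _}.
    apply/eqP; rewrite eqEsubset sub1set -[Un q 0 K]/(gval (Group (Un_group_set 0 hK))) group1 andbT.
    by apply/subsetP => g; rewrite inE => /andP[].
  have -> : 2%:R^-1 * (1 + 1) = 1 :> rat by field.
  have one (k : nat) : k = 1%N -> k%:R = 1 :> rat by move=> ->.
  split; apply: one.
  - by apply: card_real_classes1; rewrite /PGLn GF1 quotient1.
  - by apply: card_real_classes_in1; rewrite // inE group1 GL_1E det1 eqxx.
  - by apply: card_real_classes1; rewrite /PGUn UK1 quotient1.
  - by apply: card_real_classes_in1; rewrite // inE UK1 inE eqxx GL_1E det1 eqxx.
have [s [sE sK [omega s_omega]]] := frobenius_involution hK.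
pose HF : {set F} := [set a | a != 0]; pose HK : {set K} := [set a | a ^+ q.+1 == 1].
have condF mu : mu \in HF -> exists T, recip_conditions mu predT q T HF.
  by rewrite inE => nz; exists (fun _ _ => setT); rewrite -hF; apply: recip_conditions_GL.
have condK mu : mu \in HK -> exists T, recip_conditions mu (selfadj s) q T HK.
  rewrite inE => /eqP mu1; eexists.
  exact: (recip_conditions_U hK sE sK s_omega mu1).
have HF1 : 1 \in HF by rewrite inE oner_neq0.
have HK1 : 1 \in HK by rewrite inE expr1n.
have PGL : (#|HF| * #|real_classes (PGLn n F)|
    = \sum_(mu in HF) #|types_fixed n.-1.+1 mu predT|)%N.
  rewrite -[#|HF|](@eq_card _ [pred a : F | a != 0]) => [|a]; last by rewrite !inE.
  by rewrite card_real_PGLn //; apply: eq_bigl => a; rewrite inE.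
have PGU : (#|HK| * #|real_classes (PGUn q n K)|
    = \sum_(mu in HK) #|types_fixed n.-1.+1 mu (selfadj s)|)%N.
  rewrite -[#|HK|](@eq_card _ [pred a : K | a ^+ q.+1 == 1]) => [|a]; last by rewrite !inE.
  by rewrite (card_real_PGUn n_gt0 hK sE sK s_omega) //; apply: eq_bigl => a; rewrite inE.
rewrite (card_real_SLn _ n_gt0) (card_real_SUn n_gt0 hK sE sK s_omega).
rewrite -(prednK n_gt0) in PGL PGU *.
have oddF := natr2_eq0 F; have oddK := natr2_eq0 K; rewrite hF in oddF; rewrite hK oddX /= in oddK.
rewrite eE; case oq: (odd q) => /=; rewrite oq /= in oddF oddK.
  have nzF : char_odd F by rewrite /char_odd oddF.
  have nzK : char_odd K by rewrite /char_odd oddK.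
  split.
  - exact: (average_odd HF1 condF).
  - exact: (card_sign_odd _ HF1 condF).
  - exact: (average_odd HK1 condK).
  - exact: (card_sign_odd _ HK1 condK).
have -> : forall x : rat, 2%:R^-1 * (x + x) = x by move=> x; field.
split.
- exact: (average_char2 HF1 condF (eqP oddF) PGL).
- exact: (card_sign_char2 _ HF1 condF (eqP oddF)).
- exact: (average_char2 HK1 condK (eqP oddK) PGU).
- exact: (card_sign_char2 _ HK1 condK (eqP oddK)).
Qed.

Theorem theorem4p1 (q : nat)
    (hq : exists p k : nat, [/\ prime p, (0 < k)%N & q = (p ^ k)%N])
    (F K : finFieldType) (hF : #|F| = q) (hK : #|K| = (q ^ 2)%N) :
  exists c : nat -> nat,
    (forall n : nat,
      [/\ #|real_classes (PGLn n F)| = c n,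
          #|real_classes_in (GLn n F) (SLn n F)| = c n,
          #|real_classes (PGUn q n K)| = c n
        & #|real_classes_in (Un q n K) (SUn q n K)| = c n]) /\
    let e := gcdn (q - 1) 2 in
    exists A B : fps,
      [/\ fps_infprod (fun i : nat =>
            fps_frac ((1 + 'X^i) ^+ e) (1 - q%:R *: 'X^(2 * i))) A,
          fps_infprod (fun i : nat =>
            fps_frac (1 + 'X^(e * i)) (1 - q%:R *: 'X^(2 * i))) B
        & forall n : nat, (c n)%:R = 2%:R^-1 * (A n + B n)].
Proof.
exists (fun n => #|real_classes (PGLn n F)|); split=> [n|e].
  have [h1 h2 h3 h4] := common_count hF hK n.
  by split=> //; apply/eqP; rewrite -(Num.Theory.eqr_nat rat) ?h2 ?h3 ?h4 h1.
pose b := e == 2%N.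
have eE : e = if b then 2%N else 1%N.
  have : (e %| 2)%N by apply: dvdn_gcdr.
  by rewrite /b dvdn_divisors // => /[!inE] /orP[] /eqP->.
exists (if b then ell_coef q 2%:R 1 else ell_coef q 1 0).
exists (if b then ell_coef q 0 1 else ell_coef q 1 0).
split=> [||n]; last first.
- by have [-> _ _ _] := common_count hF hK n; rewrite -/e -/b; case: (b).
- rewrite eE; case: (b); apply: infprod_ell => i i_gt0; rewrite ell_num_comp.
    by rewrite scale0r addr0 scale1r.
  by rewrite scale0r addr0 scale1r mul1n.
rewrite eE; case: (b); apply: infprod_ell => i i_gt0; rewrite ell_num_comp.
  by rewrite scale1r scaler_nat mul2n -addnn exprD; ring.
by rewrite scale0r addr0 scale1r expr1.
Qed.
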